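(* For every integer $d\ge 1$ there is a constant $C_d$, depending only on $d$, such that the following holds. Let $n_1,\dots,n_d\ge 1$ be integers, $n=n_1\cdots n_d$, let $\mathbf x_1,\dots,\mathbf x_n$ be an enumeration of the lattice design $\mathbb L_{n_1,\dots,n_d}$, let $\sigma>0$, let $f^*\in\mathcal F_{\mathrm{EM}}^d$, and let $V^*:=V_{\mathrm{HK}\mathbf 0}(f^*;[0,1]^d)$. Let $y_i=f^*(\mathbf x_i)+\xi_i$ with $\xi_1,\dots,\xi_n$ i.i.d. $N(0,\sigma^2)$, and let $$\hat f_{\mathrm{EM}}\in\operatorname*{arg\,min}_{f\in\mathcal F_{\mathrm{EM}}^d}\frac1n\sum_{i=1}^n (y_i-f(\mathbf x_i))^2 .$$ Then $$\mathcal R(\hat f_{\mathrm{EM}},f^* )\le C_d\left(\frac{\sigma^2V^*}{n}\right)^{2/3}\left(\log\left(2+\frac{V^*\sqrt n}{\sigma}\right)\right)^{\frac{2d-1}{3}}+C_d\frac{\sigma^2}{n}(\log(en))^{\frac{3d}{2}}(\log(e\log(en)))^{\frac{2d-1}{2}} .$$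
   Context: Notation: $\mathbf 0=(0,\dots,0)$, $\mathbf 1=(1,\dots,1)$; $\mathbf a\preceq\mathbf b$ means $a_j\le b_j$ for all $j$; for $\mathbf a\preceq\mathbf b$, $[\mathbf a,\mathbf b]=\prod_j[a_j,b_j]$. Quasi-volume: for $f:[0,1]^d\to\mathbb R$ and distinct $\mathbf a\preceq\mathbf b$ in $[0,1]^d$, $$\Delta(f;[\mathbf a,\mathbf b])=\sum_{j_1=0}^{J_1}\cdots\sum_{j_d=0}^{J_d}(-1)^{j_1+\dots+j_d}f(b_1+j_1(a_1-b_1),\dots,b_d+j_d(a_d-b_d)),$$ where $J_i=1$ if $a_i\ne b_i$ and $J_i=0$ otherwise. Entire monotonicity: $\mathcal F_{\mathrm{EM}}^d$ is the class of all $f:[0,1]^d\to\mathbb R$ with $\Delta(f;[\mathbf a,\mathbf b])\ge 0$ for all $\mathbf a\ne\mathbf b$ in $[0,1]^d$ with $\mathbf a\preceq\mathbf b$. Vitali variation: given univariate partitions $0=x^{(s)}_0<\dots<x^{(s)}_{k_s}=1$, $s=1,\dots,d$, the split they generate is the collection $\mathcal P$ of all rectangles $\prod_{s=1}^d[x^{(s)}_{l_s},x^{(s)}_{l_s+1}]$, $0\le l_s\le k_s-1$. Set $V^{(d)}(f;[0,1]^d)=\sup_{\mathcal P}\sum_{A\in\mathcal P}|\Delta(f;A)|$, supremum over all such splits. HK$\mathbf 0$ variation (Hardy–Krause variation anchored at $\mathbf 0$): for nonempty $S\subseteq\{1,\dots,d\}$ let $f_S:[0,1]^{|S|}\to\mathbb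 R$ be the restriction of $f$ to $\{\mathbf u\in[0,1]^d:u_j=0\ \forall j\notin S\}$, viewed as a function of the coordinates in $S$. Then $V_{\mathrm{HK}\mathbf 0}(f;[0,1]^d)=\sum_{\varnothing\ne S\subseteq\{1,\dots,d\}}V^{(|S|)}(f_S;[0,1]^{|S|})$. Lattice design: $\mathbb L_{n_1,\dots,n_d}=\{(i_1/n_1,\dots,i_d/n_d):0\le i_j\le n_j-1,\ j=1,\dots,d\}$. Loss and risk: $\mathcal L(\hat f,f^* )=\frac1n\sum_{i=1}^n(\hat f(\mathbf x_i)-f^*(\mathbf x_i))^2$ and $\mathcal R(\hat f,f^* )=\mathbb E\,\mathcal L(\hat f,f^* )$. The values of $\hat f_{\mathrm{EM}}$ at the design points do not depend on the choice of minimizer. *)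

(* Defs.v *)
From HB Require Import structures.
From mathcomp Require Import all_boot all_order all_algebra.
From mathcomp Require Import all_classical all_reals all_analysis.

Set Implicit Arguments.
Unset Strict Implicit.
Unset Printing Implicit Defensive.

Import Order.TTheory GRing.Theory Num.Theory.

Local Open Scope classical_set_scope.
Local Open Scope ring_scope.

(* Points are families [I -> R] over a finite index type, so that the faces
   [0,1]^S are treated uniformly with [0,1]^d (I = 'I_d). A function on the cube
   is a total function of which only the values on [0,1]^I are ever used. *)

Definition in_cube (R : realType) (I : finType) (u : I -> R) : Prop :=
  forall j, 0 <= u j <= 1.

(* J_i is the boolean [a i != b i], coerced to nat. *)
Definition quasi_volume (R : realType) (I : finType) (f : (I -> R) -> R)
    (a b : I -> R) : R :=
  \sum_(j : {ffun I -> bool} | [forall i, (j i <= (a i != b i))%N])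
    (-1) ^+ (\sum_i j i)%N * f (fun i => b i + (j i)%:R * (a i - b i)).

Definition entirely_monotone (R : realType) (I : finType)
    (f : (I -> R) -> R) : Prop :=
  forall a b : I -> R, in_cube a -> in_cube b -> a <> b ->
    (forall j, a j <= b j) -> 0 <= quasi_volume f a b.

(* [itv_partition 0 1 (p s)] lists the nodes x_1 < ... < x_{k_s} = 1 without the
   initial one, so the nodes are [0 :: p s] and k_s = size (p s). *)
Definition vitali_variation (R : realType) (I : finType)
    (f : (I -> R) -> R) : \bar R :=
  ereal_sup
    [set (\sum_(l : {dffun forall s : I, 'I_(size (p s))})
            `|quasi_volume f (fun s => nth 0 (0 :: p s) (l s))
                             (fun s => nth 0 (0 :: p s) (l s).+1)|)%:E
    | p in [set p : I -> seq R | forall s, itv_partition 0 1 (p s)]].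

Definition face_restriction (R : realType) (I : finType) (S : {set I})
    (f : (I -> R) -> R) : ({j : I | j \in S} -> R) -> R :=
  fun u => f (fun j => if insub j is Some k then u k else 0).

Definition HK0_variation (R : realType) (I : finType)
    (f : (I -> R) -> R) : \bar R :=
  (\sum_(S : {set I} | S != finset.set0)
    vitali_variation (face_restriction (S := S) f))%E.

Definition lattice_design (R : realType) (d : nat) (m : 'I_d -> nat) :
    set ('I_d -> R) :=
  [set (fun j => (i j)%:R / (m j)%:R)
  | i in [set i : 'I_d -> nat | forall j, (i j < m j)%N]].

Definition EM_least_squares (R : realType) (d n : nat)
    (x : 'I_n -> 'I_d -> R) (y : 'I_n -> R) : set (('I_d -> R) -> R) :=
  [set f | entirely_monotone f /\
    forall g : ('I_d -> R) -> R, entirely_monotone g ->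
      n%:R^-1 * \sum_(i < n) (y i - f (x i)) ^+ 2 <=
      n%:R^-1 * \sum_(i < n) (y i - g (x i)) ^+ 2].

Definition loss (R : realType) (d n : nat) (x : 'I_n -> 'I_d -> R)
    (f g : ('I_d -> R) -> R) : R :=
  n%:R^-1 * \sum_(i < n) (f (x i) - g (x i)) ^+ 2.

Definition risk (R : realType) (dT : measure_display) (T : measurableType dT)
    (P : probability T R) (d n : nat) (x : 'I_n -> 'I_d -> R)
    (fhat : T -> ('I_d -> R) -> R) (fstar : ('I_d -> R) -> R) : \bar R :=
  ('E_P[fun w => loss x (fhat w) fstar])%E.

Definition mutually_independent (R : realType) (dT : measure_display)
    (T : measurableType dT) (P : probability T R) (n : nat)
    (xi : 'I_n -> {RV P >-> R}) : Prop :=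
  forall (K : {set 'I_n}) (B : 'I_n -> set R),
    (forall i, measurable (B i)) ->
    P (\bigcap_(i in [set` K]) (xi i @^-1` B i)) =
    (\prod_(i in K) P (xi i @^-1` B i))%E.

(* Equality of laws is required on Borel sets only: [normal_prob] has no
   probabilistic meaning on non-measurable sets. *)
Definition normally_distributed (R : realType) (dT : measure_display)
    (T : measurableType dT) (P : probability T R) (m s : R)
    (X : {RV P >-> R}) : Prop :=
  forall B : set R, measurable B -> distribution P X B = normal_prob m s B.

(* Main.v *)
(* Write v for the difference of the estimator and f* on the grid, a for its
   Euclidean norm and xi for the noise. Comparing the estimator with f* in the
   least squares criterion gives a^2 <= 2 <xi, v>.

   Cut every coordinate axis into dyadic blocks, small near both ends (Whitney
   decomposition), and expand <xi, v> in the tensor product of the Haar bases of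
   the blocks. On a block with n_b points, the total level of a wavelet being the
   sum of its levels, the wavelets of total level at most L_b (a hyperbolic cross)
   are handled by Cauchy-Schwarz and contribute a times the norm of a Gaussian
   vector of dimension about 2^L_b (L_b + 1)^(d-1). For the higher levels,
   summation by parts writes an entirely monotone function as a positive mixture
   of indicators of orthants, so that only the increment of the function over the
   block and the supremum over orthants of a Gaussian process matter; the variance
   at level l is at most n_b 2^-l (l + 1)^(d-1), and by multi-affine interpolation
   the supremum runs over about 2^(d l) dyadic nodes. The increment of f* is at
   most V*, and that of the estimator at most V* + 2 a / sqrt n_b, because by
   monotonicity its values at the corners of the block are controlled by averages
   over neighbouring boxes of the same size; this is why the blocks shrink near
   the boundary.

   The resulting quadratic inequality in a bounds E a^2 without any localization
   or peeling, and optimizing L_b gives the two terms of the theorem. *)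

Require Import Defs.
From HB Require Import structures.
From mathcomp Require Import all_boot all_order all_algebra.
From mathcomp Require Import all_classical all_reals all_analysis.
From mathcomp Require Import measurable_realfun zify ring lra.

Import Order.TTheory GRing.Theory Num.Theory.

Local Open Scope classical_set_scope.
Local Open Scope ring_scope.

(** * One-dimensional Haar functions *)

(** The obstacle is that the variation of the estimator is not bounded in advance. Its increment
    over a block may exceed [V] by a term of order a / sqrt n_b; the noise above the cutoff has
    variance proportional to n_b, so this excess costs every block the same, whatever its size. With
    N blocks, N of order (log n)^d, a common cutoff L costs N 2^L below it against N^2 2^-L above
    it, up to powers of L. The balance 2^L = sqrt N gives N^(3/2), the origin of the exponent 3d/2
    in the second term. The part that involves [V] keeps the factor n_b, which decays geometrically
    with the depth of the block; lowering the cutoff with the depth then keeps powers of log n out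
    of the first term. The minimizers are selected arbitrarily for each outcome. All bounds are
    therefore pointwise in the noise, by explicit functions whose mean is known, and nothing about
    the measurability of the loss has to be proved. *)

Fixpoint haar (R : rcfType) (q l i : nat) : R :=
  if q is q'.+1 then
    if (l < 2 ^ q')%N then haar R q' l i./2 / Num.sqrt 2
    else if i./2 == (l - 2 ^ q')%N then (-1) ^+ (odd i) / Num.sqrt 2 else 0
  else 1.

(** The inner product with the indicator of [x, 2^q): the one-dimensional factor that summation by
    parts leaves of a wavelet. *)
Definition haar_tail (R : rcfType) (q l x : nat) : R :=
  \sum_(x <= i < 2 ^ q) haar R q l i.

(** Index 0 is the constant, and 2^p + i is the difference on the i-th pair that appears between
    resolutions p and p + 1. The level is thus the least [q] at which the index belongs to the
    basis; at resolution q, a wavelet of level lv > 0 is supported on 2^(q - lv + 1) points. *)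
Definition haar_level (l : nat) : nat := if l is 0 then 0 else (trunc_log 2 l).+1.

Lemma haar_level_le (l n : nat) : (haar_level l <= n)%N = (l < 2 ^ n)%N.
Proof.
case: l => [|l]; first by rewrite leq0n expn_gt0.
rewrite /haar_level; apply/idP/idP => h.
  by apply: leq_trans (trunc_log_ltn l.+1 (isT : 1 < 2)%N) _; rewrite leq_exp2l.
by rewrite -(@ltn_exp2l 2) // (leq_ltn_trans _ h) // trunc_logP.
Qed.

Section Haar.
Variable R : rcfType.
Local Notation s2 := (Num.sqrt 2 : R).

Lemma sqrt2_inv_sqr : s2^-1 ^+ 2 = 2^-1.
Proof. by rewrite exprVn sqr_sqrtr // ler0n. Qed.

Lemma sum_bump (N p : nat) (F : nat -> R) : (p < N)%N ->
  \sum_(0 <= l < N) (if p == l then F l else 0) = F p.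
Proof.
move=> pN; rewrite big_mkord -big_mkcond /= (big_pred1 (Ordinal pN)) //.
Qed.

(** The old functions give half the indicator that both points lie in the same pair, and the new
    ones add or subtract the same half according to the parities. Completeness, unlike
    orthonormality, survives the insertion of zero functions into the family. *)
Lemma haar_complete (q i j : nat) : (i < 2 ^ q)%N -> (j < 2 ^ q)%N ->
  \sum_(0 <= l < 2 ^ q) haar R q l i * haar R q l j = (i == j)%:R.
Proof.
elim: q i j => [|q IH] i j hi hj.
  rewrite expn0 big_nat1 /= mulr1; rewrite expn0 in hi hj.
  by case: i hi => [|//]; case: j hj.
have hi2 : (i./2 < 2 ^ q)%N by rewrite expnS in hi; lia.
have hj2 : (j./2 < 2 ^ q)%N by rewrite expnS in hj; lia.
rewrite (big_cat_nat (n := (2 ^ q)%N)) //=; last by rewrite leq_exp2l.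
rewrite (eq_big_nat _ _ (F2 := fun l => 2^-1 * (haar R q l i./2 * haar R q l j./2)));
  last first.
  move=> l /andP[_ ->]; rewrite -sqrt2_inv_sqr; ring.
rewrite -big_distrr /= IH //.
rewrite -{1}[(2 ^ q)%N]add0n big_addn.
rewrite (_ : (2 ^ q.+1 - 2 ^ q = 2 ^ q)%N); last by rewrite expnS; lia.
rewrite (eq_big_nat _ _ (F2 := fun l => if i./2 == l then
   (i./2 == j./2)%:R * (2^-1 * (-1) ^+ (odd i) * (-1) ^+ (odd j)) else 0)); last first.
  move=> l /andP[_ hl]; rewrite ltnNge leq_addl /= addnK.
  case: (i./2 =P l) => [->|_]; last by rewrite mul0r.
  rewrite [l == _]eq_sym; case: eqP => _; last by rewrite mulr0 mul0r.
  by rewrite mul1r -sqrt2_inv_sqr; ring.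
rewrite (sum_bump _ _ (fun _ => _)) //.
have -> : (i == j) = (i./2 == j./2) && (odd i == odd j).
  apply/eqP/andP => [->|[/eqP h1 /eqP h2]]; first by rewrite !eqxx.
  by rewrite -(odd_double_half i) -(odd_double_half j) h1 h2.
by case: (i./2 == j./2); case: (odd i); case: (odd j) => /=; rewrite ?expr0 ?expr1; lra.
Qed.

(** A tail that starts at an odd index contains only one half of its first pair, hence the two
    starting points. *)
Lemma sum_half_tail (N x : nat) (g : nat -> R) : (x <= N.*2)%N ->
  \sum_(x <= i < N.*2) g i./2 =
  \sum_(x./2 <= i < N) g i + \sum_(uphalf x <= i < N) g i.
Proof.
move=> hx; rewrite -(subKn hx); move: (N.*2 - x)%N (leq_subr x N.*2) => k {x hx}.
elim: k => [|k IH] hk.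
  by rewrite subn0 doubleK uphalf_double !big_geq // addr0.
have -> : (N.*2 - k.+1 = (N.*2 - k).-1)%N by lia.
have := IH (ltnW hk); have : (0 < N.*2 - k <= N.*2)%N by lia.
case: (N.*2 - k)%N => [|x] // /andP[_ hx] /= IHx.
rewrite big_ltn // IHx [X in _ = X + _]big_ltn; last by lia.
by rewrite uphalfE /=; ring.
Qed.

Lemma haar_tail_old (q l x : nat) : (l < 2 ^ q)%N -> (x <= 2 ^ q.+1)%N ->
  haar_tail R q.+1 l x = (haar_tail R q l x./2 + haar_tail R q l (uphalf x)) / s2.
Proof.
move=> hl hx; rewrite /haar_tail /= hl -big_distrl /=; congr (_ / _).
have e : (2 ^ q.+1 = (2 ^ q).*2)%N by rewrite expnS mul2n.
by rewrite e; apply: sum_half_tail; rewrite -e.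
Qed.

(** A new wavelet sums to zero over its pair, so its tail sees only a cut through the middle of that
    pair. *)
Lemma haar_tail_new (q p x : nat) : (p < 2 ^ q)%N -> (x <= 2 ^ q.+1)%N ->
  haar_tail R q.+1 (2 ^ q + p) x = if odd x && (x./2 == p) then - s2^-1 else 0.
Proof.
move=> hp; rewrite /haar_tail.
have e : (2 ^ q.+1 = (2 ^ q).*2)%N by rewrite expnS mul2n.
rewrite e => hx; rewrite -(subKn hx).
move: ((2 ^ q).*2 - x)%N (leq_subr x (2 ^ q).*2) => k {x hx}.
elim: k => [|k IH] hk.
  by rewrite subn0 big_geq // odd_double.
have -> : ((2 ^ q).*2 - k.+1 = ((2 ^ q).*2 - k).-1)%N by lia.
have := IH (ltnW hk); have : (0 < (2 ^ q).*2 - k <= (2 ^ q).*2)%N by lia.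
case: ((2 ^ q).*2 - k)%N => [|x] // /andP[_ hx] /= IHx.
rewrite big_ltn // IHx /= ltnNge leq_addr /= addKn.

case: (boolP (odd x)) => ox /=; rewrite ?addr0 ?mulN1r ?mul1r //.
have -> : uphalf x = x./2 by rewrite uphalf_half (negbTE ox).
by case: (x./2 == p); rewrite ?addr0 // subrr.
Qed.

Lemma haar_tail0 (q l : nat) : (0 < l < 2 ^ q)%N -> haar_tail R q l 0 = 0.
Proof.
elim: q l => [|q IH] l /andP[l0 lq]; first by rewrite expn0 in lq; case: l l0 lq.
have [h|h] := ltnP l (2 ^ q).
  by rewrite haar_tail_old // IH ?l0 // addr0 mul0r.
rewrite -(subnKC h) haar_tail_new //; rewrite expnS in lq; lia.
Qed.

(** Refinement replaces a tail by (a + b) / sqrt 2, whose square is at most a^2 + b^2, so the bound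
    doubles; at the level just born only the pair cut by [x] contributes, with 1/2. *)
Lemma haar_tail_sq (q lv x : nat) : (x <= 2 ^ q)%N -> (lv <= q)%N ->
  \sum_(0 <= l < 2 ^ q | haar_level l == lv) haar_tail R q l x ^+ 2 <= 2 ^+ (q - lv).
Proof.
elim: q x => [|q IH] x hx; first rewrite leqn0.
  move=> /eqP->; rewrite subnn big_mkcond expn0 big_nat1 /= /haar_tail.
  case: x hx => [|[|//]] _; first by rewrite expn0 big_nat1 /= expr1n.
  by rewrite big_geq // expr0n ler01.
move=> hlv.
have hx1 : (x./2 <= 2 ^ q)%N by rewrite expnS in hx; lia.
have hx2 : (uphalf x <= 2 ^ q)%N by rewrite expnS in hx; lia.
rewrite (big_cat_nat (n := (2 ^ q)%N)) //=; last by rewrite leq_exp2l.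
have [hq|hq] := leqP lv q.
- rewrite [X in _ + X]big_nat_cond [X in _ + X]big_pred0 ?addr0; last first.
    move=> l; apply/negbTE/negP => /andP[/andP[h1 h2] /eqP h3].
    by move: hq; rewrite -h3 haar_level_le ltnNge h1.
  apply: (@le_trans _ _ (\sum_(0 <= l < 2 ^ q | haar_level l == lv)
      (haar_tail R q l x./2 ^+ 2 + haar_tail R q l (uphalf x) ^+ 2))).
    rewrite big_nat_cond [leRHS]big_nat_cond; apply: ler_sum => l /andP[/andP[_ hl] _].
    rewrite haar_tail_old // exprMn sqrt2_inv_sqr.
    set a := haar_tail _ _ _ _; set b := haar_tail _ _ _ _.
    have : 0 <= (a - b) ^+ 2 by rewrite sqr_ge0.
    by rewrite !expr2; lra.
  rewrite big_split /= subSn // exprS.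
  have := IH _ hx1 hq; have := IH _ hx2 hq; lra.
- have -> : lv = q.+1 by lia.
  rewrite big_nat_cond big_pred0 ?add0r; last first.
    move=> l; apply/negbTE/negP => /andP[/andP[h1 h2] /eqP h3].
    by move: h2; rewrite -haar_level_le h3 ltnn.
  rewrite subnn expr0.
  apply: (@le_trans _ _ (\sum_(2 ^ q <= l < 2 ^ q.+1) haar_tail R q.+1 l x ^+ 2)).
    by rewrite [leRHS](bigID (fun l => haar_level l == q.+1)) /= lerDl sumr_ge0 // => l _;
      rewrite sqr_ge0.
  rewrite -{1}[(2 ^ q)%N]add0n big_addn.
  rewrite (_ : (2 ^ q.+1 - 2 ^ q = 2 ^ q)%N); last by rewrite expnS; lia.
  rewrite (eq_big_nat _ _ (F2 := fun l => if x./2 == l then (odd x)%:R * 2^-1 else 0));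
    last first.
    move=> l /andP[_ hl]; rewrite addnC haar_tail_new //.
    case: (odd x); case: (x./2 == l) => //=; rewrite ?expr0n ?mul0r //.
    by rewrite sqrrN sqrt2_inv_sqr mul1r.
  have [hx3|hx3] := ltnP x./2 (2 ^ q).
    rewrite (sum_bump _ _ (fun _ => _)) //.
    by case: (odd x) => /=; lra.
  rewrite big_nat_cond big1 // => l /andP[/andP[_ hl] _].
  by case: eqP => // e; move: hl; rewrite -e ltnNge hx3.
Qed.

(* On a dyadic cell of length [2 ^ r] the functions of level at most [q] are
   constant, so their tail sums interpolate linearly between the cell ends. *)
Lemma haar_tail_interp (q r x : nat) : (x <= 2 ^ (q + r))%N ->
  exists a : 'I_(2 ^ q).+1 -> R, [/\ forall y, 0 <= a y, \sum_y a y = 1 &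
    forall l, (l < 2 ^ q)%N ->
      haar_tail R (q + r) l x = s2 ^+ r * \sum_y a y * haar_tail R q l y].
Proof.
elim: r x => [|r IH] x.
  rewrite addn0 => hx; exists (fun y => (y == inord x)%:R); split.
  - by move=> y; rewrite ler0n.
  - rewrite (bigD1 (inord x)) //= eqxx big1 ?addr0 //.
    by move=> y /negbTE->.
  - move=> l hl; rewrite expr0 mul1r (bigD1 (inord x)) //= eqxx mul1r big1 ?addr0.
      by rewrite inordK.
    by move=> y /negbTE->; rewrite mul0r.
rewrite addnS => hx.
have hx1 : (x./2 <= 2 ^ (q + r))%N by rewrite expnS in hx; lia.
have hx2 : (uphalf x <= 2 ^ (q + r))%N by rewrite expnS in hx; lia.
have [a1 [a1p a1s a1e]] := IH _ hx1; have [a2 [a2p a2s a2e]] := IH _ hx2.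
exists (fun y => (a1 y + a2 y) / 2); split.
- by move=> y; rewrite divr_ge0 ?addr_ge0.
- by rewrite -big_distrl big_split /= a1s a2s; lra.
move=> l hl; rewrite haar_tail_old //; last first.
  by rewrite (leq_trans hl) // leq_exp2l ?leq_addr.
rewrite a1e // a2e // -mulrDr -big_split /=.
under [in RHS]eq_bigr do rewrite mulrAC.
rewrite -big_distrl /= exprS.
under [in RHS]eq_bigr do rewrite mulrDl.
have -> : s2^-1 = s2 / 2.
  by rewrite -sqrt2_inv_sqr expr2 mulrA divff ?mul1r // sqrtr_eq0 -ltNge ltr0n.
ring.
Qed.

End Haar.

(** * Decomposition of an interval into dyadic blocks *)

Section Blocks.
Local Open Scope nat_scope.

Definition in_block (s k i : nat) : bool := ((s <= i) && (i < s + 2 ^ k))%N.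

Lemma binary_digit_block (r k : nat) :
  (r %/ 2 ^ k * 2 ^ k = r %/ 2 ^ k.+1 * 2 ^ k.+1 + odd (r %/ 2 ^ k) * 2 ^ k)%N.
Proof.
rewrite expnSr divnMA divn2; move: (2 ^ k)%N => c; move: (r %/ c)%N => a.
by have := odd_double_half a; rewrite -mul2n; nia.
Qed.

(** The block of a binary digit starts where the blocks of the higher digits end; the lowest [K]
    digits cover what lies beyond the last multiple of 2^K. *)
Lemma sum_binary_blocks (K s0 r i : nat) :
  (\sum_(k < K) (odd (r %/ 2 ^ k) && in_block (s0 + r %/ 2 ^ k.+1 * 2 ^ k.+1) k i) =
   (s0 + r %/ 2 ^ K * 2 ^ K <= i < s0 + r))%N.
Proof.
elim: K => [|K IH]; first by rewrite big_ord0 expn0 divn1 muln1; lia.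
rewrite big_ord_recr /= IH /in_block.
have := binary_digit_block r K; have := leq_divM r (2 ^ K).
move: (r %/ 2 ^ K.+1 * 2 ^ K.+1)%N (r %/ 2 ^ K * 2 ^ K)%N (2 ^ K)%N => a b c.
case: (odd _) => /=; lia.
Qed.

Lemma sum_left_blocks (K i : nat) :
  (\sum_(k < K) in_block (2 ^ k - 1) k i = (i < 2 ^ K - 1))%N.
Proof.
elim: K => [|K IH]; first by rewrite big_ord0.
rewrite big_ord_recr /= IH /in_block expnS.
have := expn_gt0 2 K; move: (2 ^ K)%N => a; lia.
Qed.

Lemma sum_right_blocks (K m i : nat) : (2 ^ K <= m.+1)%N ->
  (\sum_(k < K) in_block (m.+1 - 2 ^ k.+1) k i = (m.+1 - 2 ^ K <= i < m))%N.
Proof.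
elim: K => [|K IH] h; first by rewrite big_ord0 expn0; lia.
have h' : (2 ^ K <= m.+1)%N by rewrite expnS in h; lia.
rewrite big_ord_recr /= IH // /in_block.
rewrite expnS in h *.
have := expn_gt0 2 K; move: (2 ^ K)%N h {h'} => a; lia.
Qed.

(* Blocks of length [2 ^ k] whose distance to both ends of [0, m) is at least
   of the order of their length: 1, 2, 4, ... from the left, the same from the
   right, and the binary digits of the remaining middle part. *)
Lemma whitney_blocks (m : nat) : (0 < m)%N ->
  exists K (s : nat -> nat -> nat) (v : nat -> nat -> bool), [/\ (2 ^ K <= m)%N,
    forall c k, v c k -> [/\ (k <= K)%N, (2 ^ k <= s c k + 1)%N &
       (s c k + 2 * 2 ^ k <= m + 1)%N] &
    forall i, (i < m)%N ->
       (\sum_(c < 3) \sum_(k < K.+1) (v c k && in_block (s c k) k i) = 1)%N].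
Proof.
(* [K] is the largest exponent for which the blocks growing from the two ends, of total length 2^K -
   1 on each side, do not overlap: 2^(K+1) <= m + 2. The middle part [r] is shorter than 2^(K+1), so
   its blocks have length at most 2^K. *)
move=> m0; set K := (trunc_log 2 m.+2).-1.
have KE : trunc_log 2 m.+2 = K.+1.
  by rewrite prednK // trunc_log_gt0 /=.
have K1 : (2 ^ K.+1 <= m.+2)%N by rewrite -KE; apply: trunc_logP.
have K2 : (m.+2 < 2 ^ K.+2)%N by rewrite -KE; apply: trunc_log_ltn.
set r := (m.+2 - 2 ^ K.+1)%N.
exists K, (fun c k => if c is 0 then (2 ^ k - 1)%N else if c is 1 then (m.+1 - 2 ^ k.+1)%N
   else (2 ^ K - 1 + r %/ 2 ^ k.+1 * 2 ^ k.+1)%N).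
exists (fun c k => if c is 0 then (k < K)%N else if c is 1 then (k < K)%N
   else (k < K.+1)%N && odd (r %/ 2 ^ k)); split.
- case: (posnP K) => [->|K0]; first by rewrite expn0.
  have : (2 ^ 1 <= 2 ^ K)%N by rewrite leq_exp2l.
  by move: K1; rewrite expnS; lia.
- have pw k : (k < K)%N -> (2 * 2 ^ k <= 2 ^ K)%N by move=> h; rewrite -expnS leq_exp2l.
  have pw1 k : (k <= K)%N -> (2 ^ k <= 2 ^ K)%N by move=> h; rewrite leq_exp2l.
  move: K1 K2; rewrite !expnS => K1 K2.
  move=> c k; case: c => [|[|c]].
  + move=> h; have := pw _ h; have := expn_gt0 2 k; split; lia.
  + move=> h; have := pw _ h; have := expn_gt0 2 k; split; rewrite ?expnS; lia.
  + move=> /andP[h o]; have := pw1 k h; have := expn_gt0 2 k.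
    have := binary_digit_block r k; rewrite o mul1n.
    have := leq_divM r (2 ^ k); rewrite /r !expnS.
    move: (_ %/ _ * _)%N (_ %/ _ * _)%N => a b.
    split; lia.
- move=> i im; rewrite !big_ord_recr big_ord0 /= add0n.
  rewrite ltnn /= !addn0.
  under eq_bigr do rewrite ltn_ord /=.
  under [X in (_ + X + _)%N]eq_bigr do rewrite ltn_ord /=.
  rewrite sum_left_blocks sum_right_blocks; last by rewrite expnS in K1; lia.
  have -> : (\sum_(k < K) ((k < K.+1) && odd (r %/ 2 ^ k) &&
       in_block (2 ^ K - 1 + r %/ 2 ^ k.+1 * 2 ^ k.+1) k i) +
     ((K < K.+1) && odd (r %/ 2 ^ K) && in_block (2 ^ K - 1 + r %/ 2 ^ K.+1 * 2 ^ K.+1) K i)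
     = (2 ^ K - 1 <= i < 2 ^ K - 1 + r))%N.
    have := sum_binary_blocks K.+1 (2 ^ K - 1) r i.
    rewrite [r %/ 2 ^ K.+1]divn_small; last by rewrite /r; rewrite expnS in K2; lia.
    rewrite mul0n addn0 => <-; rewrite big_ord_recr /= ltnSn /=.
    rewrite [r %/ 2 ^ K.+1]divn_small; last by rewrite /r; rewrite expnS in K2; lia.
    congr (_ + _)%N; last by rewrite mul0n addn0.
    apply: eq_bigr => k _.
    by rewrite (ltn_trans (ltn_ord k) (ltnSn K)).
  rewrite /r; move: K1 K2; rewrite !expnS.
  have := expn_gt0 2 K; move: (2 ^ K)%N => a; lia.
Qed.

End Blocks.

(** * Expectations of functions of Gaussian vectors *)

Definition density_measure {d} {T : measurableType d} {R : realType}
  (mu : {measure set T -> \bar R}) (p : T -> R) (p0 : forall x, 0 <= p x)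
  (mp : measurable_fun setT p) (A : set T) : \bar R :=
  (\int[mu]_(x in A) (p x)%:E)%E.

Section Density.
Context {d} {T : measurableType d} {R : realType}.
Variables (mu : {measure set T -> \bar R}) (p : T -> R).
Hypotheses (p0 : forall x, 0 <= p x) (mp : measurable_fun setT p).
Local Notation nu := (density_measure mu p p0 mp).
Local Open Scope ereal_scope.

Let nu0 : nu set0 = 0.
Proof. by rewrite /density_measure integral_set0. Qed.

Let nu_ge0 A : 0 <= nu A.
Proof. by apply: integral_ge0 => x _; rewrite lee_fin. Qed.

Let nu_sigma_additive : semi_sigma_additive nu.
Proof.
move=> A mA tA mUA; rewrite /density_measure.
rewrite ge0_integral_bigcup//=; last by move=> x _; rewrite lee_fin.
  by apply: is_cvg_ereal_nneg_natsum_cond => n _ _; exact: nu_ge0.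
exact/measurable_EFinP/measurable_funTS.
Qed.

HB.instance Definition _ := isMeasure.Build _ _ _ nu nu0 nu_ge0 nu_sigma_additive.

Import HBNNSimple.

Lemma ge0_integral_density (f : T -> \bar R) :
  measurable_fun setT f -> (forall x, 0 <= f x) ->
  \int[nu]_x f x = \int[mu]_x (f x * (p x)%:E).
Proof.
move=> mf f0; pose f_ := nnsfun_approx measurableT mf.
have mpE : measurable_fun setT (EFin \o p) by exact/measurable_EFinP.
transitivity (limn (fun n => \int[nu]_x (f_ n x)%:E)).
  rewrite -monotone_convergence//.
  - apply: eq_integral => y _; apply/esym/cvg_lim => //.
    by apply: cvg_nnsfun_approx.
  - by move=> n; exact/measurable_EFinP/measurable_funP.
  - by move=> n y _; rewrite lee_fin.
  - by move=> y _ m n mn; rewrite lee_fin; exact/lefP/nd_nnsfun_approx.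
rewrite [X in limn X](_ : _ = (fun n => \int[mu]_x ((f_ n x)%:E * (p x)%:E))); last first.
  apply/funext => n.
  transitivity (\sum_(k \in range (f_ n)) \int[nu]_x (k * \1_(f_ n @^-1` [set k]) x)%:E).
    under eq_integral do rewrite fimfunE -fsumEFin//.
    rewrite ge0_integral_fsum//.
    - by move=> y; exact/measurable_EFinP/measurable_funM.
    - by move=> y x _; rewrite EFinM nnfun_muleindic_ge0.
  transitivity (\sum_(k \in range (f_ n))
      \int[mu]_x ((k * \1_(f_ n @^-1` [set k]) x)%:E * (p x)%:E)); last first.
    rewrite -ge0_integral_fsum//.
    - apply: eq_integral => x _; rewrite fimfunE -fsumEFin// ge0_mule_fsuml//.
      by move=> r; rewrite EFinM nnfun_muleindic_ge0.
    - move=> y; apply: emeasurable_funM => //; exact/measurable_EFinP/measurable_funM.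
    - by move=> y x _; rewrite mule_ge0 ?lee_fin// -lee_fin EFinM nnfun_muleindic_ge0.
  apply: eq_fsbigr => r; rewrite inE => -[t _ ft].
  have r0 : (0 <= r)%R by rewrite -ft.
  rewrite integralZl_indic_nnsfun// integral_indic//= setIT.
  under [RHS]eq_integral do rewrite EFinM -muleA.
  rewrite ge0_integralZl//; last 2 first.
    apply: emeasurable_funM => //; exact/measurable_EFinP.
    by move=> x _; rewrite mule_ge0 ?lee_fin.
  congr (_ * _); rewrite /density_measure integral_mkcond; apply: eq_integral => x _.
  by rewrite /patch indicE; case: ifP; rewrite ?mul1e ?mul0e.
rewrite -monotone_convergence//; last 3 first.
  - move=> n; apply: emeasurable_funM => //; exact/measurable_EFinP/measurable_funP.
  - by move=> n x _; rewrite mule_ge0 ?lee_fin.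
  - move=> x _ m n mn; rewrite lee_wpmul2r ?lee_fin//; exact/lefP/nd_nnsfun_approx.
apply: eq_integral => x _; apply/cvg_lim => //.
(* [f x] may be infinite, and infinity times 0 is 0 by convention; points where the density vanishes
   are treated apart. *)
have [fy|fy] := eqVneq (p x) 0%R.
  by under eq_fun do rewrite fy mule0; rewrite fy mule0; exact: cvg_cst.
apply: cvgeZr => //.
by apply: cvg_nnsfun_approx.
Qed.

End Density.

Lemma measurable_preimage {d} {T : measurableType d} {R : realType} (X : {mfun T >-> R})
  (B : set R) : measurable B -> measurable (X @^-1` B).
Proof. by move=> mB; rewrite -[X in measurable X]setTI; exact: measurable_funPT. Qed.

(** * Expectation of a product of functions of independent variables *)

Section Independence.
Context {d} {T : measurableType d} {R : realType} (P : probability T R) (n : nat).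
Variable xi : 'I_n -> {RV P >-> R}.
Hypothesis indep : mutually_independent xi.

Definition product_rule (g : 'I_n -> R -> R) : Prop :=
  (\int[P]_w (\prod_i g i (xi i w))%:E = \prod_i \int[P]_w (g i (xi i w))%:E)%E.

Definition replace_factor (i : 'I_n) (h : R -> R) (g : 'I_n -> R -> R) :=
  fun j => if j == i then h else g j.

(* Both sides are integrals of [g i] against measures that agree on Borel sets. *)
Lemma product_rule_replace (i : 'I_n) (g : 'I_n -> R -> R) :
  (forall j x, 0 <= g j x) -> (forall j, measurable_fun setT (g j)) ->
  (forall j, j != i -> (\int[P]_w (g j (xi j w))%:E \is a fin_num)%E) ->
  (forall B, measurable B -> product_rule (replace_factor i (\1_B) g)) ->
  product_rule g.
Proof.
move=> g0 mg gfin H; rewrite /product_rule.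
pose G w := \prod_(j | j != i) g j (xi j w).
have G0 w : 0 <= G w by apply: prodr_ge0.
have mG : measurable_fun setT G.
  rewrite (_ : G = fun w => \prod_j (if j != i then g j (xi j w) else 1)); last first.
    by apply/funext => w; rewrite /G big_mkcond.
  apply: measurable_prod => j _.
  case: (j != i); last exact: measurable_cst.
  by apply: measurableT_comp.
pose c := (\prod_(j | j != i) \int[P]_w (g j (xi j w))%:E)%E.
have c0 : (0 <= c)%E by apply: prode_ge0 => j _; apply: integral_ge0 => w _; rewrite lee_fin.
have cfin : c \is a fin_num by apply: prode_fin_num.
have cE : c = (NngNum (fine_ge0 c0))%:num%:E by rewrite /= fineK.
have mgxi : measurable_fun setT (fun w => (g i (xi i w))%:E).
  by apply/measurable_EFinP/measurableT_comp.
transitivity (\int[density_measure P G G0 mG]_w (g i (xi i w))%:E)%E.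
  rewrite ge0_integral_density//; last by move=> w; rewrite lee_fin.
  by apply: eq_integral => w _; rewrite (bigD1 i).
transitivity (\int[pushforward (density_measure P G G0 mG) (xi i)]_x (g i x)%:E)%E.
  rewrite ge0_integral_pushforward//.
    exact/measurable_EFinP.
  by move=> x _; rewrite lee_fin.
rewrite (@eq_measure_integral _ _ _ _ (mscale (NngNum (fine_ge0 c0)) (distribution P (xi i)))).
  rewrite ge0_integral_mscale//; last 2 first.
    exact/measurable_EFinP.
    by move=> x _; rewrite lee_fin.
  rewrite -cE ge0_integral_distribution//; last 2 first.
    exact/measurable_EFinP.
    by move=> x; rewrite lee_fin.
  by rewrite [RHS](bigD1 i)//= muleC.
move=> B mB _; transitivity (c * distribution P (xi i) B)%E; last by rewrite {1}cE.
have := H B mB; rewrite /product_rule [in RHS](bigD1 i)//= /replace_factor eqxx.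
have -> : (\prod_(j | j != i) \int[P]_w ((if j == i then \1_B else g j) (xi j w))%:E = c)%E.
  by apply: eq_bigr => j /negbTE->.
have -> : (\int[P]_w (\1_B (xi i w))%:E = distribution P (xi i) B)%E.
  rewrite /distribution /pushforward -[X in P X]setIT -integral_indic//.
  exact: measurable_preimage.
rewrite muleC => <-; rewrite /pushforward /density_measure integral_mkcond.
apply: eq_integral => w _; rewrite /patch (bigD1 i)//= eqxx.
rewrite [X in _ * X](eq_bigr (fun j => g j (xi j w))); last by move=> j /negbTE->.
rewrite indicE; case: ifPn => h.
  by rewrite (_ : xi i w \in B = true) ?mul1r//; move: h; rewrite !inE.
by rewrite (_ : xi i w \in B = false) ?mul0r//; move: h; rewrite !notin_setE => h;
  apply/negbTE; rewrite notin_setE.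
Qed.

(** Independence is the case where all factors are indicators. The induction allows general factors
    at the indices below [k] and keeps indicators at the others. *)
Lemma expectation_prod (g : 'I_n -> R -> R) :
  (forall j x, 0 <= g j x) -> (forall j, measurable_fun setT (g j)) ->
  (forall j, (\int[P]_w (g j (xi j w))%:E \is a fin_num)%E) -> product_rule g.
Proof.
suff H k : forall g : 'I_n -> R -> R,
    (forall j x, 0 <= g j x) -> (forall j, measurable_fun setT (g j)) ->
    (forall j, (\int[P]_w (g j (xi j w))%:E \is a fin_num)%E) ->
    (forall j : 'I_n, (k <= j)%N -> exists2 B, measurable B & g j = \1_B) ->
    product_rule g.
  by move=> g0 mg gfin; apply: (H n) => // j; rewrite leqNgt ltn_ord.
elim: k => [|k IH] {}g g0 mg gfin gind.
  have /choice[B HB] : forall j, exists B, measurable B /\ g j = \1_B.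
    by move=> j; have [B mB gB] := gind j isT; exists B.
  have mB j : measurable (xi j @^-1` B j).
    by apply: measurable_preimage; exact: (HB j).1.
  have E j : (\int[P]_w (g j (xi j w))%:E = P (xi j @^-1` B j))%E.
    by rewrite (HB j).2 -[X in P X]setIT -integral_indic.
  rewrite /product_rule (eq_bigr _ (fun j _ => E j)).
  transitivity (\prod_(j in [set: 'I_n]%SET) P (xi j @^-1` B j))%E; last first.
    by apply: eq_bigl => j; rewrite finset.in_setT.
  rewrite -(indep _ _ (fun j => (HB j).1)).
  rewrite -[X in P X]setIT -integral_indic//; last first.
    by apply: fin_bigcap_measurable => // j _; exact: mB.
  apply: eq_integral => w _; congr EFin; rewrite indicE.
  case: (boolP (w \in _)) => [|] h.
    rewrite big1// => j _; rewrite (HB j).2 indicE.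
    rewrite mem_set//; have /(_ j) := set_mem h; apply.
    by rewrite /= finset.in_setT.
  have [j hj] : exists j, ~ B j (xi j w).
    by apply/existsNP => K; move/negP: h; apply; apply/mem_set => j _; exact: K.
  by rewrite (bigD1 j)//= (HB j).2 indicE memNset ?mul0r.
have [kn|kn] := ltnP k n; last first.
  by apply: IH => // j; rewrite leqNgt (leq_trans (ltn_ord j) kn).
apply: (@product_rule_replace (Ordinal kn)) => // B mB.
apply: IH => [j x|j|j|j kj]; rewrite /replace_factor; case: eqP => // jk.
- have E : (\int[P]_w (\1_B (xi j w))%:E = P (xi j @^-1` B))%E.
    by rewrite -[X in P X]setIT -integral_indic//; exact: measurable_preimage.
  by rewrite E fin_num_measure//; exact: measurable_preimage.
- by exists B.
- apply: gind; rewrite ltn_neqAle kj andbT; apply/eqP => e; apply: jk.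
  exact/val_inj.
Qed.

End Independence.

Lemma normal_mgf {d} {T : measurableType d} {R : realType} (P : probability T R)
  (s : R) (X : {RV P >-> R}) (c : R) : 0 < s -> normally_distributed 0 s X ->
  (\int[P]_w (expR (c * X w))%:E = (expR (s ^+ 2 * c ^+ 2 / 2))%:E)%E.
Proof.
move=> s0 nX.
have mE : measurable_fun setT (fun x : R => (expR (c * x))%:E).
  by apply/measurable_EFinP; apply: measurableT_comp => //; exact: measurable_funM.
have mp : measurable_fun setT (normal_pdf 0 s) by exact: measurable_normal_pdf.
have p0 x : 0 <= normal_pdf 0 s x by exact: normal_pdf_ge0.
transitivity (\int[distribution P X]_x (expR (c * x))%:E)%E.
  by rewrite ge0_integral_distribution// => y; rewrite lee_fin expR_ge0.
(* The identity carries the density measure from the type on which Lebesgue measure lives to the one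
   on which the law of [X] lives. *)
pose idR : measurableTypeR R -> R := idfun.
have mid : measurable_fun setT idR by exact: measurable_id.
pose nu := density_measure (@lebesgue_measure R) (normal_pdf 0 s) p0 mp.
transitivity (\int[pushforward nu idR]_x (expR (c * x))%:E)%E.
  by apply: eq_measure_integral => A mA _; exact: nX.
rewrite ge0_integral_pushforward//= preimage_setT.
rewrite ge0_integral_density//.
(* Completing the square: the tilted density is a multiple of the normal density with mean s^2 c. *)
transitivity (\int[lebesgue_measure]_x ((expR (s ^+ 2 * c ^+ 2 / 2))%:E *
     (normal_pdf (s ^+ 2 * c) s x)%:E))%E.
  apply: eq_integral => x _; rewrite -!EFinM; congr EFin.
  rewrite !normal_pdfE ?gt_eqF// mulrCA [RHS]mulrCA; congr (_ * _).
  rewrite /normal_fun -!expRD; congr expR.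
  by rewrite /idR /= subr0; field; rewrite gt_eqF.
rewrite ge0_integralZl//.
- by rewrite integral_normal_pdf mule1.
- by apply/measurable_EFinP; exact: measurable_normal_pdf.
- by move=> x _; rewrite lee_fin normal_pdf_ge0.
Qed.

Lemma gaussian_vector_mgf {d} {T : measurableType d} {R : realType} (P : probability T R)
  (n : nat) (xi : 'I_n -> {RV P >-> R}) (s : R) (c : 'I_n -> R) :
  0 < s -> mutually_independent xi -> (forall i, normally_distributed 0 s (xi i)) ->
  (\int[P]_w (expR (\sum_i c i * xi i w))%:E = (expR (s ^+ 2 * (\sum_i c i ^+ 2) / 2))%:E)%E.
Proof.
move=> s0 ind nX.
have E i := @normal_mgf _ _ _ P s (xi i) (c i) s0 (nX i).
have := @expectation_prod _ _ _ P n xi ind (fun i x => expR (c i * x)).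
rewrite /product_rule => H.
under eq_integral do rewrite expR_sum.
rewrite H.
- rewrite (eq_bigr _ (fun i _ => E i)) prodEFin -expR_sum; congr (expR _)%:E.
  by rewrite mulr_sumr mulr_suml.
- by move=> *; exact: expR_ge0.
- by move=> j; apply: measurableT_comp => //; exact: measurable_funM.
- by move=> j; rewrite E.
Qed.

(* [F] is dominated by a finite combination of exponentials of linear forms whose
   expectation under n independent N(0, s^2) variables is at most [b]. This
   bounds the expectation of [F] without any measurability requirement on [F]. *)
Definition gaussian_mean_le {R : realType} {n : nat} (s : R) (F : ('I_n -> R) -> R)
    (b : R) : Prop :=
  exists L : seq (R * ('I_n -> R)),
    (forall z, F z <= \sum_(p <- L) `|p.1| * expR (\sum_i p.2 i * z i)) /\
    \sum_(p <- L) `|p.1| * expR (s ^+ 2 * (\sum_i p.2 i ^+ 2) / 2) <= b.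

Section GaussianMean.
Context {R : realType} {n : nat} (s : R).
Implicit Types (F G : ('I_n -> R) -> R) (b c : R) (z : 'I_n -> R).
Local Notation EB := (@gaussian_mean_le R n s).

Lemma gaussian_mean_exp c (u : 'I_n -> R) : 0 <= c ->
  EB (fun z => c * expR (\sum_i u i * z i)) (c * expR (s ^+ 2 * (\sum_i u i ^+ 2) / 2)).
Proof.
move=> c0; exists [:: (c, u)]; split=> [z|]; rewrite big_seq1 ger0_norm //=.
Qed.

Lemma gaussian_mean_le_trans F G b c :
  (forall z, F z <= G z) -> b <= c -> EB G b -> EB F c.
Proof.
move=> FG bc [L [H1 H2]]; exists L; split; last exact: le_trans bc.
by move=> z; exact: le_trans (H1 z).
Qed.

Lemma gaussian_mean_cst c : 0 <= c -> EB (fun=> c) c.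
Proof.
move=> c0; apply: gaussian_mean_le_trans (gaussian_mean_exp c (fun=> 0) c0).
  by move=> z; rewrite big1 ?expR0 ?mulr1 // => i _; rewrite mul0r.
by rewrite big1 ?mulr0 ?mul0r ?expR0 ?mulr1 // => i _; rewrite expr0n.
Qed.

Lemma gaussian_mean_add F G b c : EB F b -> EB G c -> EB (fun z => F z + G z) (b + c).
Proof.
move=> [L [H1 H2]] [K [H3 H4]]; exists (L ++ K); split=> [z|]; rewrite big_cat /= lerD //.
Qed.

Lemma gaussian_mean_scale F b c : 0 <= c -> EB F b -> EB (fun z => c * F z) (c * b).
Proof.
move=> c0 [L [H1 H2]]; exists [seq (c * p.1, p.2) | p <- L]; split=> [z|].
  rewrite big_map /=; under eq_bigr do rewrite normrM (ger0_norm c0) -[_ * expR _]mulrA.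
  by rewrite -mulr_sumr ler_wpM2l.
rewrite big_map /=; under eq_bigr do rewrite normrM (ger0_norm c0) -[_ * expR _]mulrA.
by rewrite -mulr_sumr ler_wpM2l.
Qed.

Lemma gaussian_mean_sum (I : Type) (r : seq I) (Q : pred I) (F : I -> ('I_n -> R) -> R)
    (b : I -> R) : (forall i, Q i -> EB (F i) (b i)) ->
  EB (fun z => \sum_(i <- r | Q i) F i z) (\sum_(i <- r | Q i) b i).
Proof.
move=> H; elim: r => [|i r IH].
  apply: gaussian_mean_le_trans (gaussian_mean_cst 0 (lexx _)) => [z|]; by rewrite big_nil.
rewrite big_cons; case: (boolP (Q i)) => Qi; last first.
  by apply: gaussian_mean_le_trans IH => // z; rewrite big_cons (negbTE Qi).
apply: gaussian_mean_le_trans (gaussian_mean_add _ _ _ _ (H i Qi) IH) => // z.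
by rewrite big_cons Qi.
Qed.

Lemma sqr_le_expR (x : R) : 0 <= x -> x ^+ 2 <= 4 * expR x.
Proof.
move=> x0; have h := expR_ge1Dx (x / 2).
have -> : expR x = expR (x / 2) ^+ 2 by rewrite expr2 -expRD; congr expR; lra.
nra.
Qed.

(** Truncation at [a] in exponential form: beyond [a] the square is paid for by an exponential with
    the small factor exp(-a). This makes a union bound expressible by finitely many exponentials. *)
Lemma sqr_le_expR_shift (x a : R) : 0 <= a ->
  x ^+ 2 <= 2 * a ^+ 2 + 8 * expR (- a) * (expR x + expR (- x)).
Proof.
move=> a0.
wlog x0 : x / 0 <= x.
  move=> H; have [x0|/ltW x0] := leP 0 x; first exact: H.
  by have := H (- x); rewrite sqrrN opprK oppr_ge0 [expR (- x) + _]addrC; apply.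
have [xa|ax] := leP x a.
  have : x ^+ 2 <= a ^+ 2 by rewrite ler_pXn2r.
  have : 0 <= 8 * expR (- a) * (expR x + expR (- x)).
    by rewrite !mulr_ge0 ?addr_ge0 ?expR_ge0.
  have := sqr_ge0 a; lra.
have h := @sqr_le_expR (x - a) ltac:(lra).
rewrite expRD in h; rewrite mulrDr.
have : 0 <= 8 * expR (- a) * expR (- x) by rewrite !mulr_ge0 ?expR_ge0.
have : 0 <= (x - a - a) ^+ 2 by rewrite sqr_ge0.
lra.
Qed.

(** The forms are rescaled by [la] to variance at most l and truncated at 2l. Each exponential has
    mean at most exp(l/2), and exp(l/2) times the number of forms times the factor exp(-2l) stays
    below 1. A single [G] serves all indices, hence dominates the maximum. *)
Lemma gaussian_max_le (I : finType) (u : I -> 'I_n -> R) (S l : R) :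
  0 < s -> 0 < S -> (forall y, \sum_i u y i ^+ 2 <= S) ->
  1 <= l -> #|I|%:R <= expR (l - 1) ->
  exists G, [/\ forall z, 0 <= G z, EB G (32 * s ^+ 2 * S * l) &
    forall y z, (\sum_i u y i * z i) ^+ 2 <= G z].
Proof.
move=> s0 S0 hS l1 hl.
have ls0 : 0 < l / (s ^+ 2 * S) by rewrite divr_gt0 ?mulr_gt0 ?exprn_gt0 //; lra.
pose la := Num.sqrt (l / (s ^+ 2 * S)).
have la0 : 0 < la by rewrite sqrtr_gt0.
have la2 : la ^+ 2 = l / (s ^+ 2 * S) by rewrite sqr_sqrtr // ltW.
have vl y : s ^+ 2 * (\sum_i (la * u y i) ^+ 2) / 2 <= l / 2.
  under eq_bigr do rewrite exprMn.
  rewrite -mulr_sumr la2.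
  have -> : l = s ^+ 2 * (l / (s ^+ 2 * S) * S) by field; rewrite !gt_eqF.
  rewrite ler_pM2r; last by lra.
  rewrite ler_pM2l ?exprn_gt0 //.
  set c := (X in _ * _ <= X * _).
  have -> : s ^+ 2 * (l / (s ^+ 2 * S) * S) = l by field; rewrite !gt_eqF.
  by rewrite ler_pM2l.
pose G z := la ^- 2 * (2 * (2 * l) ^+ 2) +
  \sum_(y : I) (la ^- 2 * (8 * expR (- (2 * l))) * expR (\sum_i (la * u y i) * z i) +
                la ^- 2 * (8 * expR (- (2 * l))) * expR (\sum_i (- (la * u y i)) * z i)).
have lai0 : 0 < la ^- 2 by rewrite invr_gt0 exprn_gt0.
have c0 : 0 <= la ^- 2 * (8 * expR (- (2 * l))).
  by apply: mulr_ge0; [exact: ltW | rewrite mulr_ge0 ?expR_ge0].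
have d0 : 0 <= la ^- 2 * (2 * (2 * l) ^+ 2).
  by apply: mulr_ge0; [exact: ltW | rewrite mulr_ge0 ?sqr_ge0].
exists G; split.
- move=> z; rewrite /G addr_ge0 // sumr_ge0 // => y _.
  by rewrite addr_ge0 // mulr_ge0 // expR_ge0.
- have GB := gaussian_mean_add _ _ _ _ (gaussian_mean_cst _ d0)
    (gaussian_mean_sum I (index_enum I) xpredT _ _ (fun y _ => gaussian_mean_add _ _ _ _
      (gaussian_mean_exp _ (fun i => la * u y i) c0)
      (gaussian_mean_exp _ (fun i => - (la * u y i)) c0))).
  apply: (gaussian_mean_le_trans _ _ _ _ (fun z => lexx _) _ GB).
  have eq1 : la ^- 2 = s ^+ 2 * S / l by rewrite la2 invf_div.
  apply: (@le_trans _ _ (la ^- 2 * (2 * (2 * l) ^+ 2) +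
      \sum_(y : I) (2 * (la ^- 2 * (8 * expR (- (2 * l)))) * expR (l / 2)))).
    rewrite lerD2l; apply: ler_sum => y _.
    have h1 : expR (s ^+ 2 * (\sum_i (la * u y i) ^+ 2) / 2) <= expR (l / 2).
      by rewrite ler_expR.
    have h2 : expR (s ^+ 2 * (\sum_i (- (la * u y i)) ^+ 2) / 2) <= expR (l / 2).
      by under eq_bigr do rewrite sqrrN.
    apply: le_trans (lerD (ler_wpM2l c0 h1) (ler_wpM2l c0 h2)) _; lra.
  rewrite sumr_const -[_ *+ #|_|]mulr_natl.
  have E : expR (l - 1) * expR (- (2 * l)) * expR (l / 2) <= 1.
    rewrite -!expRD -[leRHS]expR0 ler_expR; lra.
  have : #|I|%:R * (expR (- (2 * l)) * expR (l / 2)) <= 1.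
    apply: le_trans E; rewrite -mulrA ler_wpM2r // mulr_ge0 ?expR_ge0 //.
  move: (expR _) (expR (l / 2)) => e1 e2 he.
  have -> : #|I|%:R * (2 * (la ^- 2 * (8 * e1)) * e2) = la ^- 2 * 16 * (#|I|%:R * (e1 * e2)).
    ring.
  apply: (@le_trans _ _ (la ^- 2 * (8 * l ^+ 2 + 16))).
    have : la ^- 2 * 16 * (#|I|%:R * (e1 * e2)) <= la ^- 2 * 16.
      by rewrite ler_piMr // mulr_ge0 // ltW.
    move: (la ^- 2) (#|I|%:R * (e1 * e2)) => t w; lra.
  apply: (@le_trans _ _ (la ^- 2 * (32 * l ^+ 2))).
    by rewrite ler_pM2l //; nra.
  rewrite eq1 le_eqVlt; apply/orP; left; apply/eqP; field; lra.
- move=> y z; rewrite /G.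
  have e : forall t : R, (t ^+ 2 = la ^- 2 * (la * t) ^+ 2).
    by move=> t; field; rewrite gt_eqF.
  rewrite e.
  have -> : la * (\sum_i u y i * z i) = \sum_i (la * u y i) * z i.
    by rewrite mulr_sumr; apply: eq_bigr => i _; rewrite mulrA.
  apply: (@le_trans _ _ (la ^- 2 * (2 * (2 * l) ^+ 2 + 8 * expR (- (2 * l)) *
     (expR (\sum_i (la * u y i) * z i) + expR (- \sum_i (la * u y i) * z i))))).
    rewrite ler_pM2l ?invr_gt0 ?exprn_gt0 //; apply: sqr_le_expR_shift; lra.
  have nE : \sum_i - (la * u y i) * z i = - \sum_i (la * u y i) * z i.
    by rewrite -sumrN; apply: eq_bigr => i _; rewrite mulNr.
  rewrite mulrDr lerD2l (bigD1 y) //= nE -[X in X <= _]addr0 lerD //.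
    by rewrite le_eqVlt; apply/orP; left; apply/eqP; ring.
  by rewrite sumr_ge0 // => y' _; rewrite addr_ge0 // mulr_ge0 // expR_ge0.
Qed.

Lemma gaussian_square_le (u : 'I_n -> R) (S : R) : 0 < s -> 0 < S ->
  \sum_i u i ^+ 2 <= S -> EB (fun z => (\sum_i u i * z i) ^+ 2) (32 * s ^+ 2 * S).
Proof.
move=> s0 S0 hS.
have [|||G [_ GB HG]] := @gaussian_max_le unit (fun=> u) S 1 s0 S0 => //.
  by rewrite card_unit subrr expR0.
by apply: gaussian_mean_le_trans GB => [z|]; [exact: (HG tt) | rewrite mulr1].
Qed.

Lemma expectation_gaussian_mean_le {dT} {T : measurableType dT} (P : probability T R)
  (xi : 'I_n -> {RV P >-> R}) F b (X : T -> R) :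
  0 < s -> mutually_independent xi -> (forall i, normally_distributed 0 s (xi i)) ->
  EB F b -> (forall w, 0 <= X w <= F (fun i => xi i w)) ->
  (\int[P]_w (X w)%:E <= b%:E)%E.
Proof.
move=> s0 ind nX [L [H1 H2]] HX.
apply: (@le_trans _ _ (\int[P]_w (\sum_(p <- L) `|p.1| * expR (\sum_i p.2 i * xi i w))%:E)%E).
  (* The integral of a nonnegative function is a supremum over the simple functions below it; in
     this form monotonicity holds for an arbitrary [X]. *)
  rewrite !ge0_integralTE//; last 2 first.
  - by move=> w; rewrite lee_fin sumr_ge0 // => p _; rewrite mulr_ge0 ?expR_ge0.
  - by move=> w; rewrite lee_fin; have /andP[] := HX w.
  apply: ereal_sup_le => _ [h hX <-] /=; exists h => // w; apply: le_trans (hX w) _; rewrite lee_fin.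
  by have /andP[_ h2] := HX w; apply: le_trans h2 _; exact: H1.
have mE (p : R * ('I_n -> R)) : measurable_fun setT (fun w => expR (\sum_i p.2 i * xi i w)).
  apply: measurableT_comp => //; apply: measurable_sum => i; exact: measurable_funM.
under eq_integral do rewrite -sumEFin.
rewrite ge0_integral_sum//; last first.
  by move=> p; apply/measurable_EFinP; exact: measurable_funM.
apply: (@le_trans _ _ (\sum_(p <- L) (`|p.1| * expR (s ^+ 2 * (\sum_i p.2 i ^+ 2) / 2))%:E)%E).
  apply: lee_sum => p _; under eq_integral do rewrite EFinM.
  rewrite ge0_integralZl//; first by rewrite (gaussian_vector_mgf _ _ _ s).
  exact/measurable_EFinP.
by rewrite sumEFin lee_fin.
Qed.

End GaussianMean.

(** * Tensor products and frames *)

Section Frame.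
Context {R : realType} {A : finType} {n : nat} (eta : A -> 'I_n -> R).
Hypothesis frame : forall i j, \sum_a eta a i * eta a j = (i == j)%:R.

Lemma frame_parseval (z v : 'I_n -> R) :
  \sum_i z i * v i = \sum_a (\sum_i eta a i * z i) * (\sum_i eta a i * v i).
Proof.
under [RHS]eq_bigr do rewrite big_distrlr /=.
rewrite exchange_big /=; apply: eq_bigr => i _.
rewrite exchange_big /= (bigD1 i) //= [X in _ + X]big1 ?addr0 => [|j ji].
  under eq_bigr do rewrite mulrACA.
  by rewrite -mulr_suml frame eqxx mul1r.
under eq_bigr do rewrite mulrACA.
by rewrite -mulr_suml frame eq_sym (negbTE ji) mul0r.
Qed.

(* Analysis is an isometry, so its adjoint, synthesis, is a contraction. *)
Lemma frame_synthesis_le (c : A -> R) :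
  \sum_i (\sum_a c a * eta a i) ^+ 2 <= \sum_a c a ^+ 2.
Proof.
set w := fun i => \sum_a c a * eta a i.
have e1 : \sum_i w i ^+ 2 = \sum_a c a * (\sum_i eta a i * w i).
  under [LHS]eq_bigr do rewrite expr2 {1}/w mulr_suml.
  rewrite exchange_big /=; apply: eq_bigr => a _.
  by rewrite mulr_sumr; apply: eq_bigr => i _; rewrite mulrA.
have e2 : \sum_i w i ^+ 2 = \sum_a (\sum_i eta a i * w i) ^+ 2.
  by under eq_bigr do rewrite expr2; rewrite frame_parseval.
have : 0 <= \sum_a (c a - \sum_i eta a i * w i) ^+ 2 by apply: sumr_ge0 => a _; rewrite sqr_ge0.
under eq_bigr do rewrite sqrrB.
rewrite big_split /= sumrB -e2 sumrMnl -e1 -mulr_natl; lra.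
Qed.

End Frame.

(** The first coordinate is determined by the other d - 1. *)
Lemma card_ffun_sum_le (d l : nat) :
  (#|[pred f : {ffun 'I_d -> 'I_l.+1} | (\sum_j f j)%N == l]| <= l.+1 ^ d.-1)%N.
Proof.
case: d => [|d] /=.
  by apply: leq_trans (max_card _) _; rewrite card_ffun !card_ord.
have inj : {in [pred f : {ffun 'I_d.+1 -> 'I_l.+1} | (\sum_j f j)%N == l] &,
    injective (fun f : {ffun 'I_d.+1 -> 'I_l.+1} => [ffun j : 'I_d => f (lift ord0 j)])}.
  move=> f g; rewrite !inE !big_ord_recl => /eqP sf /eqP sg /ffunP fg.
  have e j : f (lift ord0 j) = g (lift ord0 j) by have := fg j; rewrite !ffunE.
  have e0 : f ord0 = g ord0.
    have e' : (\sum_(i < d) f (lift ord0 i) = \sum_(i < d) g (lift ord0 i))%N.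
      by apply: eq_bigr => i _; rewrite e.
    by apply/val_inj/(@addIn (\sum_(i < d) f (lift ord0 i))%N); rewrite /= sf e' sg.
  by apply/ffunP => j; case: (unliftP ord0 j) => [i ->|->].
rewrite -(card_in_image inj); apply: leq_trans (max_card _) _.
by rewrite card_ffun !card_ord.
Qed.

Definition total_level {d M : nat} (a : {ffun 'I_d -> 'I_M}) : nat :=
  (\sum_j haar_level (a j))%N.

(** For a fixed vector of levels the sum factorizes over the coordinates and the powers of [rho]
    multiply to [rho ^+ l]; the last factor counts the vectors. Used with rho = 1/2 for variances
    and rho = 2 for cardinalities. *)
Lemma total_level_sum_le {R : realType} {d M : nat} (l : nat) (w : 'I_d -> nat -> R)
    (B : 'I_d -> R) (rho : R) :
  (forall j x, 0 <= w j x) -> (forall j, 0 <= B j) -> 0 <= rho ->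
  (forall j lv, (lv <= l)%N ->
     \sum_(x < M | haar_level x == lv) w j x <= B j * rho ^+ lv) ->
  \sum_(a : {ffun 'I_d -> 'I_M} | total_level a == l) \prod_j w j (a j) <=
    (\prod_j B j) * rho ^+ l * (l.+1%:R) ^+ d.-1.
Proof.
move=> w0 B0 rho0 H.
pose lev (a : {ffun 'I_d -> 'I_M}) : {ffun 'I_d -> 'I_l.+1} :=
  [ffun j => inord (haar_level (a j))].
have lev_le (a : {ffun 'I_d -> 'I_M}) j : total_level a == l -> (haar_level (a j) <= l)%N.
  by move=> /eqP<-; rewrite /total_level (bigD1 j) //= leq_addr.
rewrite (partition_big lev (fun f : {ffun 'I_d -> 'I_l.+1} => (\sum_j f j)%N == l)) /=; last first.
  move=> a al; rewrite -[X in _ == X](eqP al); apply/eqP; apply: eq_bigr => j _.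
  by rewrite ffunE inordK // ltnS lev_le.
apply: (@le_trans _ _ (\sum_(f : {ffun 'I_d -> 'I_l.+1} | (\sum_j f j)%N == l)
    (\prod_j B j) * rho ^+ l)).
  apply: ler_sum => f /eqP fl.
  apply: (@le_trans _ _ (\sum_(a in family (fun j (x : 'I_M) => haar_level x == f j))
       \prod_j w j (a j))).
    rewrite big_mkcond [leRHS]big_mkcond; apply: ler_sum => a _.
    case: (boolP (_ \in family _)) => [_|/negP af]; first by case: ifP => // _; exact: prodr_ge0.
    case: andP => // -[al /eqP e]; case: af; apply/familyP => j.
    by rewrite -topredE /= -e ffunE inordK // ltnS lev_le.
  rewrite -(bigA_distr_big_dep _ (fun j (x : 'I_M) => w j x)).
  have -> : rho ^+ l = \prod_j rho ^+ f j by rewrite prodrXr fl.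
  rewrite -big_split /=.
  apply: ler_prod => j _; rewrite sumr_ge0 // H //.
  by rewrite -ltnS ltn_ord.
rewrite sumr_const -[_ *+ _]mulr_natr ler_wpM2l //.
  by rewrite mulr_ge0 ?exprn_ge0 ?prodr_ge0.
by rewrite -natrX ler_nat; apply: card_ffun_sum_le.
Qed.

(* Values at the dyadic nodes of resolution [l] from which [haar_tail] is
   interpolated; [y] ranges over the [2 ^ minn l q + 1] nodes. *)
Definition haar_node (R : rcfType) (q l x y : nat) : R :=
  if (x < 2 ^ q)%N && (y <= 2 ^ minn l q)%N then
    Num.sqrt 2 ^+ (q - minn l q) * haar_tail R (minn l q) x y else 0.

Lemma haar_node_interp (R : rcfType) (q l k : nat) : (k <= 2 ^ q)%N ->
  exists a : 'I_(2 ^ l).+1 -> R, [/\ forall y, 0 <= a y, \sum_y a y = 1 &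
    forall x, (x < 2 ^ q)%N -> (haar_level x <= l)%N ->
      haar_tail R q x k = \sum_y a y * haar_node R q l x y].
Proof.
move=> hk; set p := minn l q.
have pq : (p + (q - p) = q)%N by rewrite subnKC // geq_minr.
have [a [a0 a1 aE]] := @haar_tail_interp R p (q - p) k ltac:(by rewrite pq).
have pl : (2 ^ p <= 2 ^ l)%N by rewrite leq_exp2l // geq_minl.
(* The nodes are indexed independently of [q], so that all sides of a block share one index type;
   for q < l the surplus nodes get weight 0. *)
have sumE (G : nat -> R) : \sum_(y < (2 ^ l).+1) (if (y <= 2 ^ p)%N then a (inord y) else 0) * G y
    = \sum_(y < (2 ^ p).+1) a y * G y.
  rewrite [RHS](@big_ord_widen_leq _ _ _ _ (2 ^ l).+1) ?ltnS // [RHS]big_mkcond /=.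
  apply: eq_bigr => y _; case: ifP => yp; last by rewrite mul0r.
  by rewrite inordK.
exists (fun y => if (y <= 2 ^ p)%N then a (inord y) else 0); split.
- by move=> y; case: ifP.
- have := sumE (fun=> 1); under eq_bigr do rewrite mulr1; move=> ->.
  by under eq_bigr do rewrite mulr1.
move=> x xq lx; have xp : (x < 2 ^ p)%N.
  by rewrite -haar_level_le leq_min lx haar_level_le.
rewrite (sumE (haar_node R q l x)) -{1}pq aE // mulr_sumr; apply: eq_bigr => y _.
by rewrite /haar_node xq -ltnS ltn_ord /= mulrCA.
Qed.

Lemma haar_node_sq (R : rcfType) (q l M y lv : nat) : (lv <= l)%N ->
  \sum_(x < M | haar_level x == lv) haar_node R q l x y ^+ 2 <= 2 ^+ q * 2^-1 ^+ lv.
Proof.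
move=> lvl; set p := minn l q.
have r0 : 0 <= 2 ^+ q * 2^-1 ^+ lv :> R by rewrite mulr_ge0 ?exprn_ge0 ?invr_ge0.
have [yp|yp] := leqP y (2 ^ p); last first.
  rewrite big1 // => x _; rewrite /haar_node -/p [(y <= _)%N]leqNgt yp andbF expr0n.
  by [].
have [lvq|lvq] := leqP lv q; last first.
  rewrite big1 // => x /eqP xlv; rewrite /haar_node.
  by rewrite -haar_level_le leqNgt xlv lvq /= expr0n.
have lvp : (lv <= p)%N by rewrite leq_min lvl lvq.
apply: (@le_trans _ _ (\sum_(0 <= x < 2 ^ p | haar_level x == lv)
   2 ^+ (q - p) * haar_tail R p x y ^+ 2)); last first.
  rewrite -mulr_sumr; apply: le_trans (ler_wpM2l _ (haar_tail_sq _ _ _ _ yp lvp)) _.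
    by rewrite exprn_ge0.
  rewrite -exprD exprVn -expfB_cond; last by rewrite pnatr_eq0.
  rewrite (_ : (q - p + (p - lv) = q - lv)%N) //.
  by have := geq_minr l q; rewrite -/p; lia.
rewrite -(big_mkord (fun x => haar_level x == lv) (fun x => haar_node R q l x y ^+ 2)).
have E x : haar_level x == lv -> (x < 2 ^ p)%N by rewrite -haar_level_le => /eqP->.
have Eq x : haar_level x == lv -> haar_node R q l x y ^+ 2 = 2 ^+ (q - p) * haar_tail R p x y ^+ 2.
  move=> xlv; rewrite /haar_node -/p yp.
  rewrite -haar_level_le (eqP xlv) lvq /= exprMn -exprM mulnC exprM sqr_sqrtr ?ler0n //.
rewrite (eq_bigr _ Eq).
rewrite (big_nat_widen 0 M (maxn M (2 ^ p))) ?leq_maxl //.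
rewrite (big_nat_widen 0 (2 ^ p) (maxn M (2 ^ p))) ?leq_maxr //.
rewrite big_mkcond [leRHS]big_mkcond /=; apply: ler_sum => x _.
have F0 : 0 <= 2 ^+ (q - p) * haar_tail R p x y ^+ 2 by rewrite mulr_ge0 ?sqr_ge0 ?exprn_ge0.
case: (boolP (haar_level x == lv)) => [h|//=].
rewrite (E _ h) /=.
case: ifP => // _.
Qed.

(** * Summation by parts for entirely monotone functions *)

(** A coordinate with k_i = 0 is not differenced, as if [F] vanished at -1. These are therefore the
    coefficients of [F] in its expansion over indicators of orthants, with no separate boundary
    terms. *)
Definition mixed_difference {R : pzRingType} {I : finType} (F : (I -> nat) -> R) (k : I -> nat) : R :=
  \sum_(J : {ffun I -> bool} | [forall i, (J i <= (0 < k i)%N)%N])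
    (-1) ^+ (\sum_i J i)%N * F (fun i => k i - J i)%N.

Section Abel.
Context {R : comPzRingType} {I : finType}.

Lemma sum_delta (T : finType) (F : T -> R) (x : T) :
  F x = \sum_y F y * (x == y)%:R.
Proof.
rewrite (bigD1 x) //= eqxx mulr1 big1 ?addr0 // => y.
by rewrite eq_sym => /negbTE->; rewrite mulr0.
Qed.

Lemma prod_delta (T : finType) (x y : {ffun I -> T}) :
  (x == y)%:R = \prod_i (x i == y i)%:R :> R.
Proof.
have [->|xy] := eqVneq x y; first by rewrite big1 // => i _; rewrite eqxx.
have [i xyi] : exists i, x i != y i.
  apply/existsP; rewrite -negb_forall; apply: contra xy => /forallP h.
  by apply/eqP/ffunP => i; apply/eqP.
by rewrite (bigD1 i) //= (negbTE xyi) mul0r.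
Qed.

Lemma mixed_difference_prod (g : I -> nat -> R) (k : I -> nat) :
  mixed_difference (fun u => \prod_i g i (u i)) k =
  \prod_i (g i (k i) - if (0 < k i)%N then g i (k i).-1 else 0).
Proof.
pose G i (b : bool) : R := (-1) ^+ b * g i (k i - b)%N.
have E i : g i (k i) - (if (0 < k i)%N then g i (k i).-1 else 0) =
    \sum_(b : bool | (b <= (0 < k i)%N)%N) G i b.
  rewrite big_mkcond big_bool /= /G subn0 subn1 expr0 expr1.
  by case: (k i) => [|n] /=; ring.
under [RHS]eq_bigr do rewrite E.
rewrite bigA_distr_big_dep /mixed_difference; apply: eq_big => [J|J _].
  by apply/forallP/familyP => h i; have := h i.
by rewrite /G big_split /= prodrXr.
Qed.

Lemma mixed_difference_sum (T : finType) (F : T -> (I -> nat) -> R) (c : T -> R) (k : I -> nat) :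
  mixed_difference (fun u => \sum_t c t * F t u) k = \sum_t c t * mixed_difference (F t) k.
Proof.
rewrite /mixed_difference; under [RHS]eq_bigr do rewrite mulr_sumr.
rewrite exchange_big /=; apply: eq_bigr => J _.
by rewrite mulr_sumr; apply: eq_bigr => t _; rewrite mulrCA.
Qed.

Lemma eq_mixed_difference (F G : (I -> nat) -> R) (k : I -> nat) :
  (forall u, (forall i, u i <= k i)%N -> F u = G u) ->
  mixed_difference F k = mixed_difference G k.
Proof.
by move=> FG; apply: eq_bigr => J _; rewrite FG // => i; rewrite leq_subr.
Qed.

(** Summation by parts for a point mass at [p]: the two surviving tails start at p - s and p - s + 1
    and differ by [e p]. A mass below [s] is invisible to the differences, so [e] has to vanish
    there. *)
Lemma sum_difference_tail (M s p : nat) (e : nat -> R) :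
  (p < M)%N -> (forall x, (x < s)%N -> e x = 0) ->
  \sum_(k < M) ((s + k == p)%N%:R - (if (0 < k)%N then (s + k.-1 == p)%N%:R else 0)) *
     (\sum_(k <= x < M - s) e (s + x)%N) = e p.
Proof.
move=> pM e0; set t := fun k => \sum_(k <= x < M - s) e (s + x)%N.
have [ps|sp] := ltnP p s.
  rewrite e0 // big1 // => k _.
  have -> : (s + k == p)%N = false by lia.
  have -> : (s + k.-1 == p)%N = false by lia.
  by rewrite if_same subrr mul0r.
set q := (p - s)%N; have qM : (q < M)%N by rewrite /q; lia.
under eq_bigr do rewrite mulrBl -/(t _).
rewrite sumrB (bigD1 (Ordinal qM)) //= [X in _ + X - _]big1 ?addr0; last first.
  move=> k kq; rewrite (_ : (s + k == p)%N = false) ?mul0r //.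
  by apply/eqP => h; move/eqP: kq; apply; apply/val_inj => /=; rewrite /q; lia.
have -> : (s + q == p)%N by rewrite /q; lia.
rewrite mul1r {1}/t big_ltn; last by rewrite /q; lia.
rewrite -/(t q.+1) (_ : (s + q = p)%N); last by rewrite /q; lia.
suff -> : \sum_(k < M) (if (0 < k)%N then (s + k.-1 == p)%N%:R else 0) * t k = t q.+1.
  by rewrite addrK.
have [q1M|q1M] := ltnP q.+1 M; last first.
  rewrite big1; first by rewrite /t big_geq // /q; lia.
  move=> k _; case: ifP => k0; last by rewrite mul0r.
  rewrite (_ : (s + k.-1 == p)%N = false) ?mul0r //; have := ltn_ord k; rewrite /q in q1M; lia.
rewrite (bigD1 (Ordinal q1M)) //= big1 ?addr0.
  by rewrite (_ : (s + q == p)%N) ?mul1r //; rewrite /q; lia.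
move=> k kq; case: ifP => k0; last by rewrite mul0r.
rewrite (_ : (s + k.-1 == p)%N = false) ?mul0r //.
by apply/eqP => h; move/eqP: kq; apply; apply/val_inj => /=; rewrite /q; lia.
Qed.

(* Both sides are linear in [F], so it is enough to compare them when [F] is a
   product of point masses, where everything factorizes over the coordinates. *)
Lemma abel_summation (M : nat) (s : I -> nat) (eta : I -> nat -> R) (F : (I -> nat) -> R) :
  (forall i x, (x < s i)%N -> eta i x = 0) ->
  \sum_(u : {ffun I -> 'I_M}) F (fun i => u i) * \prod_i eta i (u i) =
  \sum_(k : {ffun I -> 'I_M}) mixed_difference (fun u => F (fun i => s i + u i)%N) (fun i => k i) *
     \prod_i \sum_(k i <= x < M - s i) eta i (s i + x)%N.
Proof.
move=> e0; pose t i k := \sum_(k <= x < M - s i) eta i (s i + x)%N.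
pose D (p k : {ffun I -> 'I_M}) i : R :=
  (s i + k i == p i)%N%:R - (if (0 < k i)%N then (s i + (k i).-1 == p i)%N%:R else 0).
have E (k : {ffun I -> 'I_M}) :
    mixed_difference (fun u => F (fun i => s i + u i)%N) (fun i => k i) * \prod_i t i (k i) =
    \sum_(p : {ffun I -> 'I_M}) F (fun i => p i) * \prod_i (D p k i * t i (k i)).
  under [RHS]eq_bigr do rewrite big_split /= mulrA.
  rewrite -mulr_suml.
  have [/forallP kM|] := boolP [forall i, (s i + k i < M)%N]; last first.
    rewrite negb_forall => /existsP[i]; rewrite -leqNgt => ki.
    have -> : \prod_i t i (k i) = 0; last by rewrite !mulr0.
    by rewrite (bigD1 i) //= /t big_geq ?mul0r //; lia.
  congr (_ * _).
  rewrite (eq_mixed_difference _ (fun u => \sum_(p : {ffun I -> 'I_M})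
      F (fun i => p i) * \prod_i (s i + u i == p i)%N%:R)).
    rewrite mixed_difference_sum; apply: eq_bigr => p _; congr (_ * _).
    by rewrite (mixed_difference_prod (fun i x => (s i + x == p i)%N%:R)).
  move=> u uk.
  have uM i : (s i + u i < M)%N by apply: leq_ltn_trans (kM i); rewrite leq_add2l.
  pose x : {ffun I -> 'I_M} := [ffun i => Ordinal (uM i)].
  have -> : F (fun i => s i + u i)%N = F (fun i => x i).
    by congr F; apply/funext => i; rewrite ffunE.
  rewrite (sum_delta _ (fun y : {ffun I -> 'I_M} => F (fun i => y i)) x).
  apply: eq_bigr => p _; congr (_ * _); rewrite prod_delta; apply: eq_bigr => i _.
  by rewrite ffunE -val_eqE.
under [RHS]eq_bigr do rewrite E.
rewrite exchange_big /=; apply: eq_bigr => p _; rewrite -mulr_sumr; congr (_ * _).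
pose f i (k : 'I_M) : R :=
  ((s i + k == p i)%N%:R - (if (0 < k)%N then (s i + k.-1 == p i)%N%:R else 0)) * t i k.
transitivity (\prod_i \sum_(k < M) f i k); last by rewrite bigA_distr_bigA.
by apply: eq_bigr => i _; rewrite sum_difference_tail //; exact: e0.
Qed.

End Abel.

Definition grid_value {R : realType} {I : finType} (m : I -> nat) (f : (I -> R) -> R)
  (u : I -> nat) : R := f (fun j => (u j)%:R / (m j)%:R).

Lemma grid_in_cube {R : realType} {I : finType} (m u : I -> nat) :
  (forall j, 0 < m j)%N -> (forall j, u j <= m j)%N ->
  in_cube (fun j => (u j)%:R / (m j)%:R : R).
Proof.
move=> m0 um j; rewrite divr_ge0 ?ler0n //= ler_pdivrMr ?ltr0n //.
by rewrite mul1r ler_nat.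
Qed.

Section EntirelyMonotone.
Context {R : realType} {I : finType} (f : (I -> R) -> R).
Hypothesis fEM : entirely_monotone f.

(** The quasi-volume of a box degenerate in all coordinates but one is an increment along an axis.
    The coordinates where the two points differ are changed one at a time. *)
Lemma em_le (a b : I -> R) : in_cube a -> in_cube b -> (forall j, a j <= b j) -> f a <= f b.
Proof.
move=> ac; move: {2}#|_| (leqnn #|[pred j | a j != b j]|) => n.
elim: n b => [|n IH] b hn bc ab.
  have -> : a = b; last by [].
  apply/funext => j; apply/eqP; apply: contraLR hn => abj.
  by rewrite -ltnNge; apply/card_gt0P; exists j.
have [[j abj]|ab_eq] := pselect (exists j, a j != b j); last first.
  have -> : a = b; last by [].
  by apply/funext => j; apply/eqP; apply: contrapT => /negP h; apply: ab_eq; exists j.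
pose b' i := if i == j then a i else b i.
have b'c : in_cube b' by move=> i; rewrite /b'; case: ifP.
have b'b i : b' i <= b i by rewrite /b'; case: ifP.
apply: (@le_trans _ _ (f b')).
  apply: IH => // [|i]; last by rewrite /b'; case: ifP.
  rewrite -ltnS; apply: leq_trans hn; apply: proper_card; apply/properP; split.
    by apply/fintype.subsetP => i; rewrite !inE /b'; case: ifP; rewrite ?eqxx.
  by exists j; rewrite !inE // /b' eqxx negbK eqxx.
have b'nb : b' <> b by move=> /(congr1 (fun g => g j)); rewrite /b' eqxx => /eqP; exact/negP.
have := fEM b' b b'c bc b'nb b'b; rewrite /quasi_volume.
have dE i : (b' i != b i) = (i == j).
  by rewrite /b'; case: (i =P j) => [->|_]; rewrite ?abj ?eqxx.
pose J0 : {ffun I -> bool} := [ffun=> false]; pose J1 : {ffun I -> bool} := [ffun i => i == j].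
rewrite (bigD1 J0) /=; last by apply/forallP => i; rewrite ffunE.
rewrite (bigD1 J1) /=; last first.
  apply/andP; split; first by apply/forallP => i; rewrite ffunE dE.
  by apply/eqP => /ffunP/(_ j); rewrite !ffunE eqxx.
rewrite [X in _ + (_ + X)]big1 ?addr0; last first.
  move=> J /andP[/andP[/forallP HJ J00] J11]; exfalso; case: (boolP (J j)) => Jj.
    move/eqP: J11; apply; apply/ffunP => i; rewrite ffunE; case: (i =P j) => [->//|/eqP ij].
    by have := HJ i; rewrite dE (negbTE ij); case: (J i).
  move/eqP: J00; apply; apply/ffunP => i; rewrite ffunE; have := HJ i; rewrite dE.
  by case: (i =P j) => [->|_]; [rewrite (negbTE Jj) | case: (J i)].
rewrite big1 ?expr0 ?mul1r => [|i _]; last by rewrite ffunE.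
rewrite (bigD1 j) //= ffunE eqxx big1 ?addn0 ?expr1 ?mulN1r => [|i /negbTE ij];
  last by rewrite ffunE ij.
have -> : (fun i => b i + (J0 i)%:R * (b' i - b i)) = b.
  by apply/funext => i; rewrite ffunE mul0r addr0.
have -> : (fun i => b i + (J1 i)%:R * (b' i - b i)) = b'.
  apply/funext => i; rewrite ffunE /b'; case: eqP => _ /=; first by rewrite mul1r addrC subrK.
  by rewrite mul0r addr0.
by rewrite subr_ge0.
Qed.

Lemma mixed_difference0 (F : (I -> nat) -> R) (k : I -> nat) :
  (forall i, k i = 0)%N -> mixed_difference F k = F k.
Proof.
move=> k0; rewrite /mixed_difference (big_pred1 [ffun=> false]) => [|J].
  rewrite big1 ?expr0 ?mul1r => [|i _]; last by rewrite ffunE.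
  by congr F; apply/funext => i; rewrite ffunE subn0.
apply/forallP/eqP => [h|-> i]; last by rewrite ffunE.
by apply/ffunP => i; rewrite ffunE; have := h i; rewrite k0; case: (J i).
Qed.

(** A coordinate with k_i = 0 has equal end points, and both definitions then skip the difference.
    Entire monotonicity thus reaches every mixed difference with k != 0, not only those of
    full-dimensional boxes. *)
Lemma quasi_volume_nodes (t : I -> nat -> R) (k : I -> nat) :
  (forall i, (0 < k i)%N -> t i (k i).-1 != t i (k i)) ->
  quasi_volume f (fun i => t i (k i - (0 < k i))%N) (fun i => t i (k i)) =
  mixed_difference (fun u => f (fun i => t i (u i))) k.
Proof.
move=> tk; have ab i : (t i (k i - (0 < k i))%N != t i (k i)) = (0 < k i)%N.
  by case: posnP => ki; rewrite ?subn0 ?eqxx //= subn1 tk.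
apply: eq_big => [J|J /forallP HJ]; first by apply: eq_forallb => i; rewrite ab.
congr (_ * f _); apply/funext => i; have := HJ i; rewrite ab.
case: (J i) => /=; last by rewrite subn0 mul0r addr0.
by case: (k i) => [|n] //= _; rewrite mul1r addrC subrK.
Qed.

Lemma em_nodes_ge0 (t : I -> nat -> R) (k : I -> nat) :
  (forall i x, (x <= k i)%N -> 0 <= t i x <= 1) ->
  (forall i, (0 < k i)%N -> t i (k i).-1 < t i (k i)) -> (exists j, 0 < k j)%N ->
  0 <= mixed_difference (fun u => f (fun i => t i (u i))) k.
Proof.
move=> t01 tk [j kj]; rewrite -quasi_volume_nodes; last by move=> i ki; rewrite lt_eqF ?tk.
apply: fEM => [i|i|/(congr1 (fun h => h j))|i]; rewrite ?t01 ?leq_subr //.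
  by rewrite kj subn1 => /eqP; rewrite lt_eqF ?tk.
by case: posnP => ki; rewrite ?subn0 //= subn1 ltW ?tk.
Qed.

Variable m : I -> nat.
Hypothesis m0 : forall j, (0 < m j)%N.

Lemma em_mixed_difference_ge0 (s k : I -> nat) :
  (forall j, s j + k j <= m j)%N -> (exists j, 0 < k j)%N ->
  0 <= mixed_difference (fun u => grid_value m f (fun i => s i + u i)%N) k.
Proof.
move=> skm; apply: (em_nodes_ge0 (fun i x => (s i + x)%N%:R / (m i)%:R)) => [i x xk|i ki].
  have := @grid_in_cube R I m (fun j => minn (m j) (s j + x))%N m0 (fun j => geq_minl _ _) i.
  by rewrite (minn_idPr _) //; have := skm i; lia.
by rewrite ltr_pM2r ?invr_gt0 ?ltr0n // ltr_nat; lia.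
Qed.

Variables (M : nat) (s N : I -> nat).
Hypotheses (N0 : forall i, (0 < N i)%N) (sN : forall i, (s i + N i <= m i)%N)
  (mM : forall i, (m i <= M)%N).

(** Abel summation against the point mass at the far corner, whose tails are the indicators of k_i <
    N_i. *)
Lemma sum_mixed_difference (F : (I -> nat) -> R) :
  \sum_(k : {ffun I -> 'I_M} | [forall i, (k i < N i)%N])
    mixed_difference (fun u => F (fun i => s i + u i)%N) (fun i => k i) =
  F (fun i => s i + (N i).-1)%N.
Proof.
have hM i : (s i + (N i).-1 < M)%N by have := N0 i; have := sN i; have := mM i; lia.
have := @abel_summation R I M s (fun i x => (x == s i + (N i).-1)%N%:R) F.
pose p : {ffun I -> 'I_M} := [ffun i => Ordinal (hM i)].
rewrite (bigD1 p) //= big1 => [|i _]; last by rewrite ffunE eqxx.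
rewrite mulr1 big1 ?addr0; last first.
  move=> u up; have := prod_delta (R := R) _ u p; rewrite (negbTE up).
  under [X in _ = X -> _]eq_bigr do rewrite ffunE -val_eqE.
  by move=> <-; rewrite mulr0.
have -> : (fun i => p i : nat) = (fun i => s i + (N i).-1)%N.
  by apply/funext => i; rewrite ffunE.
move=> ->; last by move=> i x xs; rewrite (_ : (x == _) = false) //; lia.
rewrite big_mkcond; apply: eq_bigr => k _.
have tE i : \sum_(k i <= x < M - s i) (s i + x == s i + (N i).-1)%N%:R = (k i < N i)%N%:R :> R.
  have [kN|kN] := ltnP (k i) (N i); last first.
    rewrite big_nat_cond big1 // => x /andP[/andP[kx _] _].
    by rewrite (_ : (_ == _)%N = false) //; have := N0 i; lia.
  have hi := hM i; have Ni := N0 i.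
  rewrite (@big_cat_nat _ _ _ (N i).-1) /=; [|lia|lia].
  rewrite big_nat_cond big1 ?add0r => [|x /andP[/andP[_ xN] _]]; last first.
    by rewrite (_ : (_ == _)%N = false) //; lia.
  rewrite big_ltn; last by lia.
  rewrite eqxx big_nat_cond big1 ?addr0 // => x /andP[/andP[xN _] _].
  by rewrite (_ : (_ == _)%N = false) //; lia.
under [X in _ * X]eq_bigr do rewrite tE.
case: ifPn => [/forallP h|]; first by rewrite big1 ?mulr1 // => i _; rewrite h.
rewrite negb_forall => /existsP[i /negbTE ki].
by rewrite (bigD1 i) //= ki mul0r mulr0.
Qed.

(** After summation by parts the only coefficient of unknown sign is the one at k = 0, the value of
    [f] at the lower corner; it is removed because the pairing with constants vanishes. The other
    coefficients are nonnegative and their total mass is the increment of [f]. *)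
Lemma em_pairing_le (A : finType) (g : A -> R) (eta : A -> I -> nat -> R) (Z : R) :
  (forall a i x, ~~ (s i <= x < s i + N i)%N -> eta a i x = 0) ->
  let t a i k := \sum_(k <= x < M - s i) eta a i (s i + x)%N in
  \sum_a g a * \prod_i t a i 0%N = 0 ->
  (forall k : I -> nat, (forall i, k i < N i)%N -> `|\sum_a g a * \prod_i t a i (k i)| <= Z) ->
  `|\sum_a g a * \sum_(u : {ffun I -> 'I_M}) grid_value m f (fun i => u i) * \prod_i eta a i (u i)|
    <= (grid_value m f (fun i => s i + (N i).-1)%N - grid_value m f s) * Z.
Proof.
move=> e0 t Y0 YZ.
pose F := grid_value m f; pose beta (k : {ffun I -> 'I_M}) :=
  mixed_difference (fun u => F (fun i => s i + u i)%N) (fun i => k i).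
pose Y (k : {ffun I -> 'I_M}) := \sum_a g a * \prod_i t a i (k i).
have M0 (i : I) : (0 < M)%N by have := mM i; have := m0 i; lia.
have t0 a i k : (N i <= k)%N -> t a i k = 0.
  move=> Nk; rewrite /t big_nat_cond big1 // => x /andP[/andP[kx _] _].
  by apply: e0; lia.
have -> : \sum_a g a * (\sum_(u : {ffun I -> 'I_M}) F (fun i => u i) * \prod_i eta a i (u i)) =
    \sum_k beta k * Y k.
  have E a : \sum_(u : {ffun I -> 'I_M}) F (fun i => u i) * \prod_i eta a i (u i) =
      \sum_k beta k * \prod_i t a i (k i).
    by apply: (abel_summation M s (eta a) F) => i x xs; apply: e0; lia.
  under eq_bigr do rewrite E mulr_sumr.
  rewrite exchange_big /=; apply: eq_bigr => k _; rewrite /Y mulr_sumr.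
  by apply: eq_bigr => a _; rewrite mulrCA.
rewrite (bigID (fun k : {ffun I -> 'I_M} => [forall i, (k i < N i)%N])) /=.
rewrite [X in _ + X]big1 ?addr0; last first.
  move=> k; rewrite negb_forall => /existsP[i]; rewrite -leqNgt => Nk.
  by rewrite /Y big1 ?mulr0 // => a _; rewrite (bigD1 i) //= t0 // mul0r mulr0.
pose kz : {ffun I -> 'I_M} := [ffun i => Ordinal (M0 i)].
have kzN : [forall i, (kz i < N i)%N] by apply/forallP => i; rewrite ffunE N0.
have := sum_mixed_difference F; rewrite (bigD1 kz) //= mixed_difference0 => [|i]; last by rewrite ffunE.
have -> : (fun i => s i + kz i)%N = s by apply/funext => i; rewrite ffunE addn0.
rewrite -/F => /(canRL (addKr _)); rewrite addrC => <-.
rewrite (bigD1 kz) //= {1}/Y (eq_bigr (fun a => g a * \prod_i t a i 0%N)) => [|a _]; last first.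
  by congr (_ * _); apply: eq_bigr => i _; rewrite ffunE.
rewrite Y0 mulr0 add0r mulr_suml; apply: le_trans (ler_norm_sum _ _ _) _.
apply: ler_sum => k /andP[/forallP kN kkz]; rewrite normrM.
have bk : 0 <= beta k.
  apply: em_mixed_difference_ge0 => [j|]; first by have := sN j; have := kN j; lia.
  apply: contrapT => h; move/eqP: kkz; apply; apply/ffunP => i; rewrite ffunE; apply/val_inj => /=.
  by apply/eqP; rewrite -leqn0 leqNgt; apply/negP => ki; apply: h; exists i.
by rewrite ger0_norm // ler_wpM2l // YZ.
Qed.

End EntirelyMonotone.

(** * The blockwise wavelet frame of the grid *)

Lemma leq_exp_base (a b e : nat) : (a <= b)%N -> (a ^ e <= b ^ e)%N.
Proof. by case: e => // e ab; rewrite leq_exp2r. Qed.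

Lemma weighted_cauchy_schwarz {R : realFieldType} (I : finType) (Q : pred I) (x w : I -> R) :
  (forall i, Q i -> 0 < w i) ->
  (\sum_(i | Q i) x i) ^+ 2 <= (\sum_(i | Q i) w i) * (\sum_(i | Q i) x i ^+ 2 / w i).
Proof.
move=> w0; set W := \sum_(i | Q i) w i; set X := \sum_(i | Q i) x i.
have W0 : 0 <= W by apply: sumr_ge0 => i /w0/ltW.
have H t : 2 * t * X - t ^+ 2 * W <= \sum_(i | Q i) x i ^+ 2 / w i.
  rewrite /X /W !mulr_sumr -sumrB; apply: ler_sum => i /w0 wi.
  rewrite -subr_ge0.
  have -> : x i ^+ 2 / w i - (2 * t * x i - t ^+ 2 * w i) = (x i - t * w i) ^+ 2 / w i.
    by field; rewrite gt_eqF.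
  by rewrite divr_ge0 ?sqr_ge0 // ltW.
have [W1|W1] := eqVneq W 0.
  rewrite W1 mul0r; have wi := psumr_eq0P (fun k hk => ltW (w0 k hk)) W1.
  by rewrite /X big_pred0 ?expr0n // => i; apply/negbTE/negP => Qi; have := w0 i Qi; rewrite wi ?ltxx.
have W2 : 0 < W by rewrite lt_def W1.
have := ler_wpM2l W0 (H (X / W)).
have -> : W * (2 * (X / W) * X - (X / W) ^+ 2 * W) = X ^+ 2 by field.
by [].
Qed.

Lemma card_level_le {R : numDomainType} (M lv : nat) :
  \sum_(x < M | haar_level x == lv) 1 <= 2 ^+ lv :> R.
Proof.
have -> : \sum_(x < M | haar_level x == lv) 1 = (\sum_(x < M | haar_level x == lv) 1)%N%:R :> R.
  by rewrite natr_sum.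
rewrite -natrX ler_nat.
rewrite -(big_mkord (fun x => haar_level x == lv) (fun=> 1%N)).
rewrite (big_nat_widen 0 M (maxn M (2 ^ lv))) ?leq_maxl //.
apply: (@leq_trans (\sum_(0 <= x < maxn M (2 ^ lv) | true && (x < 2 ^ lv)%N) 1)).
  rewrite big_mkcond [X in (_ <= X)%N]big_mkcond /=; apply: leq_sum => x _.
  case: ifP => // /andP[/eqP xl _]; by rewrite -haar_level_le xl leqnn.
by rewrite -big_nat_widen ?leq_maxr // sum_nat_const_nat muln1 subn0.
Qed.

Lemma sum_shift_le {R : numDomainType} (N L : nat) (phi : nat -> R) :
  (forall z, 0 <= phi z) ->
  \sum_(l < N | (L < l)%N) phi (l - L)%N <= \sum_(z < N) phi z.
Proof.
move=> phi0.
apply: (@le_trans _ _ (\sum_(L <= l < N) phi (l - L)%N)).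
  rewrite big_geq_mkord /= big_mkcond [leRHS]big_mkcond; apply: ler_sum => l _.
  case: ifP => [/ltnW->//|_]; by case: ifP.
rewrite -{1}[L]add0n big_addn -(big_mkord xpredT).
under eq_bigr do rewrite addnK.
rewrite [leRHS](@big_cat_nat _ _ _ (N - L)) ?leq_subr //=.
by rewrite lerDl sumr_ge0.
Qed.

Lemma sum_geometric_le {R : realFieldType} (N : nat) : \sum_(z < N) (3 / 4 : R) ^+ z <= 4.
Proof.
suff : \sum_(z < N) (3 / 4 : R) ^+ z = 4 - 4 * (3 / 4) ^+ N.
  have h : 0 <= (3 / 4 : R) ^+ N by rewrite exprn_ge0 // divr_ge0.
  by move=> ->; lra.
elim: N => [|N IH]; first by rewrite big_ord0 expr0; lra.
by rewrite big_ord_recr /= IH exprS; lra.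
Qed.

Section Grid.
Context {R : realType} {d n : nat}.
Variables (m : 'I_d -> nat) (idx : 'I_n -> 'I_d -> nat).
Hypotheses (m0 : forall j, (0 < m j)%N) (idx_lt : forall i j, (idx i j < m j)%N)
  (idx_inj : forall i i', (forall j, idx i j = idx i' j) -> i = i')
  (idx_surj : forall u : 'I_d -> nat, (forall j, u j < m j)%N ->
     exists i, forall j, idx i j = u j).
Variables (K : 'I_d -> nat) (bs : 'I_d -> nat -> nat -> nat) (bv : 'I_d -> nat -> nat -> bool).
Hypotheses (blkP : forall j c k, bv j c k -> [/\ (k <= K j)%N, (2 ^ k <= bs j c k + 1)%N &
     (bs j c k + 2 * 2 ^ k <= m j + 1)%N])
  (blk_cover : forall j x, (x < m j)%N ->
     (\sum_(c < 3) \sum_(k < (K j).+1) (bv j c k && in_block (bs j c k) k x) = 1)%N).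
Variables (M Q : nat).
Hypotheses (mM : forall j, (m j <= M)%N) (KQ : forall j, (K j < Q)%N).

Local Notation block := {ffun 'I_d -> 'I_3 * 'I_Q}.
Local Notation wave := {ffun 'I_d -> 'I_M}.

Lemma grid_sum (H : ('I_d -> nat) -> R) :
  (forall u, ~ (forall j, u j < m j)%N -> H u = 0) ->
  \sum_i H (idx i) = \sum_(u : wave) H (fun j => u j).
Proof.
move=> H0; pose toU i : wave := [ffun j => Ordinal (leq_trans (idx_lt i j) (mM j))].
have toU_inj : injective toU.
  move=> i i' /ffunP e; apply: idx_inj => j; have := e j.
  by rewrite !ffunE => /(congr1 val).
have toUE i : (fun j => toU i j : nat) = idx i by apply/funext => j; rewrite ffunE.
transitivity (\sum_i \sum_(u : wave) H (fun j => u j) * (toU i == u)%:R).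
  apply: eq_bigr => i _; rewrite -toUE.
  exact: (sum_delta _ (fun u : wave => H (fun j => u j))).
rewrite exchange_big /=; apply: eq_bigr => u _; rewrite -mulr_sumr.
have [um|um] := pselect (forall j, (u j < m j)%N); last by rewrite H0 ?mul0r.
have [i ei] := idx_surj _ um.
have ui : toU i = u by apply/ffunP => j; rewrite ffunE; apply/val_inj; rewrite /= ei.
rewrite (bigD1 i) //= ui eqxx big1 ?addr0 ?mulr1 // => i' ii'.
by rewrite -ui (inj_eq toU_inj) (negbTE ii').
Qed.

(** Indices that name no block or no wavelet give the zero function, so that one finite type serves
    all blocks; the result is a Parseval frame rather than a basis. *)
Definition wavelet1 (j : 'I_d) (b : 'I_3 * 'I_Q) (l x : nat) : R :=
  if [&& bv j b.1 b.2, in_block (bs j b.1 b.2) b.2 x & (l < 2 ^ b.2)%N]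
  then haar R b.2 l (x - bs j b.1 b.2) else 0.

Definition wavelet (a : block * wave) (i : 'I_n) : R :=
  \prod_j wavelet1 j (a.1 j) (a.2 j) (idx i j).

Lemma block_size_le j (b : 'I_3 * 'I_Q) : bv j b.1 b.2 -> (2 ^ b.2 <= M)%N.
Proof. by move=> /blkP[_ h1 h2]; have := mM j; lia. Qed.

Lemma wavelet1_frame j x y : (x < m j)%N -> (y < m j)%N ->
  \sum_b \sum_(l < M) wavelet1 j b l x * wavelet1 j b l y = (x == y)%:R.
Proof.
move=> xm ym.
have E (b : 'I_3 * 'I_Q) : \sum_(l < M) wavelet1 j b l x * wavelet1 j b l y =
    (bv j b.1 b.2 && in_block (bs j b.1 b.2) b.2 x)%:R * (x == y)%:R.
  have [v|v] := boolP (bv j b.1 b.2); last first.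
    by rewrite mul0r big1 // => l _; rewrite /wavelet1 (negbTE v) mul0r.
  have [bx|bx] := boolP (in_block (bs j b.1 b.2) b.2 x); last first.
    by rewrite mul0r big1 // => l _; rewrite /wavelet1 (negbTE bx) andbF mul0r.
  have [byy|byy] := boolP (in_block (bs j b.1 b.2) b.2 y); last first.
    rewrite (_ : (x == y) = false) ?mulr0; last first.
      by apply/negbTE; apply: contraNneq byy => <-.
    by rewrite big1 // => l _; rewrite /wavelet1 (negbTE byy) andbF mulr0.
  have /andP[h1 h2] := bx; have /andP[h3 h4] := byy.
  rewrite mul1r -(_ : (x - bs j b.1 b.2 == y - bs j b.1 b.2)%N = (x == y)); last by lia.
  rewrite -(@haar_complete R b.2); [|lia|lia].
  rewrite big_mkord (big_ord_widen _ (fun l => haar R b.2 l (x - bs j b.1 b.2) *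
    haar R b.2 l (y - bs j b.1 b.2)) (block_size_le _ _ v)) [RHS]big_mkcond.
  apply: eq_bigr => l _; rewrite /wavelet1 v bx byy /=.
  by case: ifP; rewrite ?mul0r.
have S1 : (\sum_(b : 'I_3 * 'I_Q) (bv j b.1 b.2 && in_block (bs j b.1 b.2) b.2 x) = 1)%N.
  transitivity (\sum_(c < 3) \sum_(k < (K j).+1) (bv j c k && in_block (bs j c k) k x))%N;
    last exact: blk_cover.
  transitivity (\sum_(c < 3) \sum_(k < Q) (bv j c k && in_block (bs j c k) k x))%N.
    by rewrite [RHS]pair_bigA.
  apply: eq_bigr => c _.
  rewrite (big_ord_widen Q (fun k => nat_of_bool (bv j c k && in_block (bs j c k) k x)) (KQ j)).
  rewrite [RHS]big_mkcond; apply: eq_bigr => k _.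
  by case: ifPn => // kK; case: (boolP (bv j c k)) => //= /blkP[h _ _]; rewrite ltnS h in kK.
under eq_bigr do rewrite E.
by rewrite -mulr_suml -natr_sum S1 mul1r.
Qed.

Lemma wavelet_frame i i' : \sum_a wavelet a i * wavelet a i' = (i == i')%:R.
Proof.
transitivity (\sum_b \sum_l wavelet (b, l) i * wavelet (b, l) i').
  by rewrite pair_bigA; apply: eq_bigr => -[].
transitivity (\prod_j \sum_b \sum_(l < M)
   wavelet1 j b l (idx i j) * wavelet1 j b l (idx i' j)).
  rewrite bigA_distr_bigA; apply: eq_bigr => b _.
  rewrite (bigA_distr_bigA (fun j (l : 'I_M) =>
    wavelet1 j (b j) l (idx i j) * wavelet1 j (b j) l (idx i' j))).
  by apply: eq_bigr => l _; rewrite /wavelet -big_split.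
under eq_bigr do rewrite wavelet1_frame //.
have [->|ii'] := eqVneq i i'; first by rewrite big1 // => j _; rewrite eqxx.
have [j ij] : exists j, idx i j != idx i' j.
  apply: contrapT => h; move/eqP: ii'; apply; apply: idx_inj => j.
  by apply: contrapT => /eqP ij; apply: h; exists j.
by rewrite (bigD1 j) //= (negbTE ij) mul0r.
Qed.

Lemma wavelet_norm_le a : \sum_i wavelet a i ^+ 2 <= 1.
Proof.
have := frame_synthesis_le wavelet wavelet_frame (fun a' => (a' == a)%:R).
rewrite [leRHS](bigD1 a) //= eqxx expr1n [X in _ <= _ + X]big1 ?addr0; last first.
  by move=> a' /negbTE->; rewrite expr0n.
apply: le_trans; rewrite le_eqVlt; apply/orP; left; apply/eqP; apply: eq_bigr => i _.
rewrite (bigD1 a) //= eqxx mul1r big1 ?addr0 // => a' /negbTE->; by rewrite mul0r.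
Qed.

Definition valid_block (b : block) : bool := [forall j, bv j (b j).1 (b j).2].

Lemma wavelet_invalid b l i : ~~ valid_block b -> wavelet (b, l) i = 0.
Proof.
rewrite negb_forall => /existsP[j /negbTE vj].
by rewrite /wavelet (bigD1 j) //= /wavelet1 vj mul0r.
Qed.

Definition block_start (b : block) (j : 'I_d) : nat := bs j (b j).1 (b j).2.
Definition block_end (b : block) (j : 'I_d) : nat := (block_start b j + (2 ^ (b j).2).-1)%N.
Definition block_volume (b : block) : R := \prod_j 2 ^+ (b j).2.
Definition block_increment (f : ('I_d -> R) -> R) (b : block) : R :=
  grid_value m f (block_end b) - grid_value m f (block_start b).

Lemma block_volume_gt0 b : 0 < block_volume b.
Proof. by apply: prodr_gt0 => j _; rewrite exprn_gt0. Qed.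

Definition grid_coef (z : 'I_n -> R) (a : block * wave) : R := \sum_i wavelet a i * z i.

Lemma grid_coef_em (f : ('I_d -> R) -> R) (b : block) (l : wave) :
  grid_coef (fun i => grid_value m f (idx i)) (b, l) =
  \sum_(u : wave) grid_value m f (fun j => u j) * \prod_j wavelet1 j (b j) (l j) (u j).
Proof.
rewrite /grid_coef /wavelet.
rewrite (grid_sum (fun u => (\prod_j wavelet1 j (b j) (l j) (u j)) * grid_value m f u)).
  by apply: eq_bigr => u _; rewrite mulrC.
move=> u um; have [j uj] : exists j, ~~ (u j < m j)%N.
  by apply: contrapT => h; apply: um => j; apply: contrapT => /negP uj; apply: h; exists j.
rewrite (bigD1 j) //= {1}/wavelet1; case: ifPn; rewrite ?mul0r //.
move=> /and3P[/blkP[_ h1 h2] /andP[_ h3] _]; exfalso; move: uj; rewrite -leqNgt => uj; lia.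
Qed.

Lemma wavelet1_tail j (b : 'I_3 * 'I_Q) (l k : nat) : bv j b.1 b.2 -> (k <= 2 ^ b.2)%N ->
  \sum_(k <= x < M - bs j b.1 b.2) wavelet1 j b l (bs j b.1 b.2 + x) =
  if (l < 2 ^ b.2)%N then haar_tail R b.2 l k else 0.
Proof.
move=> v kb; case: ifP => lb; last first.
  by rewrite big1 // => x _; rewrite /wavelet1 lb !andbF.
have [_ h1 h2] := blkP _ _ _ v; have := mM j => mj.
rewrite (@big_cat_nat _ _ _ (2 ^ b.2)) //=; last by lia.
rewrite [X in _ + X]big_nat_cond [X in _ + X]big1 ?addr0; last first.
  move=> x /andP[/andP[bx _] _]; rewrite /wavelet1 /in_block ltn_add2l ltnNge bx.
  by rewrite andbF andbF.
apply: eq_big_nat => x /andP[_ xb].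
by rewrite /wavelet1 v lb /in_block leq_addr ltn_add2l xb /= addKn.
Qed.

(* Summation by parts reduces entirely monotone functions to indicators of
   orthants, and interpolation reduces those to finitely many dyadic nodes, so
   that one Gaussian maximum controls all functions at once. *)
Lemma layer_bound (sigma : R) (b : block) (l : nat) :
  0 < sigma -> valid_block b -> (0 < l)%N ->
  exists G : ('I_n -> R) -> R, [/\ forall z, 0 <= G z,
    gaussian_mean_le sigma G
      (32 * sigma ^+ 2 * (block_volume b * 2^-1 ^+ l * l.+1%:R ^+ d.-1) * (l.+1%:R * d.+1%:R)) &
    forall f z, entirely_monotone f ->
      `|\sum_(w : wave | total_level w == l) grid_coef z (b, w) *
          grid_coef (fun i => grid_value m f (idx i)) (b, w)|
      <= block_increment f b * Num.sqrt (G z)].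
Proof.
move=> s0 /forallP vb l0.
(* For nodes in range, [u y] is the component of total level [l], within the block, of the indicator
   of the orthant at [y]; its squared norm is the variance to be bounded. *)
pose node (y : {ffun 'I_d -> 'I_(2 ^ l).+1}) (w : wave) : R :=
  if total_level w == l then \prod_j haar_node R (b j).2 l (w j) (y j) else 0.
pose u y i := \sum_(w : wave) node y w * wavelet (b, w) i.
set S := block_volume b * 2^-1 ^+ l * l.+1%:R ^+ d.-1.
have S0 : 0 < S.
  by rewrite !mulr_gt0 ?block_volume_gt0 ?exprn_gt0 ?invr_gt0 ?ltr0n.
have uS y : \sum_i u y i ^+ 2 <= S.
  pose c (a : block * wave) : R := (a.1 == b)%:R * node y a.2.
  have -> : \sum_i u y i ^+ 2 = \sum_i (\sum_a c a * wavelet a i) ^+ 2.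
    apply: eq_bigr => i _; congr (_ ^+ 2).
    transitivity (\sum_b' \sum_w c (b', w) * wavelet (b', w) i).
      rewrite (bigD1 b) //= [X in _ + X]big1 ?addr0.
        by apply: eq_bigr => w _; rewrite /c /= eqxx mul1r.
      by move=> b' /negbTE bb; rewrite big1 // => w _; rewrite /c /= bb !mul0r.
    by rewrite pair_bigA; apply: eq_bigr => -[].
  apply: le_trans (frame_synthesis_le wavelet wavelet_frame c) _.
  have -> : \sum_a c a ^+ 2 = \sum_(w : wave | total_level w == l) \prod_j haar_node R (b j).2 l (w j) (y j) ^+ 2.
    transitivity (\sum_b' \sum_w c (b', w) ^+ 2).
      by rewrite pair_bigA; apply: eq_bigr => -[].
    rewrite (bigD1 b) //= [X in _ + X]big1 ?addr0.
      rewrite [RHS]big_mkcond; apply: eq_bigr => w _; rewrite /c /= eqxx mul1r /node.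
      by case: ifP; rewrite ?expr0n // prodrXl.
    by move=> b' /negbTE bb; rewrite big1 // => w _; rewrite /c /= bb mul0r expr0n.
  rewrite /S /block_volume.
  apply: (total_level_sum_le l (fun j x => haar_node R (b j).2 l x (y j) ^+ 2)).
  - by move=> j x; rewrite sqr_ge0.
  - by move=> j; rewrite exprn_ge0.
  - by rewrite invr_ge0.
  - by move=> j lv hlv; apply: haar_node_sq.
have l1 : 1 <= l.+1%:R * d.+1%:R :> R by rewrite -natrM ler1n muln_gt0.
(* There are (2^l + 1)^d <= exp ((l + 1) d) nodes; [d.+1] in place of [d] absorbs the subtracted
   1. *)
have cardI : #|{ffun 'I_d -> 'I_(2 ^ l).+1}|%:R <= expR (l.+1%:R * d.+1%:R - 1) :> R.
  rewrite card_ffun !card_ord.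
  apply: (@le_trans _ _ (expR (l.+1%:R * d%:R))); last first.
    by rewrite ler_expR -(natr1 d) -natr1; have := ler0n R l; lra.
  rewrite -[l.+1%:R * _]mulr1 -natrM expRM_natl.
  apply: (@le_trans _ _ (2 ^+ (l.+1 * d))).
    rewrite -natrX ler_nat expnM; apply: leq_exp_base; rewrite expnS.
    by have := expn_gt0 2 l; lia.
  by apply: lerXn2r; rewrite ?nnegrE ?expR_ge0 //; have := expR_ge1Dx (1 : R); lra.
have [G [G0 GE GU]] := gaussian_max_le sigma _ u S _ s0 S0 uS l1 cardI.
exists G; split=> // f z fEM.
under eq_bigr do rewrite grid_coef_em.
rewrite big_mkcond /=.
pose g (w : wave) : R := if total_level w == l then grid_coef z (b, w) else 0.
rewrite (eq_bigr (fun w : wave => g w * \sum_(u : wave) grid_value m f (fun j => u j) *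
   \prod_j wavelet1 j (b j) (w j) (u j))); last first.
  by move=> w _; rewrite /g; case: ifP; rewrite ?mul0r.
have tE (w : wave) j k : (k <= 2 ^ (b j).2)%N ->
    \sum_(k <= x < M - block_start b j) wavelet1 j (b j) (w j) (block_start b j + x) =
    if (w j < 2 ^ (b j).2)%N then haar_tail R (b j).2 (w j) k else 0.
  by move=> kb; apply: wavelet1_tail.
apply: (em_pairing_le f fEM m m0 M (block_start b) (fun j => 2 ^ (b j).2)%N _ _ _ _ g
   (fun w j x => wavelet1 j (b j) (w j) x)).
- by move=> j; rewrite expn_gt0.
- by move=> j; have [_ _] := blkP _ _ _ (vb j); rewrite /block_start; have := expn_gt0 2 (b j).2; lia.
- exact: mM.
- by move=> w j x xb; rewrite /wavelet1 /in_block (negbTE xb) andbF.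
(* A positive total level means a positive level in some coordinate, where the wavelet has mean
   zero. *)
- rewrite big1 // => w _; rewrite /g; case: ifP; last by rewrite mul0r.
  move=> /eqP wl; have [j wj] : exists j : 'I_d, (0 < w j)%N.
    apply: contrapT => h; move: l0; rewrite -wl lt0n => /eqP; apply.
    rewrite /total_level big1 // => j _; case: (posnP (w j)) => [->//|wj].
    by exfalso; apply: h; exists j.
  rewrite (bigD1 j) //= tE //; case: ifP; last by rewrite mul0r mulr0.
  by move=> wb; rewrite haar_tail0 ?mul0r ?mulr0 // wj wb.
(* Coordinatewise interpolation writes the orthant at [k] as a convex combination, with product
   weights, of orthants at nodes, so the bound at the nodes carries over. *)
- move=> k kb.
  have /choice[a Ha] : forall j, exists a : 'I_(2 ^ l).+1 -> R, [/\ forall y, 0 <= a y,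
      \sum_y a y = 1 & forall x, (x < 2 ^ (b j).2)%N -> (haar_level x <= l)%N ->
      haar_tail R (b j).2 x (k j) = \sum_y a y * haar_node R (b j).2 l x y].
    by move=> j; apply: haar_node_interp; apply: ltnW.
  rewrite (eq_bigr (fun w : wave => grid_coef z (b, w) *
      \sum_(y : {ffun 'I_d -> 'I_(2 ^ l).+1}) (\prod_j a j (y j)) * node y w)); last first.
    move=> w _; rewrite /g /node; case: ifP => [/eqP wl|_]; last first.
      by rewrite mul0r big1 ?mulr0 // => y _; rewrite mulr0.
    congr (_ * _); under [RHS]eq_bigr do rewrite -big_split /=.
    rewrite -(bigA_distr_bigA (fun j (y : 'I_(2 ^ l).+1) => a j y * haar_node R (b j).2 l (w j) y)).
    apply: eq_bigr => j _; rewrite tE; last exact: ltnW.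
    have [_ _ aE] := Ha j.
    case: ifP => wb.
      by apply: aE => //; rewrite -wl /total_level (bigD1 j) //= leq_addr.
    by rewrite big1 // => y _; rewrite /haar_node wb mulr0.
  have -> : \sum_(w : wave) grid_coef z (b, w) *
      (\sum_(y : {ffun 'I_d -> 'I_(2 ^ l).+1}) (\prod_j a j (y j)) * node y w) =
      \sum_(y : {ffun 'I_d -> 'I_(2 ^ l).+1}) (\prod_j a j (y j)) * (\sum_i u y i * z i).
    under eq_bigr do rewrite mulr_sumr.
    rewrite exchange_big /=; apply: eq_bigr => y _.
    under eq_bigr do rewrite mulrCA.
    rewrite -mulr_sumr; congr (_ * _); rewrite /grid_coef.
    under eq_bigr do rewrite mulr_suml.
    rewrite exchange_big /=; apply: eq_bigr => i _; rewrite /u mulr_suml.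
    by apply: eq_bigr => w _; rewrite mulrC mulrA.
  apply: le_trans (ler_norm_sum _ _ _) _.
  have A0 (y : {ffun 'I_d -> 'I_(2 ^ l).+1}) : 0 <= \prod_j a j (y j).
    by apply: prodr_ge0 => j _; have [] := Ha j.
  apply: (@le_trans _ _ (\sum_(y : {ffun 'I_d -> 'I_(2 ^ l).+1}) (\prod_j a j (y j)) * Num.sqrt (G z))).
    apply: ler_sum => y _; rewrite normrM (ger0_norm (A0 y)) ler_wpM2l //.
    by rewrite -sqrtr_sqr ler_wsqrtr.
  rewrite -mulr_suml -(bigA_distr_bigA (fun j (y : 'I_(2 ^ l).+1) => a j y)).
  by rewrite big1 ?mul1r // => j _; have [] := Ha j.
Qed.

(** Each wavelet has norm at most 1, and the hyperbolic cross has at most 2 * 2^L (L + 1)^(d-1)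
    elements. *)
Lemma low_level_bound (sigma : R) (b : block) (L : nat) : 0 < sigma ->
  gaussian_mean_le sigma (fun z => \sum_(w : wave | (total_level w <= L)%N) grid_coef z (b, w) ^+ 2)
    (64 * sigma ^+ 2 * (2 ^+ L * L.+1%:R ^+ d.-1)).
Proof.
move=> s0.
have E (w : wave) : (total_level w <= L)%N ->
    gaussian_mean_le sigma (fun z => grid_coef z (b, w) ^+ 2) (32 * sigma ^+ 2 * 1).
  by move=> _; apply: gaussian_square_le => //; apply: wavelet_norm_le.
apply: gaussian_mean_le_trans (gaussian_mean_sum _ _ _ _ _ _ E) => //.
suff H : \sum_(w : wave | (total_level w <= L)%N) 1 <= 2 * (2 ^+ L * L.+1%:R ^+ d.-1) :> R.
  have c0 : 0 <= 32 * sigma ^+ 2 by rewrite mulr_ge0 ?sqr_ge0.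
  by have := ler_wpM2l c0 H; rewrite mulr_sumr; lra.
pose p (w : wave) : 'I_L.+1 := inord (total_level w).
rewrite (partition_big p xpredT) //=.
apply: (@le_trans _ _ (\sum_(l < L.+1) 2 ^+ l * L.+1%:R ^+ d.-1)).
  apply: ler_sum => l _.
  have h (j : 'I_d) lv : (lv <= l)%N -> \sum_(x < M | haar_level x == lv) 1 <= 1 * 2 ^+ lv :> R.
    by move=> _; rewrite mul1r; apply: card_level_le.
  have H := @total_level_sum_le R d M l (fun _ _ => 1) (fun=> 1) 2 (fun _ _ => ler01)
    (fun _ => ler01) (ler0n _ 2) h.
  rewrite [X in _ <= X * _ * _]big1 // mul1r in H.
  apply: le_trans (le_trans H _); last first.
    by rewrite ler_wpM2l ?exprn_ge0 // lerXn2r ?nnegrE ?ler0n // ler_nat ltn_ord.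
  under [leRHS]eq_bigr do rewrite big1 //.
  rewrite big_mkcond [leRHS]big_mkcond /=; apply: ler_sum => w _.
  case: ifP; last by case: ifP.
  move=> /andP[wL /eqP e]; rewrite (_ : total_level w == l) //.
  by rewrite -e /p inordK // ltnS.
rewrite -mulr_suml mulrA ler_wpM2r ?exprn_ge0 ?ler0n //.
have -> : 2 * 2 ^+ L = 2 ^+ L.+1 :> R by rewrite exprS.
elim: L.+1 => [|k IH]; first by rewrite big_ord0 ler01.
by rewrite big_ord_recr /= exprS; lra.
Qed.

Section Pair.
Variables (f g : ('I_d -> R) -> R).
Hypotheses (fEM : entirely_monotone f) (gEM : entirely_monotone g).
Local Notation x_ := (fun i => grid_value m f (idx i) - grid_value m g (idx i)).
Local Notation dist := (Num.sqrt (\sum_i x_ i ^+ 2)).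
Local Notation gap := (g (fun=> 1) - g (fun=> 0)).

(** The squared distance is at least t^2 times the number of grid points of the box, which is the
    volume of the block. *)
Lemma box_gap_le (b : block) (lo : 'I_d -> nat) (t : R) :
  (forall j, lo j + 2 ^ (b j).2 <= m j)%N ->
  (forall i, (forall j, in_block (lo j) (b j).2 (idx i j)) -> t <= `|x_ i|) ->
  t <= dist / Num.sqrt (block_volume b).
Proof.
move=> lom ht; have bv0 := block_volume_gt0 b.
have [t0|t0] := leP t 0; first by apply: le_trans t0 _; rewrite divr_ge0 ?sqrtr_ge0.
rewrite ler_pdivlMr ?sqrtr_gt0 //.
have -> : t = Num.sqrt (t ^+ 2) by rewrite sqrtr_sqr gtr0_norm.
rewrite -sqrtrM ?sqr_ge0 // ler_wsqrtr //.
have -> : block_volume b = \sum_i \prod_j (in_block (lo j) (b j).2 (idx i j))%:R.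
  rewrite (grid_sum (fun u => \prod_j (in_block (lo j) (b j).2 (u j))%:R)).
    rewrite -(bigA_distr_bigA (fun j (x : 'I_M) => (in_block (lo j) (b j).2 x)%:R)).
    apply: eq_bigr => j _.
    have hj := lom j; have mj := mM j.
    rewrite -(big_mkord xpredT (fun x => (in_block (lo j) (b j).2 x)%:R)).
    rewrite (@big_cat_nat _ _ _ (lo j)) //=; last by lia.
    rewrite big_nat_cond big1 ?add0r; last first.
      by move=> x /andP[/andP[_ xl] _]; rewrite /in_block leqNgt xl.
    rewrite (@big_cat_nat _ _ _ (lo j + 2 ^ (b j).2)) //=; [|lia|lia].
    rewrite [X in _ + X]big_nat_cond [X in _ + X]big1 ?addr0; last first.
      by move=> x /andP[/andP[xl _] _]; rewrite /in_block ltnNge xl andbF.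
    rewrite (eq_big_nat _ _ (F2 := fun=> 1)); last first.
      by move=> x h; rewrite /in_block h.
    by rewrite sumr_const_nat addKn natrX.
  move=> u um; have [j uj] : exists j, ~~ (u j < m j)%N.
    by apply: contrapT => h; apply: um => j; apply: contrapT => /negP uj; apply: h; exists j.
  rewrite (bigD1 j) //= (_ : in_block _ _ _ = false) ?mul0r //.
  by apply/negbTE/negP => /andP[_ h]; have := lom j; move: uj; rewrite -leqNgt; lia.
rewrite mulr_sumr; apply: ler_sum => i _.
have [/forallP h|] := boolP [forall j, in_block (lo j) (b j).2 (idx i j)].
  rewrite big1 ?mulr1 => [|j _]; last by rewrite h.
  rewrite -[leRHS]real_normK ?num_real //.
  by rewrite ler_pXn2r ?nnegrE ?normr_ge0 ?(ltW t0) ?ht.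
rewrite negb_forall => /existsP[j /negbTE h].
by rewrite (bigD1 j) //= h mul0r mulr0 sqr_ge0.
Qed.

Lemma grid_value_le1 (h : ('I_d -> R) -> R) (u : 'I_d -> nat) : entirely_monotone h ->
  (forall j, u j <= m j)%N -> h (fun=> 0) <= grid_value m h u <= h (fun=> 1).
Proof.
move=> hEM um; have uc := @grid_in_cube R _ m u m0 um.
by apply/andP; split; apply: em_le => //;
  try (by move=> j; rewrite ?ler01 ?lexx); move=> j; have /andP[] := uc j.
Qed.

Lemma block_increment_gap_le (b : block) : valid_block b -> block_increment g b <= gap.
Proof.
move=> /forallP vb; have um j : (block_start b j <= m j)%N /\ (block_end b j <= m j)%N.
  have [_ h1 h2] := blkP _ _ _ (vb j); rewrite /block_end /block_start.
  by have := expn_gt0 2 (b j).2; lia.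
have /andP[_ h1] := @grid_value_le1 g (block_end b) gEM (fun j => (um j).2).
have /andP[h2 _] := @grid_value_le1 g (block_start b) gEM (fun j => (um j).1).
by rewrite /block_increment; lra.
Qed.

(** If [f] exceeds g(1) by t at the upper corner, monotonicity gives f - g >= t on the whole box
    above that corner; similarly below the lower corner. The boxes contain the corner itself, so a
    distance to the ends one less than the block length is enough. *)
Lemma block_increment_le (b : block) : valid_block b ->
  block_increment f b <= gap + 2 * (dist / Num.sqrt (block_volume b)).
Proof.
move=> /forallP vb.
have E j : (0 < 2 ^ (b j).2)%N /\ (2 ^ (b j).2 <= block_start b j + 1)%N /\
    (block_start b j + 2 * 2 ^ (b j).2 <= m j + 1)%N.
  by have [_ h1 h2] := blkP _ _ _ (vb j); rewrite expn_gt0.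
have le_grid (u u' : 'I_d -> nat) : (forall j, u j <= u' j)%N -> (forall j, u' j <= m j)%N ->
    grid_value m f u <= grid_value m f u'.
  move=> uu' um; apply: em_le => //.
  - by apply: grid_in_cube => // j; apply: leq_trans (uu' j) (um j).
  - exact: grid_in_cube.
  - by move=> j; rewrite ler_wpM2r ?invr_ge0 ?ler0n // ler_nat.
have up : grid_value m f (block_end b) - g (fun=> 1) <= dist / Num.sqrt (block_volume b).
  apply: (box_gap_le b (block_end b)) => [j|i hi].
    by have := E j; rewrite /block_end; lia.
  apply: le_trans (ler_norm _).
  have h1 : grid_value m f (block_end b) <= grid_value m f (idx i).
    by apply: le_grid => j; [have /andP[] := hi j | apply: ltnW].
  have /andP[_ h2] := @grid_value_le1 g (idx i) gEM (fun j => ltnW (idx_lt i j)).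
  lra.
have down : g (fun=> 0) - grid_value m f (block_start b) <= dist / Num.sqrt (block_volume b).
  apply: (box_gap_le b (fun j => block_start b j - (2 ^ (b j).2).-1)%N) => [j|i hi].
    by have := E j; lia.
  rewrite -normrN; apply: le_trans (ler_norm _).
  have h1 : grid_value m f (idx i) <= grid_value m f (block_start b).
    apply: le_grid => j; last by have := E j; lia.
    by have := hi j; have := E j; rewrite /in_block; lia.
  have /andP[h2 _] := @grid_value_le1 g (idx i) gEM (fun j => ltnW (idx_lt i j)).
  lra.
by rewrite /block_increment; lra.
Qed.

End Pair.

(** * Splitting at the cutoff, and the quadratic inequality for the distance *)

Local Notation Lmax := (d * M).+1.

Lemma total_level_lt (w : wave) : (total_level w < Lmax)%N.
Proof.
rewrite ltnS -[X in (_ <= X * _)%N](card_ord d) -sum_nat_const; apply: leq_sum => j _.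
by rewrite haar_level_le; apply: ltn_trans (ltn_ord (w j)) (ltn_expl _ _).
Qed.

Hypothesis d0 : (0 < d)%N.
Variables (c sigma : R).
Hypotheses (c_sum : forall N, \sum_(z < N) (2 / 3 : R) ^+ z * z.+1%:R ^+ d <= c) (sigma0 : 0 < sigma).

Let layer_spec (b : block) (l : nat) (G : ('I_n -> R) -> R) : Prop :=
  [/\ forall z, 0 <= G z,
    gaussian_mean_le sigma G
      (32 * sigma ^+ 2 * (block_volume b * 2^-1 ^+ l * l.+1%:R ^+ d.-1) * (l.+1%:R * d.+1%:R)) &
    forall f z, entirely_monotone f ->
      `|\sum_(w : wave | total_level w == l) grid_coef z (b, w) *
          grid_coef (fun i => grid_value m f (idx i)) (b, w)|
      <= block_increment f b * Num.sqrt (G z)].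

Variables (G : block -> nat -> ('I_n -> R) -> R) (L : block -> nat).
Hypothesis GP : forall b l, valid_block b -> (0 < l)%N -> layer_spec b l (G b l).

Let high (p : block * 'I_Lmax) : bool := valid_block p.1 && (L p.1 < p.2)%N.

(** Cauchy-Schwarz with weights [om b] times (3/4)^(l - L b). They are summable in l, and dividing
    the variance decay 2^-l by them leaves (2/3)^(l - L b), still summable against the polynomial
    factor. The distribution [om] over the blocks stays free. *)
Lemma high_level_bound (rho om : block -> R) :
  (forall b, 0 < om b) -> (forall b, 0 <= rho b) ->
  gaussian_mean_le sigma (fun z => (\sum_(p | high p) rho p.1 * Num.sqrt (G p.1 p.2 z)) ^+ 2)
    (128 * d.+1%:R * c * sigma ^+ 2 * (\sum_(b | valid_block b) om b) *
     (\sum_(b | valid_block b)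
        rho b ^+ 2 * block_volume b * (2^-1 ^+ L b * (L b).+1%:R ^+ d) / om b)).
Proof.
move=> om0 rho0; pose wt (p : block * 'I_Lmax) : R := om p.1 * (3 / 4) ^+ (p.2 - L p.1).
have q0 k : 0 < (3 / 4 : R) ^+ k by rewrite exprn_gt0 // divr_gt0.
have wt0 p : 0 < wt p by rewrite mulr_gt0.
have highsum (phi : block -> nat -> R) :
    \sum_(p | high p) phi p.1 p.2 = \sum_(b | valid_block b) \sum_(l < Lmax | (L b < l)%N) phi b l.
  by rewrite (pair_big_dep valid_block (fun b (l : 'I_Lmax) => (L b < l)%N) (fun b l => phi b l)).
have W4 : \sum_(p | high p) wt p <= 4 * \sum_(b | valid_block b) om b.
  rewrite (highsum (fun b l => om b * (3 / 4) ^+ (l - L b))) mulr_sumr.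
  apply: ler_sum => b _; rewrite -mulr_sumr mulrC ler_wpM2r ?(ltW (om0 b)) //.
  apply: le_trans (sum_shift_le _ _ (fun z => (3 / 4 : R) ^+ z) (fun z => ltW (q0 z))) _.
  exact: sum_geometric_le.
have W0 : 0 <= \sum_(p | high p) wt p by apply: sumr_ge0 => p _; rewrite ltW.
pose bd b l : R := 32 * sigma ^+ 2 * (block_volume b * 2^-1 ^+ l * l.+1%:R ^+ d.-1) * (l.+1%:R * d.+1%:R).
pose F (p : block * 'I_Lmax) z := (rho p.1 ^+ 2 / wt p) * G p.1 p.2 z.
have EF p : high p -> gaussian_mean_le sigma (F p) (rho p.1 ^+ 2 / wt p * bd p.1 p.2).
  move=> /andP[vp lp]; have [_ GE _] := GP _ _ vp (leq_ltn_trans (leq0n _) lp).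
  by apply: gaussian_mean_scale => //; rewrite divr_ge0 ?sqr_ge0 ?ltW.
apply: gaussian_mean_le_trans (gaussian_mean_scale _ _ _ _ W0
  (gaussian_mean_sum _ _ (index_enum _) high _ _ EF)).
  move=> z; apply: le_trans (weighted_cauchy_schwarz _ _ _ _ (fun p _ => wt0 p)) _.
  rewrite ler_wpM2l //; apply: ler_sum => p /andP[vp lp].
  have [G0 _ _] := GP _ _ vp (leq_ltn_trans (leq0n _) lp).
  by rewrite /F exprMn sqr_sqrtr // mulrAC.
apply: (@le_trans _ _ (4 * (\sum_(b | valid_block b) om b) *
   (32 * sigma ^+ 2 * d.+1%:R * c * \sum_(b | valid_block b)
        rho b ^+ 2 * block_volume b * (2^-1 ^+ L b * (L b).+1%:R ^+ d) / om b))); last first.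
  by rewrite le_eqVlt; apply/orP; left; apply/eqP; ring.
apply: ler_pM => //.
  apply: sumr_ge0 => p _; rewrite mulr_ge0 ?divr_ge0 ?sqr_ge0 ?(ltW (wt0 _)) //.
  by rewrite /bd !mulr_ge0 ?exprn_ge0 ?ler0n ?invr_ge0 ?(ltW (block_volume_gt0 _)) ?(ltW sigma0).
rewrite (highsum (fun b l => rho b ^+ 2 / (om b * (3 / 4) ^+ (l - L b)) * bd b l)) mulr_sumr.
apply: ler_sum => b _.
set A := 32 * sigma ^+ 2 * d.+1%:R * (rho b ^+ 2 * block_volume b * (2^-1 ^+ L b * (L b).+1%:R ^+ d) / om b).
have A0 : 0 <= A.
  by rewrite /A !mulr_ge0 ?exprn_ge0 ?ler0n ?invr_ge0 ?(ltW (block_volume_gt0 _))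
    ?(ltW sigma0) ?rho0 ?(ltW (om0 _)).
apply: (@le_trans _ _ (\sum_(l < Lmax | (L b < l)%N) A * ((2 / 3) ^+ (l - L b) * (l - L b).+1%:R ^+ d))).
  apply: ler_sum => l lb; rewrite /bd /A.
  set z := (l - L b)%N; have -> : (l : nat) = (L b + z)%N by rewrite /z subnKC // ltnW.
  have q1 : (2 / 3 : R) ^+ z = 2^-1 ^+ z / (3 / 4) ^+ z.
    by rewrite -exprVn -exprMn; congr (_ ^+ z); field.
  rewrite q1 exprD.
  have -> : 32 * sigma ^+ 2 * (block_volume b * (2^-1 ^+ L b * 2^-1 ^+ z) * (L b + z).+1%:R ^+ d.-1) *
     ((L b + z).+1%:R * d.+1%:R) = 32 * sigma ^+ 2 * d.+1%:R * block_volume b * 2^-1 ^+ L b * 2^-1 ^+ z *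
      (L b + z).+1%:R ^+ d :> R.
    have -> : (L b + z).+1%:R ^+ d = (L b + z).+1%:R ^+ d.-1 * (L b + z).+1%:R :> R.
      by rewrite -exprSr prednK.
    move: ((L b + z).+1%:R : R) ((L b + z).+1%:R ^+ d.-1 : R) (2^-1 ^+ L b : R) (2^-1 ^+ z : R).
    by move=> e1 e2 e3 e4; ring.
  have le1 : (L b + z).+1%:R ^+ d <= (L b).+1%:R ^+ d * z.+1%:R ^+ d :> R.
    rewrite -exprMn -natrM lerXn2r ?nnegrE ?ler0n // ler_nat; lia.
  set B := rho b ^+ 2 / (om b * (3 / 4) ^+ z) * (32 * sigma ^+ 2 * d.+1%:R * block_volume b * 2^-1 ^+ L b * 2^-1 ^+ z).
  have B0 : 0 <= B.
    by rewrite /B !mulr_ge0 ?invr_ge0 ?mulr_ge0 ?(ltW (q0 _)) ?exprn_ge0 ?ler0n ?invr_ge0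
      ?(ltW (block_volume_gt0 _)) ?(ltW sigma0) ?rho0 ?(ltW (om0 _)).
  rewrite mulrA -/B; apply: le_trans (ler_wpM2l B0 le1) _.
  rewrite le_eqVlt; apply/orP; left; apply/eqP; rewrite /B; field.
  by rewrite !gt_eqF.
rewrite -mulr_sumr.
have phi0 z : 0 <= (2 / 3 : R) ^+ z * z.+1%:R ^+ d by rewrite mulr_ge0 ?exprn_ge0 ?ler0n ?divr_ge0.
apply: le_trans (ler_wpM2l A0 (le_trans (sum_shift_le _ _ _ phi0) (c_sum _))) _.
by rewrite le_eqVlt; apply/orP; left; apply/eqP; rewrite /A; ring.
Qed.

(** Below the cutoff 2 y1 y2 <= 4 y1^2 + y2^2 / 4, which leaves a quarter of the squared distance to
    absorb. Above it the two functions are bounded separately, because their difference is not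
    entirely monotone in general. *)
Lemma process_le (f g : ('I_d -> R) -> R) (z : 'I_n -> R) :
  entirely_monotone f -> entirely_monotone g ->
  2 * \sum_i z i * (grid_value m f (idx i) - grid_value m g (idx i)) <=
  4 * (\sum_(b | valid_block b) \sum_(w : wave | (total_level w <= L b)%N) grid_coef z (b, w) ^+ 2) +
  (\sum_i (grid_value m f (idx i) - grid_value m g (idx i)) ^+ 2) / 4 +
  2 * \sum_(p | high p) (block_increment f p.1 + block_increment g p.1) * Num.sqrt (G p.1 p.2 z).
Proof.
move=> fEM gEM; pose x i := grid_value m f (idx i) - grid_value m g (idx i).
have split_levels (F : block * wave -> R) : (forall b w, ~~ valid_block b -> F (b, w) = 0) ->
    \sum_a F a = \sum_(b | valid_block b) \sum_(w : wave | (total_level w <= L b)%N) F (b, w) +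
      \sum_(p | high p) \sum_(w : wave | total_level w == p.2) F (p.1, w).
  move=> F0; transitivity (\sum_b \sum_w F (b, w)).
    by rewrite pair_bigA; apply: eq_bigr => -[].
  rewrite (bigID valid_block) /= [X in _ + X]big1 ?addr0; last first.
    by move=> b vb; rewrite big1 // => w _; rewrite F0.
  rewrite -(pair_big_dep valid_block (fun b (l : 'I_Lmax) => (L b < l)%N)
    (fun b l => \sum_(w : wave | total_level w == l) F (b, w))) -big_split /=.
  apply: eq_bigr => b _; rewrite (bigID (fun w => total_level w <= L b)%N) /=; congr (_ + _).
  pose p (w : wave) : 'I_Lmax := Ordinal (total_level_lt w).
  rewrite (partition_big p (fun l : 'I_Lmax => (L b < l)%N)) /=; last by move=> w; rewrite -ltnNge.
  apply: eq_bigr => l lb; apply: eq_bigl => w; rewrite -ltnNge -val_eqE /=.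
  by case: eqP => [->|]; rewrite ?lb ?andbF.
have coef0 y b w : ~~ valid_block b -> grid_coef y (b, w) = 0.
  by move=> vb; rewrite /grid_coef big1 // => i _; rewrite wavelet_invalid ?mul0r.
have xnorm : \sum_i x i ^+ 2 = \sum_a grid_coef x a ^+ 2.
  by rewrite /grid_coef; under eq_bigr do rewrite expr2; rewrite (frame_parseval _ wavelet_frame).
rewrite -/x (frame_parseval _ wavelet_frame z x).
rewrite (split_levels (fun a => grid_coef z a * grid_coef x a)) => [|b w vb]; last first.
  by rewrite (coef0 z) // mul0r.
rewrite mulrDr lerD //.
  rewrite xnorm (split_levels (fun a => grid_coef x a ^+ 2)) => [|b w vb]; last first.
    by rewrite (coef0 x) // expr0n.
  have h0 : 0 <= \sum_(p | high p) \sum_(w : wave | total_level w == p.2) grid_coef x (p.1, w) ^+ 2.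
    by apply: sumr_ge0 => p _; apply: sumr_ge0 => w _; rewrite sqr_ge0.
  suff : 2 * (\sum_(b | valid_block b) \sum_(w : wave | (total_level w <= L b)%N)
      grid_coef z (b, w) * grid_coef x (b, w)) <=
    4 * (\sum_(b | valid_block b) \sum_(w : wave | (total_level w <= L b)%N) grid_coef z (b, w) ^+ 2) +
    4^-1 * (\sum_(b | valid_block b) \sum_(w : wave | (total_level w <= L b)%N) grid_coef x (b, w) ^+ 2).
    by lra.
  rewrite !mulr_sumr -big_split /=; apply: ler_sum => b _.
  rewrite !mulr_sumr -big_split /=; apply: ler_sum => w _.
  have : 0 <= (2 * grid_coef z (b, w) - 2^-1 * grid_coef x (b, w)) ^+ 2 by rewrite sqr_ge0.
  by move: (grid_coef z _) (grid_coef x _) => y1 y2; lra.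
rewrite ler_pM2l ?ltr0n //; apply: ler_sum => p /andP[vp lp].
have [G0 _ GU] := GP _ _ vp (leq_ltn_trans (leq0n _) lp).
have hf := GU f z fEM; have hg := GU g z gEM.
have -> : \sum_(w : wave | total_level w == p.2) grid_coef z (p.1, w) * grid_coef x (p.1, w) =
  \sum_(w : wave | total_level w == p.2) grid_coef z (p.1, w) * grid_coef (fun i => grid_value m f (idx i)) (p.1, w)
  - \sum_(w : wave | total_level w == p.2) grid_coef z (p.1, w) * grid_coef (fun i => grid_value m g (idx i)) (p.1, w).
  rewrite -sumrB; apply: eq_bigr => w _; rewrite -mulrBr; congr (_ * _).
  by rewrite /grid_coef -sumrB; apply: eq_bigr => i _; rewrite -mulrBr.
move: hf hg; rewrite !ler_norml => /andP[_ hf] /andP[hg _]; lra.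
Qed.

Lemma grid_risk (V P : R) (om : block -> R) :
  0 <= V -> 0 < P -> (forall b, 0 < om b) ->
  exists F, gaussian_mean_le sigma F
   (512 * sigma ^+ 2 * (\sum_(b | valid_block b) 2 ^+ L b * (L b).+1%:R ^+ d.-1) +
    4 * sigma ^+ 2 * P +
    512 * d.+1%:R * c * (V ^+ 2 / P) * (\sum_(b | valid_block b) om b) *
     (\sum_(b | valid_block b) block_volume b * (2^-1 ^+ L b * (L b).+1%:R ^+ d) / om b) +
    4096 * d.+1%:R * c * sigma ^+ 2 * (\sum_(b | valid_block b) 1) *
     (\sum_(b | valid_block b) 2^-1 ^+ L b * (L b).+1%:R ^+ d)) /\
  forall f g z, entirely_monotone f -> entirely_monotone g -> g (fun=> 1) - g (fun=> 0) <= V ->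
   let x i := grid_value m f (idx i) - grid_value m g (idx i) in
   \sum_i x i ^+ 2 <= 2 * \sum_i z i * x i -> \sum_i x i ^+ 2 <= F z.
Proof.
move=> V0 P0 om0.
pose X1 z := \sum_(b | valid_block b) \sum_(w : wave | (total_level w <= L b)%N) grid_coef z (b, w) ^+ 2.
pose r b : R := (Num.sqrt (block_volume b))^-1.
have r0 b : 0 <= r b by rewrite invr_ge0 sqrtr_ge0.
pose X2 z := \sum_(p | high p) 1 * Num.sqrt (G p.1 p.2 z).
pose X3 z := \sum_(p | high p) r p.1 * Num.sqrt (G p.1 p.2 z).
have E1 := gaussian_mean_sum _ _ (index_enum _) valid_block _ _
  (fun b _ => low_level_bound sigma b (L b) sigma0).
have E2 := high_level_bound (fun=> 1) om om0 (fun=> ler01).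
have E3 := high_level_bound r (fun=> 1) (fun=> ltr01) r0.
have sg0 : 0 < sigma ^+ 2 by rewrite exprn_gt0.
have c1 : 0 <= 4 * (V ^+ 2 / (P * sigma ^+ 2)).
  by rewrite mulr_ge0 ?divr_ge0 ?sqr_ge0 // mulr_ge0 ?ltW.
have c2 : 0 <= 4 * sigma ^+ 2 * P by rewrite mulr_ge0 ?(ltW P0) // mulr_ge0 // ltW.
(* With a the distance, a^2 <= 4 X1 + a^2/4 + 4 V X2 + 4 a X3. The last term is at most a^2/4 + 16
   X3^2, and doubling what remains gives 8 X1 + 8 V X2 + 32 X3^2. Only the mean of X2^2 is
   controlled, so 8 V X2 is split by the arithmetic-geometric mean inequality with the free
   parameter [P]. *)
exists (fun z => 8 * X1 z + 4 * sigma ^+ 2 * P + 4 * (V ^+ 2 / (P * sigma ^+ 2)) * X2 z ^+ 2 +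
  32 * X3 z ^+ 2); split.
  have H := gaussian_mean_add _ _ _ _ _ (gaussian_mean_add _ _ _ _ _ (gaussian_mean_add _ _ _ _ _
    (gaussian_mean_scale _ _ _ _ (ler0n R 8) E1) (gaussian_mean_cst sigma _ c2))
    (gaussian_mean_scale _ _ _ _ c1 E2)) (gaussian_mean_scale _ _ _ _ (ler0n R 32) E3).
  apply: (gaussian_mean_le_trans _ _ _ _ _ (fun z => lexx _) _ H).
  rewrite le_eqVlt; apply/orP; left; apply/eqP.
  rewrite -mulr_sumr.
  have -> : \sum_(b | valid_block b) 1 ^+ 2 * block_volume b * (2^-1 ^+ L b * (L b).+1%:R ^+ d) / om b =
     \sum_(b | valid_block b) block_volume b * (2^-1 ^+ L b * (L b).+1%:R ^+ d) / om b.
    by apply: eq_bigr => b _; rewrite expr1n mul1r.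
  (* The 1 / n_b from the increment cancels the n_b of the variance: here all blocks count
     equally. *)
  have -> : \sum_(b | valid_block b) r b ^+ 2 * block_volume b * (2^-1 ^+ L b * (L b).+1%:R ^+ d) / 1 =
     \sum_(b | valid_block b) 2^-1 ^+ L b * (L b).+1%:R ^+ d.
    apply: eq_bigr => b _; have -> : r b ^+ 2 = (block_volume b)^-1.
      by rewrite /r exprVn sqr_sqrtr // ltW // block_volume_gt0.
    by rewrite mulVf ?gt_eqF ?block_volume_gt0 // mul1r divr1.
  move: (\sum_(b | _) _) (\sum_(b | _) _) (\sum_(b | _) _) (\sum_(b | _) _) (\sum_(b | _) _) => t1 t2 t3 t4 t5.
  by field; rewrite !gt_eqF.
move=> f g z fEM gEM gapV x hx.
have X20 : 0 <= X2 z by apply: sumr_ge0 => p _; rewrite mulr_ge0 ?sqrtr_ge0.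
have X30 : 0 <= X3 z by apply: sumr_ge0 => p _; rewrite mulr_ge0 ?sqrtr_ge0.
have := process_le f g z fEM gEM; rewrite -/x -/(X1 z) => Hp.
set a2 := \sum_i x i ^+ 2 in hx Hp *.
have a20 : 0 <= a2 by apply: sumr_ge0 => i _; rewrite sqr_ge0.
pose a := Num.sqrt a2; have aE : a ^+ 2 = a2 by rewrite sqr_sqrtr.
have Hh : \sum_(p | high p) (block_increment f p.1 + block_increment g p.1) * Num.sqrt (G p.1 p.2 z) <=
    2 * V * X2 z + 2 * a * X3 z.
  rewrite /X2 /X3 !mulr_sumr -big_split /=; apply: ler_sum => p /andP[vp _].
  have h1 := block_increment_le f g fEM gEM p.1 vp.
  have h2 := block_increment_gap_le g gEM p.1 vp.
  rewrite -/x -/a2 -/a -/(r p.1) in h1.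
  apply: (@le_trans _ _ ((2 * V + 2 * (a * r p.1)) * Num.sqrt (G p.1 p.2 z))).
    by rewrite ler_wpM2r ?sqrtr_ge0 //; lra.
  by rewrite le_eqVlt; apply/orP; left; apply/eqP; ring.
have h1 : 8 * V * X2 z <= 4 * sigma ^+ 2 * P + 4 * (V ^+ 2 / (P * sigma ^+ 2)) * X2 z ^+ 2.
  have h : 0 <= 4 * (P * sigma ^+ 2)^-1 * (P * sigma ^+ 2 - V * X2 z) ^+ 2.
    by rewrite mulr_ge0 ?sqr_ge0 // mulr_ge0 ?invr_ge0 ?mulr_ge0 // ?ltW.
  rewrite -subr_ge0; apply: le_trans h _; rewrite le_eqVlt; apply/orP; left; apply/eqP.
  by field; rewrite !gt_eqF.
have h2 : 0 <= (a / 2 - 4 * X3 z) ^+ 2 by rewrite sqr_ge0.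
rewrite -/(X1 z); nra.
Qed.

End Grid.

(** * Hardy-Krause variation *)

Section Face.
Context {R : realType} {I : finType}.

Definition face_extend (S : {set I}) (u : {j : I | j \in S} -> R) : I -> R :=
  fun j => if insub j is Some k then u k else 0.

Lemma face_extend_in (S : {set I}) (u : {j : I | j \in S} -> R) k :
  face_extend S u (val k) = u k.
Proof. by rewrite /face_extend valK. Qed.

Lemma face_extend_out (S : {set I}) (u : {j : I | j \in S} -> R) j :
  j \notin S -> face_extend S u j = 0.
Proof. by move=> jS; rewrite /face_extend insubN. Qed.

(** Outside [S] both end points are 0, so a rectangle of the face is a degenerate rectangle of the
    cube and the index families with nonzero entries outside [S] drop out. *)
Lemma quasi_volume_face (S : {set I}) (f : (I -> R) -> R) (a b : {j : I | j \in S} -> R) :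
  quasi_volume (face_restriction (S := S) f) a b =
  quasi_volume f (face_extend S a) (face_extend S b).
Proof.
pose h (J : {ffun {j : I | j \in S} -> bool}) : {ffun I -> bool} :=
  [ffun j => if insub j is Some k then J k else false].
pose h' (J : {ffun I -> bool}) : {ffun {j : I | j \in S} -> bool} := [ffun k => J (val k)].
have h_in J k : h J (val k) = J k by rewrite ffunE valK.
have h_out J j : j \notin S -> h J j = false by move=> jS; rewrite ffunE insubN.
have hK J : h' (h J) = J by apply/ffunP => k; rewrite ffunE h_in.
rewrite /quasi_volume [RHS](reindex_onto h h') /=; last first.
  move=> J /forallP HJ; apply/ffunP => j.
  have [jS|jS] := boolP (j \in S).
    by rewrite -[j]/(val (Sub j jS : {j : I | j \in S})) h_in ffunE.
  by rewrite h_out //; have := HJ j; rewrite !face_extend_out // eqxx; case: (J j).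
apply: eq_big => [J|J _].
  rewrite hK eqxx andbT; apply/forallP/forallP => HJ j; last first.
    by have := HJ (val j); rewrite h_in !face_extend_in.
  have [jS|jS] := boolP (j \in S); last by rewrite h_out.
  by rewrite -[j]/(val (Sub j jS : {j : I | j \in S})) h_in !face_extend_in.
have -> : (\sum_i h J i = \sum_i J i)%N.
  rewrite (bigID (mem S)) /= [X in (_ + X)%N]big1 ?addn0 => [|j jS]; last by rewrite h_out.
  by rewrite big_sub; apply: eq_bigr => k _; rewrite h_in.
congr (_ * f _); apply/funext => j.
have [jS|jS] := boolP (j \in S).
  by rewrite -[j]/(val (Sub j jS : {j : I | j \in S})) valK h_in !face_extend_in.
by rewrite insubN // !face_extend_out // subrr mulr0 addr0.
Qed.

Lemma face_restriction_em (S : {set I}) (f : (I -> R) -> R) :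
  entirely_monotone f -> entirely_monotone (face_restriction (S := S) f).
Proof.
move=> fEM a b ac bc ab leab; rewrite quasi_volume_face; apply: fEM.
- move=> j; rewrite /face_extend; case: insubP => [k _ _|_]; [exact: ac | by rewrite lexx ler01].
- move=> j; rewrite /face_extend; case: insubP => [k _ _|_]; [exact: bc | by rewrite lexx ler01].
- move=> e; apply: ab; apply/funext => k.
  by have := congr1 (fun h => h (val k)) e; rewrite !face_extend_in.
- by move=> j; rewrite /face_extend; case: insubP.
Qed.

End Face.

Lemma sum_injective_le {R : numDomainType} (A B : finType) (h : A -> B) (Q : pred B) (phi : B -> R) :
  injective h -> (forall a, Q (h a)) -> (forall b, Q b -> 0 <= phi b) ->
  \sum_a phi (h a) <= \sum_(b | Q b) phi b.
Proof.
move=> hinj hQ phi0.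
have -> : \sum_a phi (h a) = \sum_b \sum_(a | h a == b) phi b.
  rewrite (partition_big h xpredT) //=; apply: eq_bigr => b _.
  by apply: eq_bigr => a /eqP ->.
rewrite [leRHS]big_mkcond; apply: ler_sum => b _.
case: (pickP (fun a => h a == b)) => [a /eqP hab|hb]; last first.
  by rewrite big_pred0 //; case: ifP => // /phi0.
rewrite (big_pred1 a) => [|a']; first by rewrite -hab hQ.
by rewrite -hab (inj_eq hinj).
Qed.

Section Variation.
Context {R : realType} {I : finType} (f : (I -> R) -> R).
Hypotheses (fEM : entirely_monotone f) (i0 : I).

(** The quasi-volumes are nonnegative and, indexed by their upper corners, are among the terms with
    k != 0 of a sum that telescopes to f(1) - f(0). The coordinate [i0] ensures k != 0: without
    coordinates the quasi-volume would be the value of [f]. *)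
Lemma em_variation_sum_le (p : I -> seq R) : (forall s, itv_partition 0 1 (p s)) ->
  \sum_(l : {dffun forall s : I, 'I_(size (p s))})
    `|quasi_volume f (fun s => nth 0 (0 :: p s) (l s)) (fun s => nth 0 (0 :: p s) (l s).+1)| <=
  f (fun=> 1) - f (fun=> 0).
Proof.
move=> pP; pose t s x : R := nth 0 (0 :: p s) x.
have tS s x : (x < size (p s))%N -> t s x < t s x.+1.
  by have [/(pathP 0) h _] := pP s; apply: h.
have t_end s : t s (size (p s)) = 1.
  by have [_ /eqP <-] := pP s; rewrite (last_nth 0).
have t01 s x : (x <= size (p s))%N -> 0 <= t s x <= 1.
  move=> xs; apply/andP; split.
    elim: x xs => [|x IH] xs; first by rewrite /t /= lexx.
    by apply: le_trans (IH (ltnW xs)) _; apply/ltW/tS.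
  rewrite -(t_end s) -(subKn xs); move: (size (p s) - x)%N (leq_subr x (size (p s))) => k.
  elim: k => [|k IH] ks; first by rewrite subn0.
  apply: le_trans (IH (ltnW ks)); apply/ltW.
  have -> : (size (p s) - k = (size (p s) - k.+1).+1)%N by lia.
  by apply: tS; lia.
pose F (u : I -> nat) := f (fun s => t s (u s)).
pose M := (\max_s (size (p s)).+1)%N.
have sM s : ((size (p s)).+1 <= M)%N by exact: (leq_bigmax s).
pose ok (k : {ffun I -> 'I_M}) := [forall s, (k s < (size (p s)).+1)%N].
have MD0 (k : {ffun I -> 'I_M}) : ok k -> (exists s, 0 < k s)%N ->
    0 <= mixed_difference F (fun s => k s).
  move=> /forallP kok; apply: (em_nodes_ge0 f fEM t) => [s x xk|s ks].
    by apply: t01; apply: leq_trans xk _; rewrite -ltnS.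
  rewrite -{2}(prednK ks); apply: tS; have := kok s; lia.
have tot := @sum_mixed_difference R I (fun s => (size (p s)).+1) M (fun=> 0%N)
  (fun s => (size (p s)).+1) (fun=> isT) (fun s => leqnn _) sM F.
have totE : F (fun i => (0 + (size (p i)).+1.-1)%N) = f (fun=> 1).
  by congr f; apply/funext => s; rewrite add0n /= t_end.
rewrite {}totE in tot.
have lM (l : {dffun forall s : I, 'I_(size (p s))}) s : ((l s).+1 < M)%N.
  by apply: leq_ltn_trans (ltn_ord (l s)) _; exact: sM.
pose up (l : {dffun forall s : I, 'I_(size (p s))}) : {ffun I -> 'I_M} :=
  [ffun s => Ordinal (lM l s)].
have up_inj : injective up.
  move=> l l' /ffunP e; apply/ffunP => s; apply/val_inj; have := e s.
  by rewrite !ffunE => /(congr1 val) /= [].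
have upE (l : {dffun forall s : I, 'I_(size (p s))}) :
    `|quasi_volume f (fun s => nth 0 (0 :: p s) (l s)) (fun s => nth 0 (0 :: p s) (l s).+1)| =
    mixed_difference F (fun s => up l s).
  have E := quasi_volume_nodes f t (fun s => (l s).+1) (fun s _ => negbT (lt_eqF (tS s _ (ltn_ord (l s))))).
  have -> : quasi_volume f (fun s => nth 0 (0 :: p s) (l s)) (fun s => nth 0 (0 :: p s) (l s).+1) =
      mixed_difference F (fun s => up l s).
    transitivity (mixed_difference F (fun s => (l s).+1)).
      rewrite -[RHS]E; congr quasi_volume; apply/funext => s; by rewrite subn1.
    by congr mixed_difference; apply/funext => s; rewrite ffunE.
  rewrite ger0_norm // MD0 //; last by exists i0; rewrite ffunE.
  by apply/forallP => s; rewrite ffunE /= ltnS ltn_ord.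
under eq_bigr do rewrite upE.
have M0 : (0 < M)%N by apply: leq_trans (sM i0).
pose kz : {ffun I -> 'I_M} := [ffun=> Ordinal M0].
have kz_ok : ok kz by apply/forallP => s; rewrite ffunE.
rewrite -/ok (bigD1 kz) //= mixed_difference0 in tot; last by move=> s; rewrite ffunE.
have t0E : F (fun s => (0 + kz s)%N) = f (fun=> 0) by congr f; apply/funext => s; rewrite ffunE.
rewrite {}t0E in tot; rewrite -tot addrC addrK.
apply: (sum_injective_le _ _ up (fun k => ok k && (k != kz)) (fun k => mixed_difference F (fun s => k s))
   up_inj).
- move=> l; apply/andP; split; first by apply/forallP => s; rewrite ffunE /= ltnS ltn_ord.
  by apply/eqP => /ffunP/(_ i0); rewrite !ffunE => /(congr1 val).
- move=> k /andP[kok kkz]; apply: MD0 => //; apply: contrapT => h; move/eqP: kkz; apply.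
  apply/ffunP => s; rewrite ffunE; apply/val_inj => /=; apply/eqP; rewrite -leqn0 leqNgt.
  by apply/negP => ks; apply: h; exists s.
Qed.

(** Finiteness matters because the variation enters the theorem through [fine], which sends infinity
    to 0. The lower bound comes from the trivial split. *)
Lemma em_vitali_variation_fin :
  (vitali_variation f \is a fin_num) /\
  ((quasi_volume f (fun=> 0) (fun=> 1))%:E <= vitali_variation f)%E.
Proof.
have lb : ((quasi_volume f (fun=> 0) (fun=> 1))%:E <= vitali_variation f)%E.
  pose p (_ : I) : seq R := [:: 1].
  apply: le_ereal_sup_tmp; exists (\sum_(l : {dffun forall s : I, 'I_(size (p s))})
     `|quasi_volume f (fun s => nth 0 (0 :: p s) (l s)) (fun s => nth 0 (0 :: p s) (l s).+1)|)%:E.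
    by exists p => // s; rewrite /itv_partition /= ltr01.
  rewrite lee_fin; pose l0 : {dffun forall s : I, 'I_(size (p s))} := [ffun s => ord0].
  rewrite (bigD1 l0) //= (_ : (fun s => nth 0 (0 :: p s) (l0 s)) = fun=> 0); last first.
    by apply/funext => s; rewrite ffunE.
  rewrite (_ : (fun s => nth 0 (p s) (l0 s)) = fun=> 1); last first.
    by apply/funext => s; rewrite ffunE.
  by apply: ler_wpDr; [apply: sumr_ge0 | exact: ler_norm].
have ub : (vitali_variation f <= (f (fun=> 1) - f (fun=> 0))%:E)%E.
  by apply: ge_ereal_sup => _ [p pP <-]; rewrite lee_fin; apply: em_variation_sum_le.
split=> //; rewrite fin_numE; apply/andP; split.
  by rewrite -ltNye; apply: lt_le_trans lb; exact: ltNyr.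
by rewrite -ltey; apply: le_lt_trans ub _; exact: ltry.
Qed.

End Variation.

(** With the nodes 0 and 1 in every coordinate, each k != 0 is the indicator of a nonempty [S], and
    the mixed difference at k is the quasi-volume of the face [0,1]^S. These sum to f(1) - f(0). *)
Lemma em_HK0_variation_ge {R : realType} {I : finType} (f : (I -> R) -> R) :
  entirely_monotone f -> f (fun=> 1) - f (fun=> 0) <= fine (HK0_variation f).
Proof.
move=> fEM.
have faceP (S : {set I}) : S != finset.set0 ->
    (vitali_variation (face_restriction (S := S) f) \is a fin_num) /\
    ((quasi_volume f (face_extend S (fun=> 0)) (face_extend S (fun=> 1)))%:E <=
      vitali_variation (face_restriction (S := S) f))%E.
  move=> /set0Pn[j jS]; rewrite -quasi_volume_face.
  exact: em_vitali_variation_fin (face_restriction_em S f fEM) (Sub j jS).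
have HKfin : HK0_variation f \is a fin_num by rewrite /HK0_variation; apply/sum_fin_numP => S _ /faceP[].
rewrite -lee_fin fineK //.
apply: (@le_trans _ _ (\sum_(S : {set I} | S != finset.set0)
    (quasi_volume f (face_extend S (fun=> 0)) (face_extend S (fun=> 1)))%:E)%E); last first.
  by apply: lee_sum => S /faceP[].
rewrite sumEFin lee_fin.
pose F (u : I -> nat) := f (fun i => (u i)%:R).
have tot := @sum_mixed_difference R I (fun=> 2%N) 2 (fun=> 0%N) (fun=> 2%N)
  (fun=> isT) (fun=> isT) (fun=> isT) F.
pose kz : {ffun I -> 'I_2} := [ffun=> ord0].
rewrite (bigD1 kz) /= in tot; last by apply/forallP => i; rewrite ffunE.
rewrite mixed_difference0 in tot; last by move=> i; rewrite ffunE.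
have t0E : F (fun s => (0 + kz s)%N) = f (fun=> 0) by congr f; apply/funext => s; rewrite ffunE.
rewrite {}t0E in tot; rewrite -[X in X - _ <= _]tot addrC addrK.
pose h (S : {set I}) : {ffun I -> 'I_2} := [ffun j => inord (j \in S)].
pose h' (k : {ffun I -> 'I_2}) : {set I} := finset.finset (fun j => k j == 1%N :> nat).
have hE S j : h S j = (j \in S) :> nat by rewrite ffunE inordK // ltnS; case: (j \in S).
have hh' k : h (h' k) = k.
  apply/ffunP => j; apply/val_inj; rewrite /= hE finset.inE.
  by case: (k j) => [[|[|]]].
have h'h S : h' (h S) = S by apply/finset.setP => j; rewrite finset.inE hE; case: (j \in S).
rewrite le_eqVlt; apply/orP; left; apply/eqP.
rewrite (reindex_onto h h') => [|k _]; last exact: hh'.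
apply: eq_big => [S|S _].
  rewrite h'h eqxx andbT; apply/andP/idP => [[_ hS]|S0].
    apply: contraNneq hS => ->; apply/eqP/ffunP => j; apply/val_inj.
    by rewrite /= hE ffunE finset.in_set0.
  split; first by apply/forallP => i; exact: ltn_ord.
  apply: contraNneq S0 => e; apply/eqP/finset.setP => j; rewrite finset.in_set0.
  by have := hE S j; rewrite e ffunE /=; case: (j \in S).
have E := quasi_volume_nodes f (fun _ x => x%:R) (fun j => j \in S).
transitivity (mixed_difference F (fun j => (j \in S) : nat)).
  by congr mixed_difference; apply/funext => j; rewrite hE.
rewrite -E => [|i]; last by case: (i \in S) => //= _; rewrite eq_sym oner_eq0.
congr quasi_volume; apply/funext => j; rewrite /face_extend; case: insubP => /=.
- by move=> k jS _; rewrite jS.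
- by move=> /negbTE->.
- by move=> k jS _; rewrite jS.
- by move=> /negbTE->.
Qed.

(** * Choice of the cutoff levels *)

(** Half of the growth, sqrt r, pays for one factor z + 1; the other half is left to the
    induction. *)
Lemma poly_le_geometric {R : rcfType} (d : nat) (r : R) : 1 < r ->
  exists2 c : R, 0 < c & forall z : nat, z.+1%:R ^+ d <= c * r ^+ z.
Proof.
elim: d r => [|d IH] r r1.
  by exists 1 => // z; rewrite expr0 mul1r exprn_ege1 // ltW.
pose q := Num.sqrt r; have q1 : 1 < q by rewrite -sqrtr1 ltr_sqrt //; lra.
have qq : q ^+ 2 = r by rewrite sqr_sqrtr //; lra.
have [c c0 cP] := IH q q1.
have e0 : 0 < q - 1 by lra.
pose c1 := 1 + (q - 1)^-1.
have c10 : 0 < c1 by rewrite addr_gt0 ?invr_gt0.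
have bern z : z.+1%:R <= c1 * q ^+ z.
  elim: z => [|z IHz]; first by rewrite expr0 mulr1 /c1 lerDl invr_ge0 ltW.
  have h1 : 1 <= q ^+ z by rewrite exprn_ege1 // ltW.
  have h2 : (q - 1) * c1 = q by rewrite /c1; field; rewrite gt_eqF.
  have h3 : q <= (q - 1) * c1 * q ^+ z by rewrite h2 ler_peMr //; lra.
  rewrite -natr1 exprS.
  have -> : c1 * (q * q ^+ z) = c1 * q ^+ z + (q - 1) * c1 * q ^+ z by ring.
  lra.
exists (c * c1) => [|z]; first exact: mulr_gt0.
rewrite exprS -qq -exprM mulnC exprM expr2 mulrC.
have -> : c * c1 * (q ^+ z * q ^+ z) = (c * q ^+ z) * (c1 * q ^+ z) by ring.
by apply: ler_pM => //; rewrite ?exprn_ge0 ?ler0n.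
Qed.

Lemma poly_geometric_sum_le {R : rcfType} (d : nat) :
  exists2 c : R, 0 < c & forall N, \sum_(z < N) (2 / 3 : R) ^+ z * z.+1%:R ^+ d <= c.
Proof.
(* The ratio 9/8 is chosen because (2/3)(9/8) = 3/4. *)
have [|c c0 cP] := @poly_le_geometric R d (9 / 8); first by lra.
exists (c * 4) => [|N]; first by rewrite mulr_gt0.
apply: (@le_trans _ _ (\sum_(z < N) c * (3 / 4) ^+ z)).
  apply: ler_sum => z _.
  have -> : (3 / 4 : R) ^+ z = (2 / 3) ^+ z * (9 / 8) ^+ z.
    by rewrite -exprMn; congr (_ ^+ z); field.
  rewrite mulrCA ler_wpM2l // exprn_ge0 // divr_ge0 //.
by rewrite -mulr_sumr ler_wpM2l ?sum_geometric_le // ltW.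
Qed.

(** A cutoff is a maximum, hence known only from below; raising it may increase the tail, but at
    most by a constant factor. *)
Lemma geometric_poly_quasi_decreasing {R : rcfType} (d : nat) :
  exists2 c : R, 0 < c & forall u v : nat, (u <= v)%N ->
    2^-1 ^+ v * v.+1%:R ^+ d <= c * (2^-1 ^+ u * u.+1%:R ^+ d).
Proof.
have [|c c0 cP] := @poly_le_geometric R d 2; first by lra.
exists c => // u v uv; rewrite -(subnKC uv); move: (v - u)%N => z.
have h1 : (u + z).+1%:R ^+ d <= u.+1%:R ^+ d * z.+1%:R ^+ d :> R.
  by rewrite -exprMn -natrM lerXn2r ?nnegrE ?ler0n // ler_nat; lia.
have h0 : 0 <= 2^-1 ^+ u * 2^-1 ^+ z :> R by rewrite mulr_ge0 ?exprn_ge0 ?invr_ge0.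
have u0 : 0 <= 2^-1 ^+ u * u.+1%:R ^+ d * 2^-1 ^+ z :> R.
  by rewrite !mulr_ge0 ?exprn_ge0 ?invr_ge0 ?ler0n.
rewrite exprD; apply: le_trans (ler_wpM2l h0 h1) _.
have := ler_wpM2l u0 (cP z).
have e : 2^-1 ^+ z * 2 ^+ z = 1 :> R by rewrite -exprMn mulVf ?expr1n ?pnatr_eq0.
have -> : 2^-1 ^+ u * u.+1%:R ^+ d * 2^-1 ^+ z * (c * 2 ^+ z) =
    c * (2^-1 ^+ u * u.+1%:R ^+ d) * (2^-1 ^+ z * 2 ^+ z) :> R by ring.
rewrite e mulr1; apply: le_trans; rewrite le_eqVlt; apply/orP; left; apply/eqP; ring.
Qed.

Lemma sum_half_geometric_le {R : realFieldType} (N : nat) :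
  \sum_(a < N) (3 / 4 : R) ^+ a./2 <= 8.
Proof.
have q0 k : 0 <= (3 / 4 : R) ^+ k by rewrite exprn_ge0 // divr_ge0.
apply: (@le_trans _ _ (\sum_(a < N.*2) (3 / 4 : R) ^+ a./2)).
  rewrite -(big_mkord xpredT (fun a => (3 / 4 : R) ^+ a./2)).
  rewrite -(big_mkord xpredT (fun a => (3 / 4 : R) ^+ a./2)).
  rewrite [leRHS](@big_cat_nat _ _ _ N) //=; last by rewrite -addnn leq_addr.
  by rewrite lerDl sumr_ge0.
have -> : \sum_(a < N.*2) (3 / 4 : R) ^+ a./2 = 2 * \sum_(z < N) (3 / 4) ^+ z.
  elim: N => [|N IH]; first by rewrite !big_ord0 mulr0.
  rewrite doubleS !big_ord_recr /= IH doubleK uphalf_double.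
  by ring.
by have := @sum_geometric_le R N; lra.
Qed.

Section ValidSums.
Context {R : realType} {d : nat}.
Variables (K : 'I_d -> nat) (bv : 'I_d -> nat -> nat -> bool) (Q : nat).
Hypotheses (bvK : forall j c k, bv j c k -> (k <= K j)%N) (KQ : forall j, (K j < Q)%N).
Local Notation block := {ffun 'I_d -> 'I_3 * 'I_Q}.
Local Notation depth := (fun (b : block) j => (K j - (b j).2)%N).

(** Blocks are chosen coordinate by coordinate, so the sum factorizes; each size occurs in at most
    three families. *)
Lemma valid_sum_prod_le (phi : 'I_d -> nat -> R) (S : 'I_d -> R) :
  (forall j a, 0 <= phi j a) -> (forall j, \sum_(a < (K j).+1) phi j a <= S j) ->
  \sum_(b : block | valid_block bv Q b) \prod_j phi j (depth b j) <= \prod_j (3 * S j).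
Proof.
move=> phi0 HS.
pose P j : pred ('I_3 * 'I_Q) := fun be => (be.2 <= K j)%N.
apply: (@le_trans _ _ (\sum_(b in family P) \prod_j phi j (depth b j))).
  rewrite big_mkcond [leRHS]big_mkcond; apply: ler_sum => b _.
  case: ifP => [/forallP vb|_]; last by case: ifP => // _; apply: prodr_ge0.
  rewrite (_ : b \in family P) //; apply/familyP => j; exact: bvK (vb j).
rewrite -(bigA_distr_big_dep P (fun j (be : 'I_3 * 'I_Q) => phi j (K j - be.2)%N)).
apply: ler_prod => j _; rewrite sumr_ge0 //=.
have -> : \sum_(be : 'I_3 * 'I_Q | P j be) phi j (K j - be.2)%N =
    \sum_(c < 3) \sum_(k < Q | (k <= K j)%N) phi j (K j - k)%N.
  by rewrite pair_big_dep; apply: eq_big.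
rewrite sumr_const card_ord -[leLHS]mulr_natl ler_wpM2l //.
rewrite (eq_bigl (fun k : 'I_Q => (k < (K j).+1)%N)) //.
rewrite -(big_ord_widen Q (fun k => phi j (K j - k)%N) (KQ j)).
rewrite (reindex_inj rev_ord_inj) /=; apply: le_trans (HS j).
by apply: ler_sum => a _; rewrite subSS subKn // -ltnS.
Qed.

Variable m : 'I_d -> nat.
Hypothesis Km : forall j, (2 ^ K j <= m j)%N.
Variables (Lw L0 : nat).

Local Notation shift := (fun b : block => (\sum_j (depth b j)./2)%N).
Local Notation D := ((3 * 8 : R) ^+ d).

(* Deep blocks, which are small, get a lower cutoff; the decay in the depth makes
   the sums over all blocks geometric. [Lw] takes over when [V] is small. *)
Definition cutoff_level (b : block) : nat := maxn Lw (L0 - shift b).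
(** Shifting by half the depth balances the costs: with the cutoff L_b before the floor [Lw], both
    2^L_b and n_b 2^-L_b decay like 2^(-depth/2). In the second, each factor 1/2 is written as 2/3
    times 3/4: this weight takes 3/4 and leaves 2/3, and both are summable. *)
Definition block_weight (b : block) : R := \prod_j (3 / 4) ^+ uphalf (depth b j).

Lemma block_weight_gt0 b : 0 < block_weight b.
Proof. by apply: prodr_gt0 => j _; rewrite exprn_gt0 // divr_gt0. Qed.

Lemma valid_geometric_sum_le (phi : nat -> R) :
  (forall a, 0 <= phi a <= (3 / 4) ^+ a./2) ->
  \sum_(b : block | valid_block bv Q b) \prod_j phi (depth b j) <= D.
Proof.
move=> Hphi; have phi0 j a : 0 <= (fun _ : 'I_d => phi) j a by have /andP[] := Hphi a.
apply: le_trans (valid_sum_prod_le (fun=> phi) (fun=> 8) phi0 _) _ => [j|].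
  by apply: le_trans (sum_half_geometric_le _); apply: ler_sum => a _; have /andP[] := Hphi a.
by rewrite prodr_const card_ord.
Qed.

Lemma block_weight_sum_le : \sum_(b | valid_block bv Q b) block_weight b <= D.
Proof.
apply: (valid_geometric_sum_le (fun a => (3 / 4) ^+ uphalf a)) => a.
by rewrite exprn_ge0 ?divr_ge0 //= uphalf_half exprD ler_piMl ?exprn_ge0 ?divr_ge0 ?exprn_ile1 //; lra.
Qed.

Lemma low_level_sum_le :
  \sum_(b | valid_block bv Q b) 2 ^+ cutoff_level b * (cutoff_level b).+1%:R ^+ d.-1 <=
  (\sum_(b | valid_block bv Q b) 1) * (2 ^+ Lw * Lw.+1%:R ^+ d.-1) + D * (2 ^+ L0 * L0.+1%:R ^+ d.-1) :> R.
Proof.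
have H0 k : 0 <= 2 ^+ k * k.+1%:R ^+ d.-1 :> R by rewrite mulr_ge0 ?exprn_ge0 ?ler0n.
apply: (@le_trans _ _ (\sum_(b | valid_block bv Q b)
  (1 * (2 ^+ Lw * Lw.+1%:R ^+ d.-1) + (\prod_j 2^-1 ^+ (depth b j)./2) * (2 ^+ L0 * L0.+1%:R ^+ d.-1)))).
  apply: ler_sum => b _; rewrite prodrXr /cutoff_level mul1r; set x := (\sum_j _)%N.
  have [h|h] := leqP (L0 - x) Lw.
    by rewrite lerDl mulr_ge0 ?exprn_ge0 ?invr_ge0.
  apply: ler_wpDl => //.
  have xL : (x <= L0)%N by lia.
  rewrite mulrA; have -> : 2^-1 ^+ x * 2 ^+ L0 = 2 ^+ (L0 - x) :> R.
    by rewrite expfB_cond ?pnatr_eq0 // exprVn mulrC.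
  by rewrite ler_wpM2l ?exprn_ge0 // lerXn2r ?nnegrE ?ler0n // ler_nat ltnS leq_subr.
rewrite big_split /= -!mulr_suml lerD2l ler_wpM2r //.
apply: (valid_geometric_sum_le (fun a => 2^-1 ^+ a./2)) => a.
by rewrite exprn_ge0 ?invr_ge0 //= lerXn2r ?nnegrE ?divr_ge0 ?invr_ge0 //; lra.
Qed.

Variable c2 : R.
Hypothesis c2P : forall u v : nat, (u <= v)%N ->
  2^-1 ^+ v * v.+1%:R ^+ d <= c2 * (2^-1 ^+ u * u.+1%:R ^+ d).
Hypothesis c20 : 0 <= c2.

Lemma cutoff_tail_sum_le :
  \sum_(b | valid_block bv Q b) 2^-1 ^+ cutoff_level b * (cutoff_level b).+1%:R ^+ d <=
  (\sum_(b | valid_block bv Q b) 1) * (c2 * (2^-1 ^+ Lw * Lw.+1%:R ^+ d)).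
Proof.
rewrite mulr_suml; apply: ler_sum => b _; rewrite mul1r; apply: c2P.
exact: leq_maxl.
Qed.

Lemma high_level_sum_le :
  \sum_(b | valid_block bv Q b) block_volume Q b *
     (2^-1 ^+ cutoff_level b * (cutoff_level b).+1%:R ^+ d) / block_weight b <=
  D * ((\prod_j (m j)%:R) * c2 * (2^-1 ^+ L0 * L0.+1%:R ^+ d)).
Proof.
set nn := \prod_j (m j)%:R : R.
have nn0 : 0 <= nn by apply: prodr_ge0 => j _; rewrite ler0n.
have half0 : 0 <= 2^-1 :> R by rewrite invr_ge0.
apply: (@le_trans _ _ (\sum_(b | valid_block bv Q b)
  (\prod_j (2 / 3) ^+ uphalf (depth b j)) * (nn * c2 * (2^-1 ^+ L0 * L0.+1%:R ^+ d)))); last first.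
  rewrite -mulr_suml ler_wpM2r //.
    by rewrite !mulr_ge0 ?exprn_ge0 ?ler0n.
  apply: (valid_geometric_sum_le (fun a => (2 / 3) ^+ uphalf a)) => a.
  rewrite exprn_ge0 ?divr_ge0 //=; apply: (@le_trans _ _ ((2 / 3) ^+ a./2)).
    by rewrite uphalf_half exprD ler_piMl ?exprn_ge0 ?divr_ge0 ?exprn_ile1 //; lra.
  by rewrite lerXn2r ?nnegrE ?divr_ge0 //; lra.
apply: ler_sum => b /forallP vb; pose x := (\sum_j (depth b j)./2)%N.
have h1 : 2^-1 ^+ cutoff_level b * (cutoff_level b).+1%:R ^+ d <=
    c2 * (2^-1 ^+ L0 * L0.+1%:R ^+ d) * 2 ^+ x.
  apply: le_trans (c2P (L0 - x) _ (leq_maxr _ _)) _.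
  have e1 : 2^-1 ^+ (L0 - x) <= 2^-1 ^+ L0 * 2 ^+ x :> R.
    have -> : 2^-1 ^+ (L0 - x) = 2^-1 ^+ (L0 - x + x) * 2 ^+ x :> R.
      by rewrite exprD -mulrA -exprMn mulVf ?expr1n ?mulr1 // pnatr_eq0.
    rewrite ler_wpM2r ?exprn_ge0 //; apply: ler_wiXn2l => //; first by lra.
    by rewrite -leq_subLR; lia.
  have e2 : (L0 - x).+1%:R ^+ d <= L0.+1%:R ^+ d :> R.
    by rewrite lerXn2r ?nnegrE ?ler0n // ler_nat ltnS leq_subr.
  rewrite -mulrA ler_wpM2l // -mulrA [_ ^+ d * 2 ^+ x]mulrC mulrA.
  by apply: ler_pM => //; rewrite ?exprn_ge0 ?ler0n.
have h2 : block_volume Q b * 2 ^+ x <= nn * (\prod_j (2 / 3) ^+ uphalf (depth b j)) * block_weight b.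
  rewrite /block_volume /nn /block_weight -prodrXr -!big_split /=.
  apply: ler_prod => j _; rewrite mulr_ge0 ?exprn_ge0 //=.
  have kK := bvK _ _ _ (vb j); move: (Km j); set a := (K j - (b j).2)%N => Kmj.
  have -> : (m j)%:R * (2 / 3) ^+ uphalf a * (3 / 4) ^+ uphalf a = (m j)%:R * 2^-1 ^+ uphalf a :> R.
    by rewrite -mulrA -exprMn; congr (_ * _ ^+ _); field.
  have e : 2^-1 ^+ uphalf a * 2 ^+ uphalf a = 1 :> R by rewrite -exprMn mulVf ?expr1n // pnatr_eq0.
  have -> : 2 ^+ (b j).2 * 2 ^+ a./2 = 2 ^+ K j * 2^-1 ^+ uphalf a :> R.
    have -> : 2 ^+ K j = 2 ^+ (b j).2 * 2 ^+ a./2 * 2 ^+ uphalf a :> R.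
      rewrite -!exprD; congr (2 ^+ _).
      have aK : (a + (b j).2 = K j)%N by rewrite subnK.
      by rewrite uphalf_half; have := odd_double_half a; rewrite -addnn -aK; lia.
    by rewrite -[RHS]mulrA [2 ^+ uphalf a * _]mulrC e mulr1.
  by rewrite ler_wpM2r ?exprn_ge0 // -natrX ler_nat.
rewrite ler_pdivrMr ?block_weight_gt0 //.
have v0 : 0 <= block_volume Q b :> R by rewrite ltW ?block_volume_gt0.
apply: le_trans (ler_wpM2l v0 h1) _.
have k0 : 0 <= c2 * (2^-1 ^+ L0 * L0.+1%:R ^+ d) by rewrite !mulr_ge0 ?exprn_ge0 ?ler0n.
have := ler_wpM2l k0 h2.
move: (block_volume Q b) (block_weight b) (\prod_j _) (2 ^+ x) (2^-1 ^+ L0 * L0.+1%:R ^+ d) => t1 t2 t3 t4 t5.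
lra.
Qed.

Lemma valid_card_le : \sum_(b | valid_block bv Q b) 1 <= \prod_j (3 * (K j).+1%:R) :> R.
Proof.
have -> : \sum_(b | valid_block bv Q b) 1 =
    \sum_(b | valid_block bv Q b) \prod_(j < d) 1 :> R.
  by apply: eq_bigr => b _; rewrite big1.
apply: (valid_sum_prod_le (fun _ _ => 1) (fun j => (K j).+1%:R) (fun _ _ => ler01)) => j.
by rewrite sumr_const card_ord.
Qed.

End ValidSums.

Lemma ln2_ge_half {R : realType} : 2^-1 <= ln 2 :> R.
Proof.
have h0 : -1 < - 2^-1 :> R by lra.
have h := le_ln1Dx h0.
have e : 1 - 2^-1 = 2^-1 :> R by lra.
rewrite e lnV ?posrE // in h; lra.
Qed.

Lemma depth_le_log {R : realType} (K n : nat) : (0 < n)%N -> (2 ^ K <= n)%N ->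
  K.+1%:R <= 2 * (1 + ln n%:R) :> R.
Proof.
move=> n0 Kn.
have h : ln (2 ^+ K) <= ln n%:R :> R.
  by rewrite ler_ln ?posrE ?exprn_gt0 ?ltr0n // -natrX ler_nat.
rewrite lnXn // -[_ *+ K]mulr_natl in h.
have := ler_wpM2l (ler0n R K) (@ln2_ge_half R); rewrite -[K.+1%:R]natr1; lra.
Qed.

Lemma grid_risk_optimized {R : realType} (d : nat) : (0 < d)%N ->
  exists2 C : R, 0 < C & forall (n : nat) (m : 'I_d -> nat) (idx : 'I_n -> 'I_d -> nat),
    (forall j, (0 < m j)%N) -> (forall i j, (idx i j < m j)%N) ->
    (forall i i', (forall j, idx i j = idx i' j) -> i = i') ->
    (forall u : 'I_d -> nat, (forall j, u j < m j)%N -> exists i, forall j, idx i j = u j) ->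
    n = (\prod_j m j)%N ->
    forall (sigma V P : R) (Lw L0 : nat), 0 < sigma -> 0 <= V -> 0 < P ->
    let La := 1 + ln n%:R in
    exists F, gaussian_mean_le sigma F
      (C * sigma ^+ 2 * (La ^+ d * (2 ^+ Lw * Lw.+1%:R ^+ d.-1) + 2 ^+ L0 * L0.+1%:R ^+ d.-1 + P +
         V ^+ 2 * n%:R / sigma ^+ 2 / P * (2^-1 ^+ L0 * L0.+1%:R ^+ d) +
         La ^+ d * La ^+ d * (2^-1 ^+ Lw * Lw.+1%:R ^+ d))) /\
    forall f g z, entirely_monotone f -> entirely_monotone g -> g (fun=> 1) - g (fun=> 0) <= V ->
     let x i := grid_value m f (idx i) - grid_value m g (idx i) in
     \sum_i x i ^+ 2 <= 2 * \sum_i z i * x i -> \sum_i x i ^+ 2 <= F z.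
Proof.
move=> d0; have [c c0 c_sum] := @poly_geometric_sum_le R d.
have [c2 c20 c2P] := @geometric_poly_quasi_decreasing R d.
(* [D] bounds the geometric sums over blocks, and S (1 + ln n)^d their number: a coordinate has at
   most 3 (K + 1) <= 6 (1 + ln n) of them. *)
pose D : R := (3 * 8) ^+ d; pose S : R := 6 ^+ d; pose d1 : R := d.+1%:R.
have D0 : 0 < D by rewrite exprn_gt0.
have S0 : 0 < S by rewrite exprn_gt0.
have d10 : 0 < d1 by rewrite ltr0n.
pose k1 := 512 * S; pose k2 := 512 * D; pose k4 := 512 * d1 * c * D * D * c2.
pose k5 := 4096 * d1 * c * c2 * S * S.
have c512 : 0 < 512 :> R by rewrite ltr0n.
have c4096 : 0 < 4096 :> R by rewrite ltr0n.
have k10 : 0 < k1 by rewrite /k1 (mulr_gt0 c512 S0).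
have k20 : 0 < k2 by rewrite /k2 (mulr_gt0 c512 D0).
have k40 : 0 < k4.
  rewrite /k4; move: (512 : R) c512 => e e0.
  by rewrite (mulr_gt0 (mulr_gt0 (mulr_gt0 (mulr_gt0 (mulr_gt0 e0 d10) c0) D0) D0) c20).
have k50 : 0 < k5.
  rewrite /k5; move: (4096 : R) c4096 => e e0.
  by rewrite (mulr_gt0 (mulr_gt0 (mulr_gt0 (mulr_gt0 (mulr_gt0 e0 d10) c0) c20) S0) S0).
exists (k1 + k2 + 4 + k4 + k5); first by rewrite !addr_gt0 // ltr0n.
move=> n m idx m0 idx_lt idx_inj idx_surj nE sigma V P Lw L0 s0 V0 P0 La.
have /choice[K /choice[bs /choice[bv HB]]] := fun j => whitney_blocks (m j) (m0 j).
have Km j : (2 ^ K j <= m j)%N by have [] := HB j.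
have blkP j c' k : bv j c' k -> [/\ (k <= K j)%N, (2 ^ k <= bs j c' k + 1)%N &
     (bs j c' k + 2 * 2 ^ k <= m j + 1)%N] by have [_ h _] := HB j; exact: h.
have blk_cover j x : (x < m j)%N ->
    (\sum_(c' < 3) \sum_(k < (K j).+1) (bv j c' k && in_block (bs j c' k) k x) = 1)%N.
  by have [_ _ h] := HB j; exact: h.
pose M := (\max_j m j)%N; pose Q := (\max_j K j).+1.
have mM j : (m j <= M)%N by exact: (leq_bigmax j).
have KQ j : (K j < Q)%N by rewrite ltnS; exact: (leq_bigmax j).
have bvK j c' k : bv j c' k -> (k <= K j)%N by move=> /blkP[].
have HG (p : {ffun 'I_d -> 'I_3 * 'I_Q} * nat) : exists G : ('I_n -> R) -> R,
    valid_block bv Q p.1 -> (0 < p.2)%N -> [/\ forall z, 0 <= G z,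
    gaussian_mean_le sigma G
      (32 * sigma ^+ 2 * (block_volume Q p.1 * 2^-1 ^+ p.2 * p.2.+1%:R ^+ d.-1) * (p.2.+1%:R * d.+1%:R)) &
    forall f z, entirely_monotone f ->
      `|\sum_(w | total_level w == p.2) grid_coef idx bs bv M Q z (p.1, w) *
          grid_coef idx bs bv M Q (fun i => grid_value m f (idx i)) (p.1, w)|
      <= block_increment m bs Q f p.1 * Num.sqrt (G z)].
  have [vb|vb] := boolP (valid_block bv Q p.1); last by exists (fun=> 0).
  have [p0|p0] := posnP p.2; first by exists (fun=> 0); rewrite p0.
  have [G GP] := layer_bound m idx m0 idx_lt idx_inj idx_surj K bs bv blkP blk_cover M Q mM KQ
    sigma p.1 p.2 s0 vb p0.
  by exists G.
have /choice[G GP] := HG.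
have [F [FE FP]] := grid_risk m idx m0 idx_lt idx_inj idx_surj K bs bv blkP blk_cover M Q mM KQ d0
  c sigma c_sum s0 (fun b l => G (b, l)) (cutoff_level K Q Lw L0) (fun b l => GP (b, l))
  V P (block_weight K Q) V0 P0 (block_weight_gt0 K Q).
exists F; split; last exact: FP.
apply: gaussian_mean_le_trans FE => //.
have T1 := @low_level_sum_le R d K bv Q bvK KQ Lw L0.
have W1 := @block_weight_sum_le R d K bv Q bvK KQ.
have T2 := @high_level_sum_le R d K bv Q bvK KQ m Km Lw L0 c2 c2P (ltW c20).
have T3 := @cutoff_tail_sum_le R d K bv Q Lw L0 c2 c2P.
have N1 := @valid_card_le R d K bv Q bvK KQ.
have n0 : (0 < n)%N by rewrite nE prodn_gt0.
have La1 : 1 <= La by rewrite lerDl ln_ge0 // ler1n.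
have NS : \sum_(b | valid_block bv Q b) 1 <= S * La ^+ d :> R.
  apply: le_trans N1 _; rewrite /S -exprMn -[X in _ ^+ X](card_ord d) -prodr_const.
  apply: ler_prod => j _; rewrite mulr_ge0 ?ler0n //=.
  have mn : (m j <= n)%N by rewrite nE (bigD1 j) //= leq_pmulr // prodn_gt0.
  by have := @depth_le_log R (K j) n n0 (leq_trans (Km j) mn); rewrite -/La; lra.
move: T1 W1 T2 T3 NS; rewrite -/D.
have -> : \prod_j (m j)%:R = n%:R :> R by rewrite nE natr_prod.
have card0 : 0 <= \sum_(b | valid_block bv Q b) 1 :> R by apply: sumr_ge0.
have T20 : 0 <= \sum_(b | valid_block bv Q b) block_volume Q b *
     (2^-1 ^+ cutoff_level K Q Lw L0 b * (cutoff_level K Q Lw L0 b).+1%:R ^+ d) / block_weight K Q b :> R.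
  apply: sumr_ge0 => b _; rewrite divr_ge0 ?(ltW (block_weight_gt0 _ _ _)) //.
  by rewrite !mulr_ge0 ?exprn_ge0 ?ler0n ?invr_ge0 ?(ltW (block_volume_gt0 _ _)).
have T30 : 0 <= \sum_(b | valid_block bv Q b)
     2^-1 ^+ cutoff_level K Q Lw L0 b * (cutoff_level K Q Lw L0 b).+1%:R ^+ d :> R.
  by apply: sumr_ge0 => b _; rewrite mulr_ge0 ?exprn_ge0 ?ler0n ?invr_ge0.
have a10 : 0 <= 2 ^+ Lw * Lw.+1%:R ^+ d.-1 :> R by rewrite mulr_ge0 ?exprn_ge0 ?ler0n.
have a20 : 0 <= 2 ^+ L0 * L0.+1%:R ^+ d.-1 :> R by rewrite mulr_ge0 ?exprn_ge0 ?ler0n.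
have a40 : 0 <= 2^-1 ^+ L0 * L0.+1%:R ^+ d :> R by rewrite mulr_ge0 ?exprn_ge0 ?ler0n ?invr_ge0.
have a50 : 0 <= 2^-1 ^+ Lw * Lw.+1%:R ^+ d :> R by rewrite mulr_ge0 ?exprn_ge0 ?ler0n ?invr_ge0.
have Lad : 0 <= La ^+ d by rewrite exprn_ge0 //; lra.
move: card0 T20 T30 a10 a20 a40 a50 Lad.
move: (\sum_(b | valid_block bv Q b) 1 : R) => N.
move: (\sum_(b | _) block_volume Q b * _ / _) => t2.
move: (\sum_(b | _) 2 ^+ cutoff_level _ _ _ _ b * _) => t1.
move: (\sum_(b | _) block_weight _ _ b) => w1.
move: (\sum_(b | _) _) => t3.
move: (2 ^+ Lw * _) (2 ^+ L0 * _) (2^-1 ^+ L0 * _) (2^-1 ^+ Lw * _) (La ^+ d) => a1 a2 a4 a5 Ld.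
move=> N0 t20 t30 a10 a20 a40 a50 Ld0 T1 W1 T2 T3 NS.
have sg0 : 0 < sigma ^+ 2 by rewrite exprn_gt0.
set B := V ^+ 2 * n%:R / sigma ^+ 2 / P.
have B0 : 0 <= B by rewrite /B !mulr_ge0 ?invr_ge0 ?ler0n ?(ltW P0) ?(ltW sg0) // sqr_ge0.
have p1 : 0 <= Ld * a1 by rewrite mulr_ge0.
have p4 : 0 <= B * a4 by rewrite mulr_ge0.
have p5 : 0 <= Ld * Ld * a5 by rewrite !mulr_ge0.
have q1 : 512 * t1 <= k1 * (Ld * a1) + k2 * a2.
  by move: T1 (ler_wpM2r a10 NS); rewrite /k1 /k2; clear; lra.
have q4 : 512 * d1 * c * (V ^+ 2 / P) * w1 * t2 <= sigma ^+ 2 * (k4 * (B * a4)).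
  have h : w1 * t2 <= D * (D * (n%:R * c2 * a4)).
    apply: le_trans (ler_wpM2r t20 W1) _; exact: ler_wpM2l (ltW D0) _ _ T2.
  have h0 : 0 <= 512 * d1 * c * (V ^+ 2 / P).
    apply: mulr_ge0; last by rewrite divr_ge0 ?sqr_ge0 ?(ltW P0).
    exact: mulr_ge0 (mulr_ge0 (ltW c512) (ltW d10)) (ltW c0).
  rewrite -mulrA; apply: le_trans (ler_wpM2l h0 h) _.
  rewrite le_eqVlt; apply/orP; left; apply/eqP; rewrite /k4 /B; field.
  by rewrite !gt_eqF.
have q5 : 4096 * d1 * c * N * t3 <= k5 * (Ld * Ld * a5).
  have h : N * t3 <= (S * Ld) * (S * Ld * (c2 * a5)).
    apply: ler_pM => //; apply: le_trans T3 _.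
    by rewrite ler_wpM2r // mulr_ge0 // ltW.
  have h0 : 0 <= 4096 * d1 * c := mulr_ge0 (mulr_ge0 (ltW c4096) (ltW d10)) (ltW c0).
  rewrite -mulrA; apply: le_trans (ler_wpM2l h0 h) _.
  by rewrite le_eqVlt; apply/orP; left; apply/eqP; rewrite /k5; ring.
apply: (@le_trans _ _ (sigma ^+ 2 * (k1 * (Ld * a1) + k2 * a2 + 4 * P + k4 * (B * a4) + k5 * (Ld * Ld * a5)))).
  by move: q4 (ler_wpM2l (ltW sg0) q1) (ler_wpM2l (ltW sg0) q5); rewrite -/d1; clear; lra.
rewrite [_ * sigma ^+ 2]mulrC -[leRHS]mulrA ler_wpM2l ?(ltW sg0) //.
set k := k1 + k2 + 4 + k4 + k5.
have [l1 l2 l3 l4 l5] : [/\ k1 <= k, k2 <= k, 4 <= k, k4 <= k & k5 <= k].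
  by move: k10 k20 k40 k50; clear; rewrite /k; split; lra.
by rewrite !mulrDr !lerD // ler_wpM2r // ltW.
Qed.

(** * Explicit cutoffs and the two rates *)

Lemma dyadic_floor {R : realType} (x : R) : 1 <= x ->
  exists k : nat, 2 ^+ k <= x < 2 ^+ k.+1.
Proof.
move=> x1; have ex : exists k : nat, x < 2 ^+ k.+1.
  exists (Num.truncn x); apply: lt_le_trans (truncnS_gt _) _.
  by rewrite -natrX ler_nat; apply: ltnW; exact: ltn_expl.
case: (ex_minnP ex) => k xk kmin; exists k; rewrite xk andbT.
case: k xk kmin => [|k] xk kmin; first by rewrite expr0.
by rewrite leNgt; apply/negP => /kmin; rewrite ltnn.
Qed.

Lemma dyadic_exponent_le {R : realType} (k : nat) (x : R) : 2 ^+ k <= x -> k%:R <= 2 * ln x.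
Proof.
move=> kx; have x0 : 0 < x by apply: lt_le_trans kx; rewrite exprn_gt0.
have : ln (2 ^+ k) <= ln x by rewrite ler_ln ?posrE ?exprn_gt0.
rewrite lnXn // -[_ *+ k]mulr_natl.
have := ler_wpM2l (ler0n R k) (@ln2_ge_half R); lra.
Qed.

Lemma ln_le_id {R : realType} (x : R) : 0 < x -> ln x <= x.
Proof.
move=> x0; have h := @le_ln1Dx R (x - 1) ltac:(lra).
rewrite (_ : 1 + (x - 1) = x) in h; lra.
Qed.

Lemma powR_gt0_mul {R : realType} (x r t : R) : 0 < x -> x `^ r * x `^ t = x `^ (r + t).
Proof. by move=> x0; rewrite powRD // (gt_eqF x0) implybT. Qed.

(** With l = 1 + ln La, 2^Lw about X = La^(d/2) l^(1/2) and Lw at most of order l, the costs La^d X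
    l^(d-1) and La^(2d) l^d / X both equal [Y]. *)
Lemma low_cutoff_choice {R : realType} (d : nat) (La : R) : (0 < d)%N -> 1 <= La ->
  let Y := La `^ (3 * d%:R / 2) * (1 + ln La) `^ ((2 * d%:R - 1) / 2) in
  1 <= Y /\ exists Lw : nat,
    La ^+ d * (2 ^+ Lw * Lw.+1%:R ^+ d.-1) <= 2 * d.+2%:R ^+ d * Y /\
    La ^+ d * La ^+ d * (2^-1 ^+ Lw * Lw.+1%:R ^+ d) <= 2 * d.+2%:R ^+ d * Y.
Proof.
move=> d0 La1 Y; set l := 1 + ln La.
have La0 : 0 < La by lra.
have d1 : 1 <= d%:R :> R by rewrite ler1n.
have lnLa : 0 <= ln La by apply: ln_ge0.
have l1 : 1 <= l by rewrite /l; lra.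
have l0 : 0 < l by lra.
have ge1 (a b : R) : 1 <= a -> 0 <= b -> 1 <= a `^ b.
  by move=> a1 b0; rewrite -(powRr0 a) ler_powR.
split; first by rewrite -[X in X <= _]mulr1; apply: ler_pM => //; apply: ge1 => //; lra.
pose X := La `^ (d%:R / 2) * l `^ (1 / 2).
have X1 : 1 <= X by rewrite -[X in X <= _]mulr1; apply: ler_pM => //; apply: ge1 => //; lra.
have X0 : 0 < X by lra.
have [k /andP[k1 k2]] := dyadic_floor X X1; exists k.
have kl : k.+1%:R <= d.+2%:R * l.
  have h := dyadic_exponent_le k X k1.
  rewrite /X lnM ?posrE ?powR_gt0 // !ln_powR in h.
  have h1 : ln l <= l by exact: ln_le_id.
  have h2 : ln La <= l by rewrite /l; lra.
  have h3 : d%:R * ln La <= d%:R * l by rewrite ler_wpM2l //; lra.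
  rewrite -[k.+1%:R]natr1 -[d.+2%:R]natr1 -[d.+1%:R]natr1; lra.
have dl0 : 0 <= d.+2%:R * l by rewrite mulr_ge0 ?ler0n //; lra.
have Xd : La ^+ d * X * l ^+ d.-1 = Y.
  rewrite /X /Y -/l -!powR_mulrn ?(ltW La0) ?(ltW l0) // mulrA powR_gt0_mul //.
  rewrite -mulrA powR_gt0_mul //.
  congr (_ `^ _ * _ `^ _); first by field.
  by rewrite -[in RHS](prednK d0) -natr1; field.
have YX : La ^+ d * La ^+ d / X * l ^+ d = Y.
  have -> : l ^+ d = l * l ^+ d.-1 by rewrite -exprS prednK.
  rewrite -Xd.
  have XX : X * X = La ^+ d * l.
    rewrite /X mulrACA !powR_gt0_mul //.
    rewrite (_ : d%:R / 2 + d%:R / 2 = d%:R); last by field.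
    rewrite (_ : 1 / 2 + 1 / 2 = 1 :> R); last by field.
    by rewrite powR_mulrn ?(ltW La0) // powRr1 // ltW.
  have -> : La ^+ d * La ^+ d / X * (l * l ^+ d.-1) = La ^+ d * (La ^+ d * l) / X * l ^+ d.-1 by ring.
  by rewrite -XX; field; rewrite gt_eqF.
have Lad : 0 <= La ^+ d by rewrite exprn_ge0 // ltW.
have Y0 : 0 <= Y by rewrite /Y mulr_ge0 ?powR_ge0.
have dd : 1 <= d.+2%:R :> R by rewrite ler1n.
split.
- apply: (@le_trans _ _ (La ^+ d * (X * (d.+2%:R * l) ^+ d.-1))).
    rewrite ler_wpM2l //; apply: ler_pM; rewrite ?exprn_ge0 ?ler0n //.
    by rewrite lerXn2r ?nnegrE ?ler0n.
  have -> : La ^+ d * (X * (d.+2%:R * l) ^+ d.-1) = d.+2%:R ^+ d.-1 * Y.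
    by rewrite exprMn -Xd; ring.
  rewrite ler_wpM2r //; have : d.+2%:R ^+ d.-1 <= d.+2%:R ^+ d :> R by rewrite ler_weXn2l ?leq_pred.
  have : 0 <= d.+2%:R ^+ d :> R by rewrite exprn_ge0 ?ler0n.
  by move: (d.+2%:R ^+ d.-1 : R) (d.+2%:R ^+ d : R) => u v; lra.
- have h : 2^-1 ^+ k <= 2 / X :> R.
    rewrite ler_pdivlMr // exprVn ler_pdivrMl ?exprn_gt0 // -exprSr; exact: ltW.
  apply: (@le_trans _ _ (La ^+ d * La ^+ d * (2 / X * (d.+2%:R * l) ^+ d))).
    rewrite ler_wpM2l ?mulr_ge0 //; apply: ler_pM; rewrite ?exprn_ge0 ?ler0n ?invr_ge0 //.
    by rewrite lerXn2r ?nnegrE ?ler0n.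
  by rewrite exprMn -YX le_eqVlt; apply/orP; left; apply/eqP; ring.
Qed.

(** With l = 1 + ln (2 + A) bounding L0 up to a constant, the three terms Q l^(d-1), P and A^2 l^d /
    (P Q), where Q stands for 2^L0, coincide for Q = A^(2/3) l^((2-d)/3); the common value is B =
    A^(2/3) l^((2d-1)/3). Taking P = 1 + B keeps it positive at A = 0. *)
Lemma high_cutoff_choice {R : realType} (d : nat) : (0 < d)%N ->
  exists2 C : R, 0 < C & forall A : R, 0 <= A ->
  exists (L0 : nat) (P : R), 0 < P /\
    2 ^+ L0 * L0.+1%:R ^+ d.-1 + P + A ^+ 2 / P * (2^-1 ^+ L0 * L0.+1%:R ^+ d) <=
    C * (1 + A `^ (2 / 3) * (ln (2 + A)) `^ ((2 * d%:R - 1) / 3)).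
Proof.
move=> d0; have d1 : 1 <= d%:R :> R by rewrite ler1n.
pose g : R := (2 * d%:R - 1) / 3; have g0 : 0 <= g by rewrite /g; lra.
(* Since ln (2 + A) >= 1/2, the quantity 1 + ln (2 + A) is at most 3 ln (2 + A); [C1] pays for this
   replacement. *)
pose C1 : R := 3 `^ g; have C10 : 0 < C1 by rewrite powR_gt0.
have C11 : 1 <= C1 by rewrite /C1 -[X in X <= _](powRr0 3) ler_powR //; lra.
have T1 : 1 <= 3 ^+ d :> R by rewrite exprn_ege1 //; lra.
exists (4 * 3 ^+ d * C1) => [|A A0]; first by rewrite !mulr_gt0 ?exprn_gt0.
pose l := 1 + ln (2 + A).
have ln2 := @ln2_ge_half R.
have ln2A : ln 2 <= ln (2 + A) by rewrite ler_ln ?posrE; lra.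
have l1 : 1 <= l by rewrite /l; lra.
have l0 : 0 < l by lra.
pose B := A `^ (2 / 3) * l `^ g.
have B0 : 0 <= B by rewrite mulr_ge0 ?powR_ge0.
suff [L0 [P [P0 HP]]] : exists (L0 : nat) (P : R), 0 < P /\
    2 ^+ L0 * L0.+1%:R ^+ d.-1 + P + A ^+ 2 / P * (2^-1 ^+ L0 * L0.+1%:R ^+ d) <= 4 * 3 ^+ d * (1 + B).
  exists L0, P; split=> //; apply: le_trans HP _.
  rewrite -[leRHS]mulrA ler_wpM2l ?mulr_ge0 ?exprn_ge0 //.
  have : B <= C1 * (A `^ (2 / 3) * ln (2 + A) `^ g).
    rewrite /B mulrCA ler_wpM2l ?powR_ge0 // -powRM; [|lra|lra].
    by apply: ge0_ler_powR; rewrite ?nnegrE /l; lra.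
  move: (A `^ (2 / 3) * _) => w; lra.
pose Q := A `^ (2 / 3) * l `^ ((2 - d%:R) / 3).
(* For Q < 1 the cutoff is 0: then A^(4/3) <= l^((2d-4)/3), whence A^2 <= B. *)
have [Q1|Q1] := leP 1 Q; last first.
  exists 0%N, (1 + B); split; first by lra.
  have h : A ^+ 2 <= B.
    have h1 : A `^ (2 / 3) <= l `^ ((d%:R - 2) / 3).
      have lp : 0 < l `^ ((d%:R - 2) / 3) by rewrite powR_gt0.
      have e : l `^ ((d%:R - 2) / 3) * l `^ ((2 - d%:R) / 3) = 1.
        rewrite powR_gt0_mul //.
        have -> : (d%:R - 2) / 3 + (2 - d%:R) / 3 = 0 :> R by field.
        by rewrite powRr0.
      have := ler_wpM2l (ltW lp) (ltW Q1); rewrite /Q mulrCA e !mulr1; exact.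
    have -> : A ^+ 2 = A `^ (2 / 3) * (A `^ (2 / 3) * A `^ (2 / 3)).
      have [->|An0] := eqVneq A 0; first by rewrite powR0 ?expr0n ?mul0r //; lra.
      have Ap : 0 < A by rewrite lt_def An0.
      rewrite !powR_gt0_mul //.
      by rewrite -powR_mulrn //; congr (_ `^ _); field.
    rewrite /B ler_wpM2l ?powR_ge0 //.
    apply: le_trans (ler_pM (powR_ge0 _ _) (powR_ge0 _ _) h1 h1) _.
    rewrite powR_gt0_mul //.
    by apply: ler_powR => //; rewrite /g; lra.
  have h2 : A ^+ 2 / (1 + B) <= B.
    rewrite ler_pdivrMr; last by lra.
    have := sqr_ge0 B; rewrite expr2 => ?; lra.
  rewrite !expr0 !expr1n !mulr1.
  have h3 : 1 + B <= 3 ^+ d * (1 + B) by rewrite ler_peMl //; lra.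
  lra.
have [k /andP[k1 k2]] := dyadic_floor Q Q1.
have A1 : 0 < A.
  rewrite lt_def A0 andbT; apply: contraTneq Q1 => A00.
  by rewrite /Q A00 powR0 ?mul0r -?ltNge ?ltr01 //; lra.
have Q0 : 0 < Q by lra.
have BB : 0 < B by rewrite mulr_gt0 ?powR_gt0.
exists k, (1 + B); split; first by lra.
have kl : k.+1%:R <= 3 * l.
  have h := dyadic_exponent_le k Q k1.
  rewrite /Q lnM ?posrE ?powR_gt0 // !ln_powR in h.
  have h1 : ln l <= l by exact: ln_le_id.
  have h2 : ln A <= l.
    have : ln A <= ln (2 + A) by rewrite ler_ln ?posrE; lra.
    by rewrite /l; lra.
  have h3 : 0 <= ln l by apply: ln_ge0.
  have h4 : (2 - d%:R) / 3 * ln l <= 1 / 3 * ln l by rewrite ler_wpM2r //; lra.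
  rewrite -[k.+1%:R]natr1; lra.
have BQ : Q * l ^+ d.-1 = B.
  rewrite /Q /B -powR_mulrn ?(ltW l0) // -mulrA powR_gt0_mul //.
  congr (_ * _ `^ _); have -> : d.-1%:R = d%:R - 1 :> R by rewrite -subn1 natrB.
  by rewrite /g; field.
have AQ : A ^+ 2 / Q * l ^+ d = B * B.
  have e : A ^+ 2 = A `^ (2 / 3) * A `^ (2 / 3) * A `^ (2 / 3).
    rewrite !powR_gt0_mul //.
    by rewrite -powR_mulrn //; congr (_ `^ _); field.
  have e2 : l ^+ d = l `^ g * l `^ g * l `^ ((2 - d%:R) / 3).
    rewrite !powR_gt0_mul //.
    by rewrite -powR_mulrn ?(ltW l0) //; congr (_ `^ _); rewrite /g; field.
  rewrite e e2 /Q /B; field.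
  by rewrite !gt_eqF ?powR_gt0.
have f1 : 2 ^+ k * k.+1%:R ^+ d.-1 <= 3 ^+ d * B.
  apply: (@le_trans _ _ (Q * (3 * l) ^+ d.-1)).
    apply: ler_pM; rewrite ?exprn_ge0 ?ler0n //.
    by rewrite lerXn2r ?nnegrE ?ler0n // mulr_ge0 // ltW.
  rewrite exprMn mulrCA BQ ler_wpM2r //.
  by rewrite ler_weXn2l ?leq_pred //; lra.
have f2 : A ^+ 2 / (1 + B) * (2^-1 ^+ k * k.+1%:R ^+ d) <= 2 * 3 ^+ d * B.
  have h : 2^-1 ^+ k <= 2 / Q :> R.
    rewrite ler_pdivlMr // exprVn ler_pdivrMl ?exprn_gt0 // -exprSr; exact: ltW.
  apply: (@le_trans _ _ (A ^+ 2 / B * (2 / Q * (3 * l) ^+ d))).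
    apply: ler_pM.
    - by rewrite divr_ge0 ?sqr_ge0 //; lra.
    - by rewrite mulr_ge0 ?exprn_ge0 ?ler0n ?invr_ge0.
    - by rewrite ler_wpM2l ?sqr_ge0 // lef_pV2 ?posrE; lra.
    - apply: ler_pM; rewrite ?exprn_ge0 ?ler0n ?invr_ge0 //.
      by rewrite lerXn2r ?nnegrE ?ler0n // mulr_ge0 // ltW.
  have -> : A ^+ 2 / B * (2 / Q * (3 * l) ^+ d) = 2 * 3 ^+ d * (A ^+ 2 / Q * l ^+ d) / B.
    by rewrite exprMn; field; rewrite !gt_eqF.
  by rewrite AQ le_eqVlt; apply/orP; left; apply/eqP; field; rewrite gt_eqF.
have f3 : 1 + B <= 3 ^+ d * (1 + B) by rewrite ler_peMl //; lra.
have := exprn_ge0 d (ler0n R 3); move: (3 ^+ d : R) f1 f2 f3 => t f1 f2 f3 t0; lra.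
Qed.

(** * The risk bound *)

Lemma em_loss_basic_inequality {R : realType} (d n : nat) (x : 'I_n -> 'I_d -> R)
    (z y : 'I_n -> R) (f g : ('I_d -> R) -> R) : (0 < n)%N ->
  (forall i, y i = g (x i) + z i) -> entirely_monotone g -> EM_least_squares x y f ->
  \sum_i (f (x i) - g (x i)) ^+ 2 <= 2 * \sum_i z i * (f (x i) - g (x i)).
Proof.
move=> n0 yE gEM [_ /(_ g gEM)]; rewrite ler_pM2l ?invr_gt0 ?ltr0n // => h.
rewrite -subr_ge0; move: h; rewrite -subr_ge0 -sumrB mulr_sumr -sumrB.
by under eq_bigr do rewrite yE; move=> h; apply: le_trans h _; rewrite le_eqVlt;
  apply/orP; left; apply/eqP; apply: eq_bigr => i _; ring.
Qed.

(** The base on the left is (sigma / sqrt n)^3 times V sqrt n / sigma, the parameter in which the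
    cutoffs are chosen. *)
Lemma scaled_rate {R : realType} (n : nat) (sigma V : R) : (0 < n)%N -> 0 < sigma -> 0 <= V ->
  (sigma ^+ 2 * V / n%:R) `^ (2 / 3) =
  sigma ^+ 2 / n%:R * (V * Num.sqrt n%:R / sigma) `^ (2 / 3).
Proof.
move=> n0 s0 V0; have nR : 0 < n%:R :> R by rewrite ltr0n.
set q := Num.sqrt n%:R; have q0 : 0 < q by rewrite sqrtr_gt0.
have qq : q ^+ 2 = n%:R by rewrite sqr_sqrtr // ltW.
have A0 : 0 <= V * q / sigma by rewrite divr_ge0 ?mulr_ge0 // ltW.
have t0 : 0 <= sigma / q by rewrite divr_ge0 // ltW.
have -> : sigma ^+ 2 * V / n%:R = (sigma / q) ^+ 3 * (V * q / sigma).
  by rewrite -qq; field; rewrite !gt_eqF.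
rewrite powRM ?exprn_ge0 // -powR_mulrn // -powRrM.
have -> : 3%:R * (2 / 3) = 2%:R :> R by field.
by rewrite powR_mulrn // expr_div_n qq.
Qed.

Theorem theorem4p1 (R : realType) (d : nat) (hd : (1 <= d)%N) :
  exists C : R,
  forall (m : 'I_d -> nat) (hm : forall j, (1 <= m j)%N)
    (n : nat) (hn : n = (\prod_(j < d) m j)%N)
    (x : 'I_n -> 'I_d -> R)
    (hx : set_bij [set: 'I_n] (lattice_design m) x)
    (sigma : R) (hsigma : 0 < sigma)
    (fstar : ('I_d -> R) -> R) (hfstar : entirely_monotone fstar)
    (V : R) (hV : V = fine (HK0_variation fstar))
    (dT : measure_display) (T : measurableType dT) (P : probability T R)
    (xi : 'I_n -> {RV P >-> R})
    (hxi_indep : mutually_independent xi)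
    (hxi_normal : forall i, normally_distributed 0 sigma (xi i))
    (y : 'I_n -> T -> R) (hy : forall i w, y i w = fstar (x i) + xi i w)
    (fhat : T -> ('I_d -> R) -> R)
    (hfhat : forall w, EM_least_squares x (y ^~ w) (fhat w)),
  let e : R := expR 1 in
  (risk P x fhat fstar <=
    (C * (sigma ^+ 2 * V / n%:R) `^ (2 / 3)
       * ln (2 + V * Num.sqrt n%:R / sigma) `^ ((2 * d%:R - 1) / 3)
     + C * (sigma ^+ 2 / n%:R)
       * ln (e * n%:R) `^ (3 * d%:R / 2)
       * ln (e * ln (e * n%:R)) `^ ((2 * d%:R - 1) / 2))%:E)%E.
Proof.
have [C0 C00 HC0] := @grid_risk_optimized R d hd.
have [C2 C20 HC2] := @high_cutoff_choice R d hd.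
pose c1 : R := 2 * d.+2%:R ^+ d.
have c10 : 0 <= c1 by rewrite mulr_ge0 ?exprn_ge0 ?ler0n.
exists (C0 * (2 * c1 + C2)).
move=> m hm n hn x hx sigma hsigma fstar hfstar V hV dT T P xi ind nor y hy fhat hfhat.
cbv zeta; set e := expR 1.
have n0 : (0 < n)%N by rewrite hn prodn_gt0.
have nR : 0 < n%:R :> R by rewrite ltr0n.
have [hx1 hx2 hx3] := hx.
have /choice[idx Hidx] : forall i, exists u : 'I_d -> nat,
    (forall j, (u j < m j)%N) /\ x i = fun j => (u j)%:R / (m j)%:R.
  by move=> i; have [u um uE] := hx1 i I; exists u.
have idx_lt i j : (idx i j < m j)%N by exact: (Hidx i).1.
have xE i : x i = fun j => (idx i j)%:R / (m j)%:R by exact: (Hidx i).2.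
have idx_inj i i' : (forall j, idx i j = idx i' j) -> i = i'.
  move=> h; apply: hx2; rewrite ?inE // !xE; apply/funext => j; by rewrite h.
have idx_surj u : (forall j, u j < m j)%N -> exists i, forall j, idx i j = u j.
  move=> um; have [i _ iE] := hx3 (fun j => (u j)%:R / (m j)%:R) (ex_intro2 _ _ u um erefl).
  exists i => j; move: (congr1 (fun h => h j) iE); rewrite xE => /mulIf h.
  apply/eqP; rewrite -(eqr_nat R); apply/eqP/h.
  by rewrite invr_eq0 pnatr_eq0 -lt0n.
have gapV : fstar (fun=> 1) - fstar (fun=> 0) <= V by rewrite hV; exact: em_HK0_variation_ge.
have V0 : 0 <= V.
  apply: le_trans gapV; rewrite subr_ge0; apply: (em_le fstar hfstar) => j; rewrite ?lexx ?ler01 //.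
set A := V * Num.sqrt n%:R / sigma.
have A0 : 0 <= A by rewrite divr_ge0 ?mulr_ge0 ?sqrtr_ge0 // ltW.
have [L0 [Pr [Pr0 HPr]]] := HC2 A A0.
(* [La] is ln (e n), and 1 + ln La is ln (e ln (e n)). *)
pose La : R := 1 + ln n%:R.
have La1 : 1 <= La by rewrite lerDl ln_ge0 // ler1n.
have [Y1 [Lw [HY1 HY2]]] := low_cutoff_choice d La hd La1.
have [F [FE FP]] := HC0 n m idx hm idx_lt idx_inj idx_surj hn sigma V Pr Lw L0 hsigma V0 Pr0.
have ln_e t : 0 < t -> ln (e * t) = 1 + ln t :> R.
  by move=> t0; rewrite lnM ?posrE ?expR_gt0 // /e expRK.
rewrite (ln_e _ nR) -/La ln_e; last by lra.
set Y := La `^ (3 * d%:R / 2) * (1 + ln La) `^ ((2 * d%:R - 1) / 2) in Y1 HY1 HY2.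
have nV0 : 0 <= n%:R^-1 :> R by rewrite invr_ge0 ltW.
have EF := gaussian_mean_scale sigma F _ _ nV0 FE.
rewrite /risk unlock.
apply: le_trans (expectation_gaussian_mean_le sigma P xi _ _ _ hsigma ind nor EF _) _.
  move=> w; rewrite /loss mulr_ge0 ?sumr_ge0 //=; last by move=> i _; rewrite sqr_ge0.
  have gv h i : h (x i) = grid_value m h (idx i) by rewrite xE.
  rewrite ler_wpM2l //.
  have := FP (fhat w) fstar (fun i => xi i w) (hfhat w).1 hfstar gapV.
  rewrite /=; under eq_bigr do rewrite -!gv.
  under [X in _ <= 2 * X]eq_bigr do rewrite -!gv.
  apply; apply: (em_loss_basic_inequality _ _ x _ (y ^~ w)) => //.
rewrite lee_fin scaled_rate // -/A.
set B := A `^ (2 / 3) * ln (2 + A) `^ ((2 * d%:R - 1) / 3) in HPr.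
have A2 : V ^+ 2 * n%:R / sigma ^+ 2 = A ^+ 2.
  by rewrite /A expr_div_n exprMn sqr_sqrtr // ltW.
rewrite A2 -/La.
set S := (X in C0 * _ * X).
(* The additive 1 in the bound for the choice of [L0] is absorbed into the second term of the
   theorem because Y >= 1. *)
have HS : S <= (2 * c1 + C2) * (B + Y).
  have B0 : 0 <= B by rewrite mulr_ge0 ?powR_ge0.
  have cB : 0 <= c1 * B by rewrite mulr_ge0.
  have cY : C2 <= C2 * Y by rewrite ler_peMr // ltW.
  rewrite /S; move: HPr HY1 HY2; rewrite -/c1.
  move: (La ^+ d * (_ * _)) (La ^+ d * La ^+ d * _) (2 ^+ L0 * _) (A ^+ 2 / Pr * _) => s1 s2 s3 s4.
  lra.
have k0 : 0 <= n%:R^-1 * (C0 * sigma ^+ 2) by rewrite !mulr_ge0 // ltW // exprn_gt0.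
rewrite mulrA; apply: le_trans (ler_wpM2l k0 HS) _.
rewrite le_eqVlt; apply/orP; left; apply/eqP; rewrite /B /Y.
ring.
Qed.
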